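(* Let $(G_0,H_0)$ be a reduced Hecke pair with Hecke algebra $\mathcal{H}$. Then there is a category equivalence between the $H_0$-smooth representations of $G_0$ and the $\langle\cdot,\cdot\rangle_R$-positive representations of $\mathcal{H}$.
   Context: $(G_0,H_0)$ ($H_0$ a subgroup of a group $G_0$) is a Hecke pair if every double coset $H_0xH_0$ is a finite union of left cosets of $H_0$; it is reduced if $\bigcap_{x\in G_0}xH_0x^{-1}=\{e\}$. Let $\mathrm{Map}(G_0/H_0)$ be the set of all maps $G_0/H_0\to G_0/H_0$ with the topology of pointwise convergence ($G_0/H_0$ discrete), and let $\theta(x)(yH_0)=xyH_0$. The Schlichting completion $(G,H)$ of $(G_0,H_0)$ is $G=\overline{\theta(G_0)}$, $H=\overline{\theta(H_0)}$ (closures in $\mathrm{Map}(G_0/H_0)$); $G$ is a locally compact group, $H$ is a compact open subgroup, and $G_0$ is identified with the dense subgroup $\theta(G_0)$. Left Haar measure on $G$ is normalized so that $H$ has measure $1$; $C_c(G)$ is the usual convolution $*$-algebra with $f^*(x)=\overline{f(x^{-1})}\Delta(x^{-1})$, and $p=\chi_H$ is a projection in it. The Hecke algebra $\mathcal{H}$ of $(G_0,H_0)$ is identified with $pC_c(G)p$ (via $\chi_{H_0xH_0}\leftrightarrow\chi_{HxH}$). The $\mathcal{H}$-valued inner product on $C_c(G)p$ is $\langle f,g\rangle_R=f^*g$. A representation $\pi$ of $\mathcal{H}$ (a nondegenerate $*$-representation by bounded operators on a Hilbert space) is $\langle\cdot,\cdot\rangle_R$-positive if $\pi(f^*f)\ge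 0$ for all $f\in C_c(G)p$. A unitary representation $\pi$ of $G_0$ on a Hilbert space $V$ (no continuity assumed) is $H_0$-smooth if the closed linear span of $\pi(G_0)V_{\pi,H_0}$ is $V$, where $V_{\pi,H_0}=\{\xi\in V:\pi(h)\xi=\xi\text{ for all }h\in H_0\}$. Morphisms in both categories are the bounded intertwining operators. *)

(* Defs.v *)
From HB Require Import structures.
From mathcomp Require Import all_boot all_order all_algebra.
From mathcomp Require Import generic_quotient complex sesquilinear.
From mathcomp Require Import all_classical all_reals all_analysis.

Set Implicit Arguments.
Unset Strict Implicit.
Unset Printing Implicit Defensive.

Import Order.TTheory GRing.Theory Num.Theory.
Import numFieldNormedType.Exports.

Local Open Scope classical_set_scope.
Local Open Scope quotient_scope.
Local Open Scope ring_scope.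

Definition is_subgroup (G : groupType) (A : set G) : Prop :=
  [/\ A 1%g, (forall x y, A x -> A y -> A (x * y)%g) &
      (forall x, A x -> A (x^-1)%g)].

Definition left_coset (G : groupType) (A : set G) (x : G) : set G :=
  [set (x * h)%g | h in A].

Definition double_coset (G : groupType) (A : set G) (x : G) : set G :=
  [set (h * x * k)%g | h in A & k in A].

Record heckePair := HeckePair {
  hp_group :> groupType;
  hp_sub : set hp_group;
  hp_subgroup : is_subgroup hp_sub;
  hp_finite : forall x : hp_group, exists s : seq hp_group,
    double_coset hp_sub x = \bigcup_(y in [set` s]) left_coset hp_sub y
}.

Definition reduced (P : heckePair) : Prop :=
  \bigcap_(x in [set: P]) [set (x * h * x^-1)%g | h in @hp_sub P] = [set 1%g].

Section LeftCosets.
Variable P : heckePair.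

Definition lcoset_rel (x y : P) : bool := `[< @hp_sub P (x^-1 * y)%g >].

Lemma lcoset_rel_refl : reflexive lcoset_rel.
Proof. by move=> x; apply/asboolP; rewrite mulVg; case: (hp_subgroup P). Qed.

Lemma lcoset_rel_sym : symmetric lcoset_rel.
Proof.
have [_ _ HV] := hp_subgroup P.
by move=> x y; apply/asboolP/asboolP => /HV; rewrite invgM invgK.
Qed.

Lemma lcoset_rel_trans : transitive lcoset_rel.
Proof.
have [_ HM _] := hp_subgroup P.
move=> y x z /asboolP xy /asboolP yz; apply/asboolP.
by have := HM _ _ xy yz; rewrite mulgA mulgK.
Qed.

Canonical lcoset_equiv :=
  EquivRel lcoset_rel lcoset_rel_refl lcoset_rel_sym lcoset_rel_trans.

Definition lcosets := {eq_quot lcoset_rel}.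

HB.instance Definition _ := Choice.on lcosets.
HB.instance Definition _ := EqQuotient.on lcosets.

Definition coset_map := {ptws lcosets -> discrete_topology lcosets}.

HB.instance Definition _ := Topological.on coset_map.

Definition theta (x : P) : coset_map :=
  fun c : lcosets => \pi_lcosets (x * repr c)%g.

Lemma lcoset_eqP (x y : P) :
  \pi_lcosets x = \pi_lcosets y <-> @hp_sub P (x^-1 * y)%g.
Proof.
split=> [/eqP|] H.
  by move: H; rewrite piE => /asboolP.
by apply/eqP; rewrite piE; apply/asboolP.
Qed.

Lemma theta_pi (x y : P) : theta x (\pi_lcosets y) = \pi_lcosets (x * y)%g.
Proof.
apply/lcoset_eqP; rewrite invgM -mulgA mulKg.
by apply/lcoset_eqP; rewrite reprK.
Qed.

Lemma theta1 (c : lcosets) : theta 1%g c = c.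
Proof. by have := theta_pi 1%g (repr c); rewrite mul1g reprK. Qed.

Lemma thetaM (x y : P) (c : lcosets) : theta (x * y)%g c = theta x (theta y c).
Proof.
by rewrite -[c]reprK [theta y _]theta_pi !theta_pi mulgA.
Qed.

Lemma thetaK (x : P) : cancel (theta x) (theta x^-1%g).
Proof. by move=> c; rewrite -thetaM mulVg theta1. Qed.

Lemma closure_ptwsP (A : set coset_map) (s : coset_map) :
  closure A s <-> forall F : seq lcosets,
    exists2 t : coset_map, A t & forall c, c \in F -> t c = s c.
Proof.
split=> [As F|As].
  have : nbhs s [set t : coset_map | forall c, c \in F -> t c = s c].
    elim: F => [|c F IH]; first exact: filterS filterT.
    have nc : nbhs s [set t : coset_map | t c = s c].
      exact: (@proj_continuous lcosets
        (fun _ => discrete_topology lcosets) c s [set d | d = s c]).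
    apply: filterS (filterI nc IH) => t [/= tc tF] d.
    by rewrite inE => /orP[/eqP ->//|/tF].
  by move=> /As[t [At tF]]; exists t.
rewrite closureEcvg /=.
pose B (F : seq lcosets) :=
  [set t : coset_map | A t /\ forall c, c \in F -> t c = s c].
have BF : Filter (filter_from setT B).
  apply: filter_from_filter; first by exists [::].
  move=> F1 F2 _ _; exists (F1 ++ F2) => // t [At tF].
  by split; split=> // c cF; apply: tF; rewrite mem_cat cF ?orbT.
exists (filter_from setT B).
  apply: filter_from_proper => F _.
  by have [t At tF] := As F; exists t.
split; last by move=> C sAC; exists [::] => // t [At _]; exact: sAC.
apply/cvg_sup => c; apply/cvg_image.
  by rewrite eqEsubset; split=> d // _; exists (fun _ => d).
move=> U Uc; exists [set t : coset_map | U (t c)]; last first.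
  rewrite eqEsubset; split=> [_ [t /= Ut <-]//|d Ud].
  by exists (fun _ => d).
by exists [:: c] => // t [_ tc] /=; rewrite tc ?inE //; exact: nbhs_singleton Uc.
Qed.

Definition schlichting := set_type (closure (range theta)).

HB.instance Definition _ := Topological.on schlichting.

Lemma schP (s : schlichting) (F : seq lcosets) :
  exists x : P, forall c, c \in F -> theta x c = val s c.
Proof.
have /closure_ptwsP/(_ F)[_ [x _ <-] xF] : closure (range theta) (val s).
  exact: set_valP.
by exists x.
Qed.

Lemma sch_inj (s : schlichting) : injective (val s).
Proof.
move=> c d; have [x xF] := schP s [:: c; d].
rewrite -!xF ?inE ?eqxx ?orbT //; exact: (can_inj (thetaK x)).
Qed.

Lemma sch_surj (s : schlichting) (d : lcosets) : exists c, val s c = d.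
Proof.
have [H1 HM HV] := hp_subgroup P.
pose e : lcosets := \pi_lcosets 1%g.
have [x xe] := schP s [:: e].
pose t c := theta x^-1%g (val s c).
suff [c tc] : exists c, t c = theta x^-1%g d.
  by exists c; exact: (can_inj (thetaK x^-1%g)).
set d' := theta x^-1%g d.
have te : t e = e by rewrite /t -xe ?inE // thetaK.
have t_inj : injective t.
  by move=> c c' /(can_inj (thetaK _)); exact: sch_inj.
have [r rE] := hp_finite (repr d').
pose O := [seq \pi_lcosets y | y <- r].
have OP h : @hp_sub P h -> theta h d' \in O.
  move=> Hh; have : double_coset (@hp_sub P) (repr d') (h * repr d')%g.
    by exists h => //; exists 1%g => //; rewrite mulg1.
  rewrite rE => -[y /= yr [k Hk hE]].
  apply/mapP; exists y => //.
  by apply/esym/lcoset_eqP; rewrite -hE mulKg.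
pose O' := undup [seq c <- O | `[< exists2 h, @hp_sub P h & theta h d' = c >]].
have O'P c : c \in O' <-> exists2 h, @hp_sub P h & theta h d' = c.
  rewrite mem_undup mem_filter; split=> [/andP[/asboolP]//|[h Hh hc]].
  by apply/andP; split; [apply/asboolP; exists h|rewrite -hc OP].
have tO' c : c \in O' -> t c \in O'.
  move=> /O'P[h Hh <-]; have [y yF] := schP s [:: e; theta h d'].
  apply/O'P; exists (x^-1 * y * h)%g.
    apply: HM => //; have : theta (x^-1 * y)%g e = e.
      by rewrite thetaM yF ?inE ?eqxx // -/(t e) te.
    by rewrite /e theta_pi mulg1 => /esym/lcoset_eqP; rewrite invg1 mul1g.
  by rewrite !thetaM yF ?inE ?eqxx ?orbT.
have d'O : d' \in O' by apply/O'P; exists 1%g => //; rewrite theta1.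
have uO : uniq O' by exact: undup_uniq.
have utO : uniq (map t O') by rewrite map_inj_uniq.
have tOO : {subset map t O' <= O'} by move=> _ /mapP[c /tO' ? ->].
have [|_ /(_ d')] := uniq_min_size utO tOO; first by rewrite size_map.
by rewrite d'O => /mapP[c _ dc]; exists c.
Qed.

Definition sch_inv_fun (s : schlichting) : coset_map :=
  fun d => sval (cid (sch_surj s d)).

Lemma sch_inv_funK (s : schlichting) d : val s (sch_inv_fun s d) = d.
Proof. by rewrite /sch_inv_fun; case: cid. Qed.

Lemma sch_one_subproof : closure (range theta) (theta 1%g).
Proof. by apply: subset_closure; exists 1%g. Qed.

Lemma sch_mul_subproof (s t : schlichting) :
  closure (range theta) ((val s \o val t) : coset_map).
Proof.
apply/closure_ptwsP => F; have [y yF] := schP t F.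
have [x xF] := schP s (map (val t) F).
exists (theta (x * y)%g); first by exists (x * y)%g.
by move=> c cF; rewrite thetaM yF // xF // map_f.
Qed.

Lemma sch_inv_subproof (s : schlichting) :
  closure (range theta) (sch_inv_fun s).
Proof.
apply/closure_ptwsP => F; have [x xF] := schP s (map (sch_inv_fun s) F).
exists (theta x^-1%g); first by exists x^-1%g.
by move=> c cF; rewrite -{1}(sch_inv_funK s c) -xF ?map_f // thetaK.
Qed.

Definition sch_one : schlichting := SigSub (mem_set sch_one_subproof).
Definition sch_mul (s t : schlichting) : schlichting :=
  SigSub (mem_set (@sch_mul_subproof s t)).
Definition sch_inv (s : schlichting) : schlichting :=
  SigSub (mem_set (@sch_inv_subproof s)).

Lemma sch_mulA : associative sch_mul.
Proof. by move=> s t u; apply: val_inj. Qed.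

Lemma sch_mul1 : left_id sch_one sch_mul.
Proof. by move=> s; apply: val_inj; apply/funext => c /=; rewrite theta1. Qed.

Lemma sch_mulr1 : right_id sch_one sch_mul.
Proof. by move=> s; apply: val_inj; apply/funext => c /=; rewrite theta1. Qed.

Lemma sch_mulrV : right_inverse sch_one sch_inv sch_mul.
Proof.
move=> s; apply: val_inj; apply/funext => c /=.
by rewrite theta1 sch_inv_funK.
Qed.

Lemma sch_mulV : left_inverse sch_one sch_inv sch_mul.
Proof.
move=> s; apply: val_inj; apply/funext => c /=.
by apply: (@sch_inj s); rewrite sch_inv_funK theta1.
Qed.

HB.instance Definition _ := isGroup.Build schlichting
  sch_mulA sch_mul1 sch_mulr1 sch_mulV sch_mulrV.
HB.instance Definition _ := isPointed.Build schlichting 1%g.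

(* The closure of theta(H0) in Map(G0/H0), as a subset of G *)
Definition sch_sub : set schlichting :=
  [set s | closure (theta @` @hp_sub P) (val s)].

End LeftCosets.

Section Convolution.
Variables (R : realType) (P : heckePair).
Local Notation G := (schlichting P).
Local Notation H := (@sch_sub P).

Definition borel := g_sigma_algebraType (@open G).

(* Radon measure: finite on compact sets, outer regular on Borel sets and inner
   regular on open sets. *)
Record left_haar (mu : {measure set borel -> \bar R}) : Prop := LeftHaar {
  haar_neq0 : mu setT != 0%E;
  haar_invariant : forall (x : G) (A : set borel), measurable A ->
    mu [set (x * y)%g | y in A] = mu A;
  haar_compact : forall K : set G, compact K -> (mu K < +oo)%E;
  haar_outer : forall A : set borel, measurable A ->
    mu A = ereal_inf [set mu U | U in [set U : set G | open U /\ A `<=` U]];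
  haar_inner : forall U : set G, open U ->
    mu U = ereal_sup [set mu K | K in [set K : set G | compact K /\ K `<=` U]]
}.

(* This convention, rather than its inverse, makes [star] below an involution. *)
Definition modular_function (mu : {measure set borel -> \bar R})
    (Delta : G -> R) : Prop :=
  forall x : G, 0 < Delta x /\
    forall A : set borel, measurable A ->
      (mu [set (y * x)%g | y in A] = (Delta x)%:E * mu A)%E.

Variables (mu : {measure set borel -> \bar R}) (Delta : G -> R).

Definition cintegral (f : G -> R[i]) : R[i] :=
  Complex (\int[mu]_x complex.Re (f x)) (\int[mu]_x complex.Im (f x)).

Definition Cc : set (G -> R[i]) :=
  [set f | continuous (f : G -> R[i]^o) /\
           compact (closure [set x | f x != 0])].

Definition conv (f g : G -> R[i]) : G -> R[i] :=
  fun x => cintegral (fun y => f y * g (y^-1 * x)%g).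

Definition star (f : G -> R[i]) : G -> R[i] :=
  fun x => (f (x^-1)%g)^* * (Delta (x^-1)%g)%:C%C.

Definition projH : G -> R[i] := \1_H.

Definition Ccp : set (G -> R[i]) := [set conv f projH | f in Cc].

(* The Hecke algebra of (G0, H0) is identified with p C_c(G) p, the function
   chi_(H0 x H0) corresponding to chi_(H x H). *)
Definition hecke_algebra : set (G -> R[i]) :=
  [set conv (conv projH f) projH | f in Cc].

Definition innerR (f g : G -> R[i]) : G -> R[i] := conv (star f) g.

End Convolution.

Record hilbertSpace (R : realType) := HilbertSpace {
  hs_space :> completeNormedModType R[i];
  hs_inner : {dot hs_space for @Num.conj R[i]};
  hs_norm : forall v : hs_space, `|v| ^+ 2 = hs_inner v v
}.

Section Operators.
Variables (R : realType).

Definition bounded_op (V W : hilbertSpace R) (f : V -> W) : Prop :=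
  exists M : R, forall v : V, `|f v| <= M%:C%C * `|v|.

Definition linear_span (V : hilbertSpace R) (A : set V) : set V :=
  [set v | exists (n : nat) (a : 'I_n -> R[i]) (w : 'I_n -> V),
     (forall i, A (w i)) /\ v = \sum_(i < n) a i *: w i].

Definition closed_span (V : hilbertSpace R) (A : set V) : set V :=
  closure (linear_span A).

End Operators.

Record Cat := MkCat {
  cat_obj :> Type;
  cat_hom : cat_obj -> cat_obj -> Type;
  cat_id : forall X, cat_hom X X;
  cat_comp : forall X Y Z, cat_hom Y Z -> cat_hom X Y -> cat_hom X Z;
  cat_id_l : forall X Y (f : cat_hom X Y), cat_comp (cat_id Y) f = f;
  cat_id_r : forall X Y (f : cat_hom X Y), cat_comp f (cat_id X) = f;
  cat_assoc : forall X Y Z T (h : cat_hom Z T) (g : cat_hom Y Z)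
    (f : cat_hom X Y),
    cat_comp h (cat_comp g f) = cat_comp (cat_comp h g) f
}.

Record Functor (C D : Cat) := MkFunctor {
  fobj :> C -> D;
  fmap : forall X Y : C, cat_hom X Y -> cat_hom (fobj X) (fobj Y);
  fmap_id : forall X : C, fmap (cat_id X) = cat_id (fobj X);
  fmap_comp : forall (X Y Z : C) (g : cat_hom Y Z) (f : cat_hom X Y),
    fmap (cat_comp g f) = cat_comp (fmap g) (fmap f)
}.
Arguments fmap {C D} F [X Y] f : rename.

Definition id_functor (C : Cat) : Functor C C :=
  @MkFunctor C C (fun X => X) (fun _ _ f => f)
    (fun=> erefl) (fun _ _ _ _ _ => erefl).

Program Definition comp_functor (C D E : Cat) (G : Functor D E)
    (F : Functor C D) : Functor C E :=
  @MkFunctor C E (fun X => G (F X)) (fun _ _ f => fmap G (fmap F f)) _ _.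
Next Obligation. by move=> C D E G F X /=; rewrite (fmap_id F) (fmap_id G). Qed.
Next Obligation.
by move=> C D E G F X Y Z g f /=; rewrite (fmap_comp F) (fmap_comp G).
Qed.

Definition is_iso (C : Cat) (X Y : C) (f : cat_hom X Y) : Prop :=
  exists g : cat_hom Y X,
    cat_comp g f = cat_id X /\ cat_comp f g = cat_id Y.

Definition nat_isomorphic (C D : Cat) (F G : Functor C D) : Prop :=
  exists eta : forall X : C, cat_hom (F X) (G X),
    (forall X, is_iso (eta X)) /\
    (forall (X Y : C) (f : cat_hom X Y),
       cat_comp (eta Y) (fmap F f) = cat_comp (fmap G f) (eta X)).

Definition equivalent_categories (C D : Cat) : Prop :=
  exists (F : Functor C D) (G : Functor D C),
    nat_isomorphic (comp_functor G F) (id_functor C) /\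
    nat_isomorphic (comp_functor F G) (id_functor D).

Section IntertwinerCategory.
Variables (R : realType) (A : Type) (D : set A) (O : Type).
Variables (sp : O -> hilbertSpace R) (act : forall X, A -> sp X -> sp X).

Record intertwiner (X Y : O) := Intertwiner {
  itw_fun :> sp X -> sp Y;
  itw_linear : linear itw_fun;
  itw_bounded : bounded_op itw_fun;
  itw_act : forall a v, D a -> itw_fun (act a v) = act a (itw_fun v)
}.

Lemma intertwiner_eq (X Y : O) (f g : intertwiner X Y) :
  (f : sp X -> sp Y) = g -> f = g.
Proof.
case: f g => f ? ? ? [g ? ? ?] /= fg; subst g.
by congr Intertwiner; exact: Prop_irrelevance.
Qed.

Program Definition itw_id (X : O) : intertwiner X X :=
  @Intertwiner X X (fun v => v) _ _ _.
Next Obligation. by []. Qed.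
Next Obligation. by move=> X; exists 1 => v; rewrite rmorph1 mul1r. Qed.
Next Obligation. by []. Qed.

Program Definition itw_comp (X Y Z : O) (g : intertwiner Y Z)
    (f : intertwiner X Y) : intertwiner X Z :=
  @Intertwiner X Z (fun v => g (f v)) _ _ _.
Next Obligation. by move=> X Y Z g f a u v; rewrite !itw_linear. Qed.
Next Obligation.
move=> X Y Z g f.
have [M fM] := itw_bounded f; have [N gN] := itw_bounded g.
exists (`|N| * M) => v; rewrite rmorphM/= -mulrA.
apply: (le_trans (gN _)); apply: (@le_trans _ _ (`|N|%:C%C * `|f v|)).
  by rewrite ler_wpM2r// lecR ler_norm.
by rewrite ler_wpM2l// (_ : 0 = 0%:C%C)// lecR.
Qed.
Next Obligation. by move=> X Y Z g f a v Da /=; rewrite !itw_act. Qed.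

Program Definition intertwiner_cat : Cat :=
  @MkCat O intertwiner itw_id itw_comp _ _ _.
Next Obligation. by move=> *; apply: intertwiner_eq. Qed.
Next Obligation. by move=> *; apply: intertwiner_eq. Qed.
Next Obligation. by move=> *; apply: intertwiner_eq. Qed.

End IntertwinerCategory.

Section Representations.
Variables (R : realType) (P : heckePair).
Local Notation G := (schlichting P).

Record unitary_rep := UnitaryRep {
  ur_space : hilbertSpace R;
  ur_act : P -> ur_space -> ur_space;
  ur_linear : forall x, linear (ur_act x);
  ur_unitary : forall x u v,
    hs_inner ur_space (ur_act x u) (ur_act x v) = hs_inner ur_space u v;
  ur_act1 : forall v, ur_act 1%g v = v;
  ur_actM : forall x y v, ur_act (x * y)%g v = ur_act x (ur_act y v)
}.

Definition fixed_vectors (pi : unitary_rep) : set (ur_space pi) :=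
  [set v | forall h, @hp_sub P h -> @ur_act pi h v = v].

Definition smooth (pi : unitary_rep) : Prop :=
  closed_span [set @ur_act pi x v | x in [set: P] & v in @fixed_vectors pi]
    = setT.

Record smooth_rep := SmoothRep {
  sr_rep :> unitary_rep;
  sr_smooth : smooth sr_rep
}.

Definition smooth_reps : Cat :=
  intertwiner_cat setT (fun pi : smooth_rep => @ur_act pi).

Variables (mu : {measure set (borel P) -> \bar R}) (Delta : G -> R).
Local Notation HA := (hecke_algebra mu).

(* Nondegenerate *-representations by bounded operators.  hr_act is a total
   function, but only its values on hecke_algebra mu are constrained, and only
   these are seen by the morphisms of positive_reps. *)
Record hecke_rep := HeckeRep {
  hr_space : hilbertSpace R;
  hr_act : (G -> R[i]) -> hr_space -> hr_space;
  hr_op_linear : forall f, HA f -> linear (hr_act f);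
  hr_op_bounded : forall f, HA f -> bounded_op (hr_act f);
  hr_linear : forall (a : R[i]) f g v, HA f -> HA g ->
    hr_act (fun x => a * f x + g x) v = a *: hr_act f v + hr_act g v;
  hr_conv : forall f g v, HA f -> HA g ->
    hr_act (conv mu f g) v = hr_act f (hr_act g v);
  hr_star : forall f u v, HA f ->
    hs_inner hr_space (hr_act (star Delta f) u) v
      = hs_inner hr_space u (hr_act f v);
  hr_nondegenerate :
    closed_span [set hr_act f v | f in HA & v in [set: hr_space]] = setT
}.

Definition innerR_positive (pi : hecke_rep) : Prop :=
  forall f, Ccp mu f -> forall v : hr_space pi,
    0 <= hs_inner (hr_space pi) (hr_act (innerR mu Delta f f) v) v.

Record positive_rep := PositiveRep {
  pr_rep :> hecke_rep;
  pr_positive : innerR_positive pr_rep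
}.

Definition positive_reps : Cat :=
  intertwiner_cat HA (fun pi : positive_rep => @hr_act pi).

End Representations.

(* Main.v *)
(* For a unitary representation [pi] of [G_0] the Hecke algebra acts on the fixed
   vectors, an element [f] through the finite sum over the cosets [c = xH_0] of
   [f(x) pi(x)], and this gives the functor [V |-> V^{H_0}].  Let [b(d, c)] be
   the normalized indicator of the double coset of [y^-1 x], where [c = xH_0]
   and [d = yH_0].  Averaging over [H_0]-orbits shows that the Gram matrix of the
   translates of the fixed vectors is given by the Hecke algebra,
     <pi(x) u, pi(y) v> = <b(d, c) u, v>,
   so a smooth [pi] is determined by the representation on [V^{H_0}].

   Fullness: an intertwiner [T] of the fixed spaces extends to the translates
   once the Gram matrix of [T u] is dominated by |T|^2 times that of [u]. Both
   matrices act as symmetric operators, commuting with [T], and the Krein-Reid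
   inequality for the form |T|^2 <u, u> - <T u, T u> gives this without spectral
   theory.

   Essential surjectivity: for a positive representation on [W], the operators
   of [b(d, c)] form a kernel on pairs of a coset and a vector.  Positivity is
   the statement that this kernel is positive for families taken from a single
   vector of [W], hence for families in a cyclic subspace; splitting off cyclic
   subspaces one at a time gives positive definiteness.  The Kolmogorov
   decomposition of the kernel carries the induced representation of [G_0]. *)

From HB Require Import structures.
From mathcomp Require Import all_boot all_order all_algebra.
From mathcomp Require Import generic_quotient complex sesquilinear.
From mathcomp Require Import all_classical all_reals all_analysis.
From mathcomp Require Import measurable_realfun.
From mathcomp Require Import ring lra.
Require Import Defs.

Set Implicit Arguments.
Unset Strict Implicit.
Unset Printing Implicit Defensive.

Import Order.TTheory GRing.Theory Num.Theory.
Import numFieldNormedType.Exports.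

Local Open Scope classical_set_scope.
Local Open Scope quotient_scope.
Local Open Scope ring_scope.

(** Choice turns a fully faithful and essentially surjective functor into an equivalence, so
    induction is needed on objects only. Once [pC_c(G)p] and [C_c(G)p] are known to consist of
    functions on finitely many cosets, the integrals that remain are finite sums. Dividing by the
    number of left cosets in a double coset absorbs the modular function: it makes [b(c, d)] the
    adjoint of [b(d, c)], and [f^* f] becomes a combination of the [b(c, d)] without further
    weights.

    Two obstacles shape the rest. Positivity is assumed for one vector of [W] at a time, while the
    kernel must be positive on families. Expansions by [b(d, c)] exist only on the algebraic cyclic
    subspace, which need not be closed, so an exact orthogonal projection could leave it; hence
    approximate projections with an error [r] that is sent to 0. In the fullness part neither an
    adjoint of the intertwiner nor a square root of the Gram operator [A] is constructed: the
    Krein-Reid inequality for [1 - A / C], with [C] a bound of [A], replaces both. *)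

Section Equivalence.
Variables (C D : Cat) (F : Functor C D).

(** Choice picks for each [Y] an object [o Y] with an isomorphism [i Y], and fullness lifts the
    conjugates of morphisms by these isomorphisms. Faithfulness turns every identity required of the
    lifts into one in [D], where [i] and its inverse cancel. *)
Lemma fully_faithful_ess_surj_equivalence :
  (forall (X Y : C) (f g : cat_hom X Y), fmap F f = fmap F g -> f = g) ->
  (forall (X Y : C) (g : cat_hom (F X) (F Y)), exists f, fmap F f = g) ->
  (forall Y : D, exists (X : C) (i : cat_hom (F X) Y), is_iso i) ->
  equivalent_categories C D.
Proof.
move=> faith full es.
pose o Y : C := sval (cid (es Y)).
pose i Y : cat_hom (F (o Y)) Y := sval (cid (svalP (cid (es Y)))).
have iP Y : is_iso (i Y) := svalP (cid (svalP (cid (es Y)))).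
pose j Y : cat_hom Y (F (o Y)) := sval (cid (iP Y)).
have jP Y : cat_comp (j Y) (i Y) = cat_id _ /\ cat_comp (i Y) (j Y) = cat_id _.
  exact: svalP (cid (iP Y)).
pose lift X Y g : cat_hom X Y := sval (cid (full X Y g)).
have liftP X Y g : fmap F (lift X Y g) = g := svalP (cid (full X Y g)).
pose m Y Z (f : cat_hom Y Z) := lift (o Y) (o Z) (cat_comp (j Z) (cat_comp f (i Y))).
have m1 Y : m Y Y (cat_id Y) = cat_id (o Y).
  by apply: faith; rewrite liftP fmap_id cat_id_l (jP Y).1.
have mM X Y Z (g : cat_hom Y Z) (f : cat_hom X Y) :
    m _ _ (cat_comp g f) = cat_comp (m _ _ g) (m _ _ f).
  apply: faith; rewrite fmap_comp !liftP !cat_assoc; congr cat_comp.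
  by rewrite -!cat_assoc [cat_comp (i Y) _]cat_assoc (jP Y).2 cat_id_l.
pose G := @MkFunctor D C o m m1 mM.
exists F, G; split.
  pose eta X : cat_hom (o (F X)) X := lift _ _ (i (F X)).
  exists eta; split=> [X|X Y f] /=.
    exists (lift _ _ (j (F X))).
    have [ji ij] := jP (F X).
    by split; apply: faith; rewrite fmap_comp !liftP fmap_id.
  apply: faith; rewrite !fmap_comp !liftP cat_assoc (jP (F Y)).2 cat_id_l //.
exists i; split=> [X|X Y f] /=; first by exists (j X).
by rewrite liftP cat_assoc (jP Y).2 cat_id_l.
Qed.

End Equivalence.

(** * Semi-inner products and Hilbert spaces *)

Section ComplexModulus.
Variable R : realType.
Implicit Types (z w : R[i]) (a b : R).

(** The norm of [R[i]] is itself an element of [R[i]]; its real part moves estimates to the ordered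
    field [R], where [lra] and [nra] apply. *)
Definition cmod z : R := complex.Re `|z|.

Lemma normcE_cmod z : `|z| = (cmod z)%:C%C.
Proof. by rewrite /cmod normc_def /=. Qed.

Lemma cmod_ge0 z : 0 <= cmod z.
Proof. by rewrite -lecR -normcE_cmod; exact: normr_ge0. Qed.

Lemma cmodM z w : cmod (z * w) = cmod z * cmod w.
Proof. by apply: (@complexI R); rewrite rmorphM -!normcE_cmod normrM. Qed.

Lemma cmodD z w : cmod (z + w) <= cmod z + cmod w.
Proof. by rewrite -lecR rmorphD -!normcE_cmod ler_normD. Qed.

Lemma cmod_sum I (r : seq I) (F : I -> R[i]) :
  cmod (\sum_(i <- r) F i) <= \sum_(i <- r) cmod (F i).
Proof.
elim: r => [|i r IH]; first by rewrite !big_nil /cmod normr0.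
by rewrite !big_cons; apply: le_trans (cmodD _ _) _; rewrite lerD2l.
Qed.

Lemma cmodN z : cmod (- z) = cmod z.
Proof. by rewrite /cmod normrN. Qed.

Lemma cmodJ z : cmod z^* = cmod z.
Proof. by rewrite /cmod norm_conjC. Qed.

Lemma cmodR a : cmod a%:C%C = `|a|.
Proof. by rewrite /cmod normc_def /= expr0n addr0 sqrtr_sqr. Qed.

Lemma cmod0 : cmod 0 = 0.
Proof. by rewrite /cmod normr0. Qed.

Lemma cmod1 : cmod 1 = 1.
Proof. by rewrite /cmod normr1. Qed.

Lemma cmod0_eq0 z : cmod z = 0 -> z = 0.
Proof. by move=> z0; apply/normr0_eq0; rewrite normcE_cmod z0. Qed.

Lemma ReD z w : complex.Re (z + w) = complex.Re z + complex.Re w.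
Proof. by case: z w => [? ?] [? ?]. Qed.

Lemma ReN z : complex.Re (- z) = - complex.Re z.
Proof. by case: z. Qed.

Lemma ReB z w : complex.Re (z - w) = complex.Re z - complex.Re w.
Proof. by rewrite ReD ReN. Qed.

Lemma ReJ z : complex.Re z^* = complex.Re z.
Proof. by case: z. Qed.

Lemma ReZ a z : complex.Re (a%:C%C * z) = a * complex.Re z.
Proof. by case: z => x y /=; rewrite mul0r subr0. Qed.

Lemma Re_le_cmod z : complex.Re z <= cmod z.
Proof.
rewrite /cmod normc_def /= (le_trans (ler_norm _))// -sqrtr_sqr.
by rewrite ler_sqrt ?addr_ge0 ?sqr_ge0// lerDl sqr_ge0.
Qed.

Lemma norm_Im_le_cmod z : `|complex.Im z| <= cmod z.
Proof.
rewrite /cmod normc_def /= -sqrtr_sqr.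
by rewrite ler_sqrt ?addr_ge0 ?sqr_ge0// lerDr sqr_ge0.
Qed.

Lemma cmod_le_ReIm z : cmod z <= `|complex.Re z| + `|complex.Im z|.
Proof.
case: z => x y; rewrite /cmod normc_def /=.
rewrite -(ger0_norm (addr_ge0 (normr_ge0 x) (normr_ge0 y))) -sqrtr_sqr.
rewrite ler_sqrt ?sqr_ge0// -(real_normK (num_real x)) -(real_normK (num_real y)).
by have := mulr_ge0 (normr_ge0 x) (normr_ge0 y); nra.
Qed.

Lemma mulcJ z : z * z^* = (cmod z ^+ 2)%:C%C.
Proof. by rewrite -normCK normcE_cmod rmorphXn. Qed.

Lemma real_complexV a : (a^-1)%:C%C = (a%:C%C)^-1.
Proof. exact: (fmorphV (real_complex R)). Qed.

Lemma real_complexM a b : (a * b)%:C%C = a%:C%C * b%:C%C.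
Proof. exact: (rmorphM (real_complex R)). Qed.

Lemma real_complexN a : (- a)%:C%C = - a%:C%C.
Proof. exact: (rmorphN (real_complex R)). Qed.

Lemma real_complexD a b : (a + b)%:C%C = a%:C%C + b%:C%C.
Proof. exact: (rmorphD (real_complex R)). Qed.

Lemma ge0_complexE z : (0 <= z) = (complex.Im z == 0) && (0 <= complex.Re z).
Proof. by rewrite lecE. Qed.

Lemma conj_eq_real z : z^* = z -> z = (complex.Re z)%:C%C.
Proof.
by case: z => x y /= [] yN; congr Complex; lra.
Qed.

End ComplexModulus.

(** * Convergence of complex sequences *)

Section ComplexSequences.
Variable R : realType.
Implicit Types (u v : nat -> R[i]) (l m : R[i]).

Definition ccvg u l := forall e : R, 0 < e ->
  exists N, forall n, (N <= n)%N -> cmod (u n - l) < e.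

Lemma ccvg_cst l : ccvg (fun=> l) l.
Proof. by move=> e e0; exists 0%N => n _; rewrite subrr cmod0. Qed.

Lemma ccvg_unique u l m : ccvg u l -> ccvg u m -> l = m.
Proof.
move=> ul um; apply/eqP; rewrite -subr_eq0; apply/eqP/cmod0_eq0.
apply/eqP; rewrite eq_le cmod_ge0 andbT; apply/ler_addgt0Pl => e e0.
rewrite addr0.
have [N1 H1] := ul _ (divr_gt0 e0 (ltr0n _ 2)).
have [N2 H2] := um _ (divr_gt0 e0 (ltr0n _ 2)).
have /H1 := leq_maxl N1 N2; have /H2 := leq_maxr N1 N2.
set n := maxn N1 N2 => h2 h1.
have := cmodD (u n - m) (- (u n - l)); rewrite cmodN.
rewrite (_ : u n - m - (u n - l) = l - m); last by ring.
by move/le_trans; apply; lra.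
Qed.

Lemma ccvgD u v l m : ccvg u l -> ccvg v m -> ccvg (fun n => u n + v n) (l + m).
Proof.
move=> ul vm e e0.
have [N1 H1] := ul _ (divr_gt0 e0 (ltr0n _ 2)).
have [N2 H2] := vm _ (divr_gt0 e0 (ltr0n _ 2)).
exists (maxn N1 N2) => n; rewrite geq_max => /andP[/H1 h1 /H2 h2].
have := cmodD (u n - l) (v n - m).
rewrite (_ : u n - l + (v n - m) = u n + v n - (l + m)); last by ring.
by move/le_lt_trans; apply; lra.
Qed.

Lemma ccvgZ (a : R[i]) u l : ccvg u l -> ccvg (fun n => a * u n) (a * l).
Proof.
move=> ul e e0; have a0 := cmod_ge0 a.
have [|N H] := ul (e / (cmod a + 1)); first by rewrite divr_gt0//; lra.
exists N => n /H h; rewrite -mulrBr cmodM.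
have : cmod a * cmod (u n - l) <= cmod a * (e / (cmod a + 1)).
  by rewrite ler_wpM2l// ltW.
move=> /le_lt_trans; apply; rewrite mulrA ltr_pdivrMr; last lra.
by nra.
Qed.

Lemma ccvgJ u l : ccvg u l -> ccvg (fun n => (u n)^*) l^*.
Proof.
by move=> ul e /ul[N H]; exists N => n /H; rewrite -rmorphB cmodJ.
Qed.

Lemma ccvg_eq u v l : u =1 v -> ccvg u l -> ccvg v l.
Proof. by move=> /funext->. Qed.

Lemma ccvg_Re_le u l (c : R) (N : nat) : ccvg u l ->
  (forall n, (N <= n)%N -> complex.Re (u n) <= c) -> complex.Re l <= c.
Proof.
move=> ul uc; apply/ler_addgt0Pr => e /ul[M H].
have /H := leq_maxl M N; have /uc := leq_maxr M N.
set n := maxn _ _ => h1 h2; have := Re_le_cmod (- (u n - l)).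
by rewrite cmodN ReN ReB; lra.
Qed.

Lemma ccvg_Re_ge u l (c : R) (N : nat) : ccvg u l ->
  (forall n, (N <= n)%N -> c <= complex.Re (u n)) -> c <= complex.Re l.
Proof.
move=> ul uc; rewrite -lerN2 -ReN; apply: (@ccvg_Re_le (fun n => -1 * u n) _ _ N).
  by rewrite -(mulN1r l); exact: ccvgZ.
by move=> n /uc; rewrite mulN1r ReN lerN2.
Qed.

Lemma real_complete (u : nat -> R) :
  (forall e, 0 < e -> exists N, forall m n : nat, (N <= m)%N -> (N <= n)%N ->
     `|u m - u n| < e) ->
  exists l : R, forall e, 0 < e -> exists N, forall n, (N <= n)%N -> `|u n - l| < e.
Proof.
move=> uC; have : cvg (u @ \oo).
  apply: R_complete; apply: cauchy_exP => e e0.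
  have [N H] := uC e e0; exists (u N); exists N => // n /= Nn.
  by rewrite /ball /=; exact: H.
move/cvg_ex => [l ul]; exists l => e e0.
have /cvgrPdist_lt/(_ e e0) [N _ H] := ul.
by exists N => n /H /=; rewrite distrC.
Qed.

Lemma complex_complete u :
  (forall e, 0 < e -> exists N, forall m n : nat, (N <= m)%N -> (N <= n)%N ->
     cmod (u m - u n) < e) ->
  exists l, ccvg u l.
Proof.
move=> uC.
have [|a aP] := @real_complete (fun n => complex.Re (u n)).
  move=> e /uC[N H]; exists N => m n Nm Nn; have {H} := H _ _ Nm Nn.
  apply: le_lt_trans; rewrite -ReB -lecR -normcE_cmod; exact: normc_ge_Re.
have [|b bP] := @real_complete (fun n => complex.Im (u n)).
  move=> e /uC[N H]; exists N => m n Nm Nn; have {H} := H _ _ Nm Nn.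
  apply: le_lt_trans; have := norm_Im_le_cmod (u m - u n).
  by case: (u m) (u n) => [? ?] [? ?].
exists (Complex a b) => e e0.
have [N1 H1] := aP _ (divr_gt0 e0 (ltr0n _ 2)).
have [N2 H2] := bP _ (divr_gt0 e0 (ltr0n _ 2)).
exists (maxn N1 N2) => n; rewrite geq_max => /andP[/H1 h1 /H2 h2].
apply: le_lt_trans (cmod_le_ReIm _) _.
by move: h1 h2; case: (u n) => [? ?] /= h1 h2; lra.
Qed.

End ComplexSequences.

(* Only the values of the form enter, so that [L] needs no vector space axioms:
   this covers both left modules and formal linear combinations. *)
Section SemiInnerProduct.
Variables (R : realType) (L : Type).
Variables (comb : R[i] -> L -> L -> L) (s : L -> L -> R[i]).
Hypothesis s_lin : forall a x y z, s (comb a x y) z = a * s x z + s y z.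
Hypothesis s_herm : forall x y, s y x = (s x y)^*.
Hypothesis s_ge0 : forall x, 0 <= complex.Re (s x x).

Definition sqn x : R := complex.Re (s x x).
Definition sn x : R := Num.sqrt (sqn x).

Lemma s_linr a x y z : s z (comb a x y) = a^* * s z x + s z y.
Proof. by rewrite s_herm s_lin rmorphD rmorphM /= -!s_herm. Qed.

Lemma s_diag x : s x x = (sqn x)%:C%C.
Proof. by apply: conj_eq_real; rewrite -s_herm. Qed.

Lemma sn_ge0 x : 0 <= sn x. Proof. exact: sqrtr_ge0. Qed.

Lemma sn_sqr x : sn x ^+ 2 = sqn x. Proof. by rewrite sqr_sqrtr//; exact: s_ge0. Qed.

Lemma sqn_comb a x y : sqn (comb a x y) =
  cmod a ^+ 2 * sqn x + 2 * complex.Re (a * s x y) + sqn y.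
Proof.
rewrite {1}/sqn s_lin !s_linr (s_herm x y) !s_diag mulrDr.
have -> : a * (a^* * (sqn x)%:C%C) = (cmod a ^+ 2 * sqn x)%:C%C.
  by rewrite mulrA mulcJ -rmorphM.
rewrite !ReD /= -rmorphM ReJ; ring.
Qed.

Lemma semi_CauchySchwarz x y : cmod (s x y) <= sn x * sn y.
Proof.
have [] := ltP 0 (sqn x) => [x0|xle].
  (* This [a] minimizes the quadratic expression [sqn (comb a x y)]. *)
  pose a := - (s x y)^* / (sqn x)%:C%C.
  have := s_ge0 (comb a x y); rewrite -/(sqn _) sqn_comb.
  have xC : (sqn x)%:C%C != 0 by rewrite eq_complex /= eqxx andbT gt_eqF.
  have -> : a * s x y = (- (cmod (s x y) ^+ 2 / sqn x))%:C%C.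
    rewrite /a mulrAC mulNr mulrC [_^* * _]mulrC mulcJ.
    by rewrite mulrN real_complexN real_complexM real_complexV mulrC.
  have -> : cmod a = cmod (s x y) / sqn x.
    rewrite /a cmodM cmodN cmodJ -real_complexV cmodR ger0_norm// invr_ge0; exact: s_ge0.
  move=> /= h; rewrite -(ler_pXn2r (_ : (0 < 2)%N)) ?nnegrE ?cmod_ge0 ?mulr_ge0 ?sn_ge0//.
  rewrite exprMn !sn_sqr -ler_pdivrMl// mulrC.
  rewrite -subr_ge0; rewrite (_ : _ - _ = (cmod (s x y) / sqn x) ^+ 2 * sqn x +
    2 * - (cmod (s x y) ^+ 2 / sqn x) + sqn y)//.
  by field; rewrite gt_eqF.
have x0 : sqn x = 0 by apply/eqP; rewrite eq_le xle s_ge0.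
rewrite {1}/sn x0 sqrtr0 mul0r.
set c := cmod _; have c0 : 0 <= c := cmod_ge0 _.
rewrite leNgt; apply/negP => cp.
(* For a null vector [x] the quadratic term disappears; at this [a] the rest equals [- sqn y - 2],
   which is negative. *)
pose a := - ((sqn y + 1) / c ^+ 2)%:C%C * (s x y)^*.
have := s_ge0 (comb a x y); rewrite -/(sqn _) sqn_comb x0 mulr0 add0r.
have -> : a * s x y = (- (sqn y + 1))%:C%C.
  rewrite /a -mulrA [_^* * _]mulrC mulcJ -/c mulNr -rmorphM/= -rmorphN.
  by rewrite divfK ?expf_neq0 ?gt_eqF.
have := s_ge0 y; rewrite -/(sqn y) /=; lra.
Qed.

(** Since [L] has no addition, a sum of [x] and [y] is any [z] that pairs like one. Then [sn z ^+ 2]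
    is the real part of [s x z + s y z], and Cauchy-Schwarz leaves a factor [sn z] to cancel. *)
Lemma sn_triangle x y z : (forall t, s z t = s x t + s y t) -> sn z <= sn x + sn y.
Proof.
move=> zE; have [->|z0] := eqVneq (sn z) 0; first by rewrite addr_ge0 ?sn_ge0.
have zp : 0 < sn z by rewrite lt_def z0 sn_ge0.
rewrite -(ler_pM2r zp) -expr2 sn_sqr /sqn zE mulrDl ReD.
by apply: lerD; apply: le_trans (Re_le_cmod _) (semi_CauchySchwarz _ _).
Qed.

Lemma sn_scale a x z : (forall t, s z t = a * s x t) -> sn z = cmod a * sn x.
Proof.
move=> zE; have e : sqn z = cmod a ^+ 2 * sqn x :> R.
  rewrite /sqn zE s_herm zE rmorphM/= -s_herm mulrA mulcJ s_diag -real_complexM.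
  by [].
by rewrite /sn e sqrtrM ?sqr_ge0// sqrtr_sqr ger0_norm// cmod_ge0.
Qed.

Definition sdiff x y := comb (-1) y x.

Lemma s_diff x y t : s (sdiff x y) t = s x t - s y t.
Proof. by rewrite s_lin mulN1r addrC. Qed.

Definition sdist x y := sn (sdiff x y).

Lemma sdist_triangle y x z : sdist x z <= sdist x y + sdist y z.
Proof.
by apply: sn_triangle => t; rewrite !s_diff addrA subrK.
Qed.

Lemma sdistC x y : sdist x y = sdist y x.
Proof.
rewrite /sdist (@sn_scale (-1) (sdiff y x)) ?cmodN ?cmod1 ?mul1r// => t.
by rewrite !s_diff mulN1r opprB.
Qed.

Lemma sdistxx x : sdist x x = 0.
Proof.
by rewrite /sdist (@sn_scale 0 x) ?cmod0 ?mul0r// => t; rewrite s_diff mul0r subrr.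
Qed.

Lemma sn_sdist x y : sn x <= sdist x y + sn y.
Proof. by apply: sn_triangle => t; rewrite s_diff subrK. Qed.

Lemma cmod_s_diff x y x' y' :
  cmod (s x y - s x' y') <= sdist x x' * sn y + sn x' * sdist y y'.
Proof.
have -> : s x y - s x' y' = s (sdiff x x') y + s x' (sdiff y y').
  rewrite (s_herm (sdiff y y')) !s_diff rmorphB /= -!s_herm.
  by rewrite addrA subrK.
by apply: le_trans (cmodD _ _) (lerD _ _); exact: semi_CauchySchwarz.
Qed.

Definition scauchy (x : nat -> L) := forall e : R, 0 < e ->
  exists N, forall m n : nat, (N <= m)%N -> (N <= n)%N -> sdist (x m) (x n) < e.

Lemma scauchy_bounded x : scauchy x -> exists B, 0 < B /\ exists N, forall n, (N <= n)%N -> sn (x n) <= B.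
Proof.
move=> /(_ 1 ltr01)[N H]; exists (1 + sn (x N)).
split; first by have := sn_ge0 (x N); lra.
by exists N => n Nn; have := sn_sdist (x n) (x N); have := H _ _ Nn (leqnn N); lra.
Qed.

Lemma scauchy_form x y : scauchy x -> scauchy y -> exists l, ccvg (fun n => s (x n) (y n)) l.
Proof.
move=> xC yC; apply: complex_complete => e e0.
have [B [B0 [N1 xB]]] := scauchy_bounded xC.
have [C [C0 [N2 yC']]] := scauchy_bounded yC.
have [|N3 H3] := xC (e / (2 * C)); first by rewrite divr_gt0// mulr_gt0.
have [|N4 H4] := yC (e / (2 * B)); first by rewrite divr_gt0// mulr_gt0.
exists (maxn (maxn N1 N2) (maxn N3 N4)) => m n.
rewrite !geq_max => /andP[/andP[m1 m2] /andP[m3 m4]] /andP[/andP[n1 n2] /andP[n3 n4]].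
apply: le_lt_trans (cmod_s_diff _ _ _ _) _.
have h1 : sdist (x m) (x n) * sn (y m) <= sdist (x m) (x n) * C.
  by rewrite ler_wpM2l ?sn_ge0 ?yC'.
have h2 : sn (x n) * sdist (y m) (y n) <= B * sdist (y m) (y n).
  by rewrite ler_wpM2r ?sn_ge0 ?xB.
have h3 : sdist (x m) (x n) * C < e / 2.
  by rewrite -ltr_pdivlMr// -mulrA -invfM; exact: H3.
have h4 : B * sdist (y m) (y n) < e / 2.
  by rewrite -ltr_pdivlMl// mulrC -mulrA -invfM; exact: H4.
lra.
Qed.

Lemma scauchy_weak_null d : scauchy d -> (forall t, ccvg (fun n => s (d n) t) 0) ->
  forall y, scauchy y -> ccvg (fun n => s (d n) (y n)) 0.
Proof.
move=> dC d0 y yC.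
have [B [B0 [N1 yB]]] := scauchy_bounded yC.
have [C [C0 [N2 dB]]] := scauchy_bounded dC.
move=> e e0.
have [|N3 H3] := yC (e / (2 * C)); first by rewrite divr_gt0// mulr_gt0.
pose N := maxn N2 N3.
have [|N4 H4] := d0 (y N) (e / 2); first by rewrite divr_gt0.
exists (maxn N N4) => n; rewrite !geq_max => /andP[/andP[n2 n3] n4].
rewrite subr0; have := H4 _ n4; rewrite subr0 => h4.
have := cmod_s_diff (d n) (y n) (d n) (y N); rewrite sdistxx mul0r add0r => h5.
have h6 : sn (d n) * sdist (y n) (y N) <= C * sdist (y n) (y N).
  by rewrite ler_wpM2r ?sn_ge0 ?dB.
have h7 : C * sdist (y n) (y N) < e / 2.
  by rewrite -ltr_pdivlMl// mulrC -mulrA -invfM; apply: H3 => //; exact: leq_maxr.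
have := cmodD (s (d n) (y n) - s (d n) (y N)) (s (d n) (y N)).
rewrite subrK; lra.
Qed.

Lemma scauchy_comb a x y : scauchy x -> scauchy y ->
  scauchy (fun n => comb a (x n) (y n)).
Proof.
move=> xC yC e e0; have a0 := cmod_ge0 a.
have [|N1 H1] := xC (e / (2 * (cmod a + 1))); first by rewrite divr_gt0//; lra.
have [|N2 H2] := yC (e / 2); first by rewrite divr_gt0.
exists (maxn N1 N2) => m n; rewrite !geq_max => /andP[m1 m2] /andP[n1 n2].
have := H1 _ _ m1 n1; have := H2 _ _ m2 n2.
set dx := sdist (x m) _; set dy := sdist (y m) _ => h2 h1.
have h : sdist (comb a (x m) (y m)) (comb a (x n) (y n)) <= cmod a * dx + dy.
  (* Without a scalar multiplication on [L], a multiple is [comb a] of a vector with a null vector,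
     here the difference of [x m] with itself. *)
  have -> : cmod a * dx = sn (comb a (sdiff (x m) (x n)) (sdiff (x m) (x m))).
    by rewrite (@sn_scale a (sdiff (x m) (x n)))// => t; rewrite s_lin (s_diff (x m) (x m)) subrr addr0.
  apply: sn_triangle => t; rewrite !(s_lin, s_diff); ring.
apply: le_lt_trans h _.
have h3 : cmod a * dx <= (cmod a + 1) * dx.
  by have : 0 <= dx := sn_ge0 _; nra.
have h4 : (cmod a + 1) * dx < e / 2.
  by rewrite -ltr_pdivlMl; [rewrite mulrC -mulrA -invfM|lra].
lra.
Qed.

End SemiInnerProduct.

(** * Hilbert spaces from sequentially complete inner products *)

Record innerSpace (R : realType) := InnerSpace {
  is_sort :> lmodType R[i];
  is_form : is_sort -> is_sort -> R[i];
  is_lin : forall a x y z,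
    is_form (a *: x + y) z = a * is_form x z + is_form y z;
  is_herm : forall x y, is_form y x = (is_form x y)^*;
  is_ge0 : forall x, 0 <= complex.Re (is_form x x);
  is_def : forall x, complex.Re (is_form x x) = 0 -> x = 0;
  is_complete : forall x : nat -> is_sort,
    scauchy (fun a x y => a *: x + y) is_form x ->
    exists l, forall e : R, 0 < e ->
      exists N, forall n, (N <= n)%N -> sn is_form (x n - l) < e
}.

Section HilbertOfInnerSpace.
Variables (R : realType) (E : innerSpace R).

Definition hcar : Type := is_sort E.
HB.instance Definition _ := GRing.Lmodule.on hcar.

Let f : hcar -> hcar -> R[i] := @is_form R E.
Let comb (a : R[i]) (x y : hcar) : hcar := a *: x + y.

Let f_lin a x y z : f (comb a x y) z = a * f x z + f y z.
Proof. exact: is_lin. Qed.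
Let f_herm x y : f y x = (f x y)^*.
Proof. exact: is_herm. Qed.
Let f_ge0 x : 0 <= complex.Re (f x x).
Proof. exact: is_ge0. Qed.

Definition hcar_norm (x : hcar) : R[i] := (sn f x)%:C%C.

Lemma hcar_ler_normD x y : hcar_norm (x + y) <= hcar_norm x + hcar_norm y.
Proof.
rewrite /hcar_norm -real_complexD lecR.
by apply: (sn_triangle f_lin f_herm f_ge0) => t; rewrite -(scale1r x) f_lin scale1r mul1r.
Qed.

Let f0 t : f 0 t = 0.
Proof.
have := f_lin (-1) 0 0 t; rewrite /comb scaler0 addr0 mulN1r addNr.
by [].
Qed.

Let fZ a x t : f (a *: x) t = a * f x t.
Proof. by rewrite -[a *: x]addr0 f_lin f0 addr0. Qed.

Lemma hcar_normrZ (a : R[i]) x : hcar_norm (a *: x) = `|a| * hcar_norm x.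
Proof.
rewrite /hcar_norm normcE_cmod -real_complexM; congr (_%:C)%C.
by apply: (sn_scale f_herm) => t; exact: fZ.
Qed.

Lemma hcar_normr0_eq0 x : hcar_norm x = 0 -> x = 0.
Proof.
move=> [] x0; apply: is_def; have := sn_sqr f_ge0 x.
by rewrite x0 expr0n /= => /esym.
Qed.

HB.instance Definition _ := Lmodule_isNormed.Build R[i] hcar
  hcar_ler_normD hcar_normrZ hcar_normr0_eq0.

Lemma hcar_sdist (x y : hcar) : sdist comb f x y = complex.Re `|x - y|.
Proof. by rewrite /= /sdist /sdiff /comb scaleN1r addrC. Qed.

(** A Cauchy filter contains a ball of each radius [1 / (n + 1)]. Any two of these balls meet, so
    their centres form a Cauchy sequence, and its limit attracts the filter. *)
Lemma hcar_cauchy_cvg (F : set_system hcar) : ProperFilter F -> cauchy F -> cvg F.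
Proof.
move=> FF /cauchy_ballP Fc.
have e0 (n : nat) : 0 < n.+1%:R^-1 :> R by rewrite invr_gt0.
have H n : exists x : hcar, F (ball x (n.+1%:R^-1)%:C%C).
  by apply: (cauchyP F).1; [apply/cauchy_ballP|rewrite -[0]/(0%:C%C) ltcR].
have [x xP] := choice H.
have xB n m : `|x n - x m| <= (n.+1%:R^-1 + m.+1%:R^-1)%:C%C.
  have [z [/= nz mz]] := filter_ex (filterI (xP n) (xP m)).
  move: nz mz; rewrite -!ball_normE /= => nz mz.
  rewrite real_complexD -[x n](subrK z) -addrA (le_trans (ler_normD _ _))//.
  by apply: lerD; rewrite ltW// distrC.
have xC : scauchy comb f x.
  move=> e e_gt0.
  have [N NP] : exists N, forall n, (N <= n)%N -> n.+1%:R^-1 < e / 2.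
    pose N := Num.truncn (2 / e); exists N => n Nn.
    rewrite -[ltRHS]invrK ltf_pV2 ?posrE ?invr_gt0 ?divr_gt0//.
    rewrite invf_div (lt_le_trans (truncnS_gt _))//.
    by rewrite ler_nat.
  exists N => m n /NP hm /NP hn; rewrite hcar_sdist -ltcR.
  have := xB m n; rewrite lecE => /andP[_]/= h; rewrite ltcR.
  by apply: le_lt_trans h _; rewrite (splitr e) ltrD.
have [l lP] := is_complete xC.
apply/cvg_ex; exists (l : hcar); apply/cvgrPdist_lt => e.
rewrite ltcE => /andP[/eqP ei /= er].
have [N1 H1] := lP _ (divr_gt0 er (ltr0n _ 2)).
pose N2 := Num.truncn (2 / complex.Re e); pose n := maxn N1 N2.
have hn : n.+1%:R^-1 < complex.Re e / 2.
  rewrite -[ltRHS]invrK ltf_pV2 ?posrE ?invr_gt0 ?divr_gt0//.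
  rewrite invf_div (lt_le_trans (truncnS_gt _))// ler_nat ltnS; exact: leq_maxr.
have h1 := H1 n (leq_maxl _ _).
have eE : e = (complex.Re e)%:C%C by case: (e) ei => ? ? /= ->.
apply: filterS (xP n) => z; rewrite -ball_normE /= => hz.
rewrite -(subrK (x n) l) -addrA (le_lt_trans (ler_normD _ _))// distrC.
rewrite eE (splitr (complex.Re e)) real_complexD ltrD//.
  by rewrite -[_ / 2]/(_) -[`|_|]/(hcar_norm _) /hcar_norm ltcR.
by rewrite (lt_trans hz)// ltcR.
Qed.

HB.instance Definition _ := Uniform_isComplete.Build hcar hcar_cauchy_cvg.

Definition hcar_dot (x y : hcar) : R[i] := f x y.

Lemma hcar_dot_bilinear :
  bilinear_for *%R (@Num.conj R[i] \; *%R : R[i] -> R[i] -> R[i]) hcar_dot.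
Proof.
split=> [z a x y|z a x y]; first exact: f_lin.
exact: (s_linr f_lin f_herm).
Qed.

HB.instance Definition _ := @bilinear_isBilinear.Build R[i] hcar hcar R[i]
  *%R (@Num.conj R[i] \; *%R) hcar_dot hcar_dot_bilinear.

Lemma hcar_dot_herm x y :
  hcar_dot x y = (-1) ^+ false * (@Num.conj R[i]) (hcar_dot y x).
Proof. by rewrite expr0 mul1r; exact: f_herm. Qed.

HB.instance Definition _ := @isHermitianSesquilinear.Build R[i] hcar false
  (@Num.conj R[i]) hcar_dot hcar_dot_herm.

Lemma hcar_dot_gt0 x : x != 0 -> 0 < hcar_dot x x.
Proof.
move=> x0; rewrite /hcar_dot (s_diag f_herm) -[0]/(0%:C%C) ltcR lt_def f_ge0 andbT.
by apply: contra_neq x0; exact: is_def.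
Qed.

HB.instance Definition _ := @isDotProduct.Build R[i] hcar hcar_dot hcar_dot_gt0.

Lemma hcar_norm_dot (v : hcar) : `|v| ^+ 2 = hcar_dot v v.
Proof. by rewrite -[`|v|]/(hcar_norm v) -rmorphXn/= (sn_sqr f_ge0) /hcar_dot (s_diag f_herm). Qed.

Definition hilbert_of : hilbertSpace R := @HilbertSpace R hcar hcar_dot hcar_norm_dot.

End HilbertOfInnerSpace.

(** * Inner products, closures and sequences in a Hilbert space *)

Section HilbertToolkit.
Variables (R : realType) (V : hilbertSpace R).
Implicit Types (u v w : V) (a : R[i]).
Local Notation ip := (hs_inner V).

Definition lcomb (a : R[i]) (u v : V) : V := a *: u + v.

Lemma ipDl u v w : ip (u + v) w = ip u w + ip v w.
Proof. exact: linearDl. Qed.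

Lemma ipDr u v w : ip w (u + v) = ip w u + ip w v.
Proof. exact: linearDr. Qed.

Lemma ipZl a u w : ip (a *: u) w = a * ip u w.
Proof. by rewrite linearZl_LR. Qed.

Lemma ipZr a u w : ip w (a *: u) = a^* * ip w u.
Proof. by rewrite linearZr_LR. Qed.

Lemma ip0l w : ip 0 w = 0.
Proof. by rewrite linear0l. Qed.

Lemma ip0r w : ip w 0 = 0.
Proof. by rewrite linear0r. Qed.

Lemma ipBl u v w : ip (u - v) w = ip u w - ip v w.
Proof. by rewrite linearBl. Qed.

Lemma ipBr u v w : ip w (u - v) = ip w u - ip w v.
Proof. by rewrite linearBr. Qed.

Lemma ip_suml I (r : seq I) (F : I -> V) w :
  ip (\sum_(i <- r) F i) w = \sum_(i <- r) ip (F i) w.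
Proof. by elim: r => [|i r IH]; rewrite ?big_nil ?ip0l// !big_cons ipDl IH. Qed.

Lemma ip_sumr I (r : seq I) (F : I -> V) w :
  ip w (\sum_(i <- r) F i) = \sum_(i <- r) ip w (F i).
Proof. by elim: r => [|i r IH]; rewrite ?big_nil ?ip0r// !big_cons ipDr IH. Qed.

Lemma ip_lin a u v w : ip (lcomb a u v) w = a * ip u w + ip v w.
Proof. by rewrite /lcomb ipDl ipZl. Qed.

Lemma ip_herm u v : ip v u = (ip u v)^*.
Proof. by rewrite [LHS](hermitian_subproof (s := ip)) expr0 mul1r. Qed.

Lemma ip_normE v : ip v v = `|v| ^+ 2.
Proof. by rewrite hs_norm. Qed.

Lemma ip_ge0 v : 0 <= complex.Re (ip v v).
Proof.
have : 0 <= ip v v by rewrite ip_normE exprn_ge0.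
by rewrite ge0_complexE => /andP[].
Qed.

Definition hn v : R := sn ip v.

Lemma normE v : `|v| = (hn v)%:C%C.
Proof.
apply/eqP; rewrite -(@eqrXn2 _ 2)//; last first.
  by rewrite -[0]/(0%:C%C) lecR sn_ge0.
by rewrite hs_norm -rmorphXn/= (sn_sqr ip_ge0) (s_diag ip_herm).
Qed.

Lemma hn_ge0 v : 0 <= hn v. Proof. exact: sn_ge0. Qed.

Lemma ipE v : ip v v = (hn v ^+ 2)%:C%C.
Proof. by rewrite (sn_sqr ip_ge0) (s_diag ip_herm). Qed.

Lemma hn_eq0 v : hn v = 0 -> v = 0.
Proof. by move=> v0; apply/normr0_eq0; rewrite normE v0. Qed.

Lemma hnD u v : hn (u + v) <= hn u + hn v.
Proof. by rewrite -lecR real_complexD -!normE ler_normD. Qed.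

Lemma hnN v : hn (- v) = hn v.
Proof. by apply: (@complexI R); rewrite -!normE normrN. Qed.

Lemma hnZ a v : hn (a *: v) = cmod a * hn v.
Proof. by apply: (@complexI R); rewrite real_complexM -!normE -normcE_cmod normrZ. Qed.

Lemma hn0 : hn 0 = 0.
Proof. by apply: (@complexI R); rewrite -!normE normr0. Qed.

Lemma hnB u v : hn (u - v) = hn (v - u).
Proof. by rewrite -hnN opprB. Qed.

Lemma hn_triangle w u v : hn (u - v) <= hn (u - w) + hn (w - v).
Proof. by rewrite -[u - v](subrKA w) (le_trans (hnD _ _)). Qed.

Lemma ip_CS u v : cmod (ip u v) <= hn u * hn v.
Proof. exact: (semi_CauchySchwarz ip_lin ip_herm ip_ge0). Qed.

Lemma ip_sdist u v : sdist lcomb ip u v = hn (u - v).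
Proof. by rewrite /sdist /sdiff /lcomb scaleN1r addrC. Qed.

Lemma ip_inj u v : (forall w, ip u w = ip v w) -> u = v.
Proof.
move=> uv; apply/eqP; rewrite -subr_eq0; apply/eqP/hn_eq0.
apply/eqP; rewrite -sqrf_eq0; apply/eqP/(@complexI R).
by rewrite -ipE ipBl !uv subrr.
Qed.

Lemma hclosureP (A : set V) v :
  closure A v <-> forall e : R, 0 < e -> exists2 a, A a & hn (v - a) < e.
Proof.
split=> [Av e e0|H B /nbhs_normP[e /=]].
  have /Av[a [Aa]] : nbhs v (ball v e%:C%C).
    by apply: nbhsx_ballx; rewrite -[0]/(0%:C%C) ltcR.
  by rewrite -ball_normE /= normE ltcR; exists a.
rewrite ltcE => /andP[/eqP ei /= er] eB.
have [a Aa av] := H _ er; exists a; split=> //; apply: eB => /=.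
rewrite normE (_ : e = (complex.Re e)%:C%C) ?ltcR//.
by case: (e) ei => ? ? /= ->.
Qed.

Definition hcvg (x : nat -> V) v := forall e : R, 0 < e ->
  exists N, forall n, (N <= n)%N -> hn (x n - v) < e.

Lemma hcomplete (x : nat -> V) : scauchy lcomb ip x -> exists v, hcvg x v.
Proof.
move=> xC; have : cvg (x @ \oo).
  apply: cauchy_cvg; apply: cauchy_exP => e.
  rewrite ltcE => /andP[/eqP ei /= er].
  have eE : e = (complex.Re e)%:C%C by case: (e) ei => ? ? /= ->.
  have [N H] := xC _ er; exists (x N); exists N => // n /= Nn.
  by rewrite -ball_normE /= eE normE ltcR -ip_sdist; exact: H.
move/cvg_ex => [l ul]; exists l => e e0.
have e0' : 0 < e%:C%C by rewrite -[0]/(0%:C%C) ltcR.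
have /cvgrPdist_lt/(_ _ e0') [N _ H] := ul.
by exists N => n /H /=; rewrite distrC normE ltcR.
Qed.

Lemma hcvg_unique x u v : hcvg x u -> hcvg x v -> u = v.
Proof.
move=> xu xv; apply/eqP; rewrite -subr_eq0; apply/eqP/hn_eq0.
apply/eqP; rewrite eq_le hn_ge0 andbT; apply/ler_addgt0Pl => e e0; rewrite addr0.
have [N1 H1] := xu _ (divr_gt0 e0 (ltr0n _ 2)).
have [N2 H2] := xv _ (divr_gt0 e0 (ltr0n _ 2)).
have /H1 := leq_maxl N1 N2; have /H2 := leq_maxr N1 N2.
have := hn_triangle (x (maxn N1 N2)) u v; rewrite (hnB u (x _)); lra.
Qed.

Lemma hcvg_cauchy x v : hcvg x v -> scauchy lcomb ip x.
Proof.
move=> xv e e0; have [N H] := xv _ (divr_gt0 e0 (ltr0n _ 2)).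
exists N => m n /H hm /H hn'; rewrite ip_sdist.
by have := hn_triangle v (x m) (x n); rewrite (hnB v (x n)); lra.
Qed.

Lemma hcvgP (A : set V) v : closure A v ->
  exists2 x : nat -> V, forall n, A (x n) & hcvg x v.
Proof.
move=> /hclosureP Av.
have H (n : nat) : exists b : V, A b /\ hn (v - b) < n.+1%:R^-1.
  by have [|b] := Av n.+1%:R^-1; rewrite ?invr_gt0//; exists b.
have [x xP] := choice H; exists x; first by move=> n; case: (xP n).
move=> e e0; exists (Num.truncn e^-1) => n Nn; rewrite hnB.
apply: lt_trans (xP n).2 _.
rewrite -[ltRHS]invrK ltf_pV2 ?posrE ?invr_gt0//.
by rewrite (lt_le_trans (truncnS_gt _))// ler_nat.
Qed.

Lemma hcvg_comb a x y u v : hcvg x u -> hcvg y v ->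
  hcvg (fun n => a *: x n + y n) (a *: u + v).
Proof.
move=> xu yv e e0; have a0 := cmod_ge0 a.
have [|N1 H1] := xu (e / (2 * (cmod a + 1))); first by rewrite divr_gt0//; lra.
have [N2 H2] := yv _ (divr_gt0 e0 (ltr0n _ 2)).
exists (maxn N1 N2) => n; rewrite geq_max => /andP[/H1 h1 /H2 h2].
rewrite (_ : _ - _ = a *: (x n - u) + (y n - v)); last first.
  by rewrite scalerBr opprD addrACA.
apply: le_lt_trans (hnD _ _) _; rewrite hnZ.
have h3 : cmod a * hn (x n - u) <= (cmod a + 1) * hn (x n - u).
  by have := hn_ge0 (x n - u); nra.
have h4 : (cmod a + 1) * hn (x n - u) < e / 2.
  by rewrite -ltr_pdivlMl; [rewrite mulrC -mulrA -invfM|lra].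
lra.
Qed.

End HilbertToolkit.

(** * Completion of a semi-inner product *)

Section Completion.
Variable R : realType.

(** The carrier has no zero; [si_pt] provides the null vector [si_comb (-1) si_pt si_pt]. *)
Record semiInner := SemiInner {
  si_type :> Type;
  si_pt : si_type;
  si_comb : R[i] -> si_type -> si_type -> si_type;
  si_form : si_type -> si_type -> R[i];
  si_lin : forall a x y z,
    si_form (si_comb a x y) z = a * si_form x z + si_form y z;
  si_herm : forall x y, si_form y x = (si_form x y)^*;
  si_ge0 : forall x, 0 <= complex.Re (si_form x x)
}.

Variable S : semiInner.
Local Notation s := (@si_form S).
Local Notation comb := (@si_comb S).
Local Notation cauchy x := (scauchy comb s x).
Implicit Type phi : S -> R[i]^o.

(** A point of the completion is the functional [t |-> lim s (x n) t] of a Cauchy sequence.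
    Functionals in place of classes of sequences identify equivalent sequences and kill null vectors
    without a quotient, and their linear structure is pointwise. *)
Definition represents (x : nat -> S) phi :=
  cauchy x /\ forall t, ccvg (fun n => s (x n) t) (phi t).

Definition cpred : {pred (S -> R[i]^o)} :=
  fun phi => `[< exists x, represents x phi >].

Lemma represents_comb a x y phi psi : represents x phi -> represents y psi ->
  represents (fun n => comb a (x n) (y n)) (a *: phi + psi).
Proof.
move=> [xC xp] [yC yp]; split.
  exact: (scauchy_comb (@si_lin S) (@si_herm S) (@si_ge0 S)).
move=> t; apply: ccvg_eq (ccvgD (ccvgZ a (xp t)) (yp t)) => n.
by rewrite si_lin.
Qed.

Lemma cst_cauchy t : cauchy (fun=> t).
Proof.
move=> e e0; exists 0%N => m n _ _.
by rewrite (sdistxx (@si_lin S) (@si_herm S)).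
Qed.

Lemma represents_cst t : represents (fun=> t) (s t).
Proof. by split=> [|u]; [exact: cst_cauchy|exact: ccvg_cst]. Qed.

Lemma cpred_submod : submod_closed cpred.
Proof.
split=> [|a phi psi /asboolP[x xP] /asboolP[y yP]]; apply/asboolP.
  exists (fun=> comb (-1) (si_pt S) (si_pt S)); split; first exact: cst_cauchy.
  move=> u; rewrite si_lin mulN1r addNr; exact: ccvg_cst.
by eexists; exact: represents_comb xP yP.
Qed.

HB.instance Definition _ := GRing.isSubmodClosed.Build R[i] (S -> R[i]^o)
  cpred cpred_submod.

Definition compl := {phi : S -> R[i]^o | phi \in cpred}.
HB.instance Definition _ := SubChoice.on compl.
HB.instance Definition _ := [SubChoice_isSubLmodule of compl by <:].

Implicit Types f g h : compl.

Lemma rep_ex f : exists x, represents x (val f).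
Proof. by have /asboolP := valP f. Qed.

Definition crep f : nat -> S := sval (cid (rep_ex f)).

Lemma crepP f : represents (crep f) (val f).
Proof. by rewrite /crep; case: cid. Qed.

Let wnull := scauchy_weak_null (@si_lin S) (@si_herm S) (@si_ge0 S).

Lemma represents_null x y phi : represents x phi -> represents y phi ->
  forall z, cauchy z -> ccvg (fun n => s (x n) (z n) - s (y n) (z n)) 0.
Proof.
move=> xp yp z zC; have [dC d0] := represents_comb (-1) yp xp.
have e0 : (-1) *: phi + phi = 0 by rewrite scaleN1r addNr.
rewrite {}e0 in d0.
apply: ccvg_eq (wnull dC d0 zC) => n /=.
by rewrite si_lin mulN1r addrC.
Qed.

Definition cform f g : R[i] :=
  sval (cid (scauchy_form (@si_lin S) (@si_herm S) (@si_ge0 S)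
    (crepP f).1 (crepP g).1)).

Lemma cformP f g x y : represents x (val f) -> represents y (val g) ->
  ccvg (fun n => s (x n) (y n)) (cform f g).
Proof.
move=> xf yg; rewrite /cform; case: cid => l /= lP.
have h1 := represents_null xf (crepP f) yg.1.
have h2 := ccvgJ (represents_null yg (crepP g) (crepP f).1).
have := ccvgD (ccvgD lP h1) h2; rewrite rmorph0 !addr0; apply: ccvg_eq => n /=.
by rewrite rmorphB /= -!si_herm; ring.
Qed.

Lemma cform_lin a f g h : cform (a *: f + g) h = a * cform f h + cform g h.
Proof.
have rf := crepP f; have rg := crepP g; have rh := crepP h.
have r : represents (fun n => comb a (crep f n) (crep g n)) (val (a *: f + g)).
  exact: represents_comb.
apply: ccvg_unique (cformP r rh) _.
apply: ccvg_eq (ccvgD (ccvgZ a (cformP rf rh)) (cformP rg rh)) => n /=.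
by rewrite si_lin.
Qed.

Lemma cform_herm f g : cform g f = (cform f g)^*.
Proof.
have rf := crepP f; have rg := crepP g.
apply: ccvg_unique (cformP rg rf) _.
by apply: ccvg_eq (ccvgJ (cformP rf rg)) => n /=; rewrite -si_herm.
Qed.

Lemma cform_ge0 f : 0 <= complex.Re (cform f f).
Proof.
by apply: (ccvg_Re_ge (N := 0) (cformP (crepP f) (crepP f))) => n _; exact: si_ge0.
Qed.

Lemma cj_subproof t : (s t : S -> R[i]^o) \in cpred.
Proof. by apply/asboolP; exists (fun=> t); exact: represents_cst. Qed.

Definition cj t : compl := Sub (s t : S -> R[i]^o) (cj_subproof t).

Lemma cform_cj f t : cform f (cj t) = val f t.
Proof.
have rf := crepP f; apply: ccvg_unique (cformP (g := cj t) rf (represents_cst t)) _.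
exact: rf.2.
Qed.

(** As for a reproducing kernel, [cform_cj] makes evaluation at [t] a pairing with [cj t]; by
    Cauchy-Schwarz a functional of norm zero then vanishes at every [t]. *)
Lemma cform_def f : complex.Re (cform f f) = 0 -> f = 0.
Proof.
move=> f0; apply: val_inj; apply/funext => t; rewrite -cform_cj /=.
apply: cmod0_eq0; apply/eqP; rewrite eq_le cmod_ge0 andbT.
have := semi_CauchySchwarz (comb := fun a f g => a *: f + g) cform_lin
  cform_herm cform_ge0 f (cj t).
by have -> : sn cform f = 0; [rewrite /sn /sqn f0 sqrtr0|rewrite mul0r].
Qed.

Lemma cform_cjj t u : cform (cj t) (cj u) = s t u.
Proof. by rewrite cform_cj. Qed.

Let fsn_ge0 := @sn_ge0 R compl cform.
Let fn := sn cform.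

Lemma cj_approx f x (e : R) N : represents x (val f) ->
  (forall n, (N <= n)%N -> sdist comb s (x n) (x N) <= e) ->
  fn (f - cj (x N)) <= e.
Proof.
move=> xf xe.
have e0 : 0 <= e by apply: le_trans (xe N (leqnn N)); exact: sn_ge0.
rewrite -(ler_pXn2r (_ : (0 < 2)%N)) ?nnegrE// ?fsn_ge0// /fn (sn_sqr cform_ge0).
have r := represents_comb (-1) (represents_cst (x N)) xf.
have rf : represents (fun n => comb (-1) (x N) (x n)) (val (f - cj (x N))).
  have <- : (-1) *: (s (x N) : S -> R[i]^o) + val f = val (f - cj (x N)).
    by rewrite scaleN1r addrC.
  exact: r.
apply: (ccvg_Re_le (N := N) (cformP rf rf)) => n Nn.
rewrite -/(sqn s _) -(sn_sqr (@si_ge0 S)) ler_pXn2r ?nnegrE ?sn_ge0//.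
exact: xe.
Qed.

Lemma cj_dense f (e : R) : 0 < e -> exists t, fn (f - cj t) < e.
Proof.
move=> e0; have rf := crepP f.
have [N H] := rf.1 _ (divr_gt0 e0 (ltr0n _ 2)).
exists (crep f N); apply: (@le_lt_trans _ _ (e / 2)); last lra.
by apply: cj_approx rf _ => n Nn; apply/ltW/H.
Qed.

Let fcomb (a : R[i]) f g := a *: f + g.

Lemma cform_sdist f g : sdist fcomb cform f g = fn (f - g).
Proof. by rewrite /sdist /sdiff /fcomb scaleN1r addrC. Qed.

Let ftri := sdist_triangle (comb := fcomb) cform_lin cform_herm cform_ge0.
Let fsym := sdistC (comb := fcomb) cform_lin cform_herm.

Lemma cj_sdist t u : sdist fcomb cform (cj t) (cj u) = sdist comb s t u.
Proof.
rewrite /sdist /sn /sdiff (sqn_comb (comb := fcomb) cform_lin cform_herm).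
by rewrite (sqn_comb (@si_lin S) (@si_herm S)) /sqn !cform_cjj.
Qed.

Let fn_triangle f g h : fn (f - h) <= fn (f - g) + fn (g - h).
Proof. by rewrite -!cform_sdist; exact: ftri. Qed.

Let fnC f g : fn (f - g) = fn (g - f).
Proof. by rewrite -!cform_sdist; exact: fsym. Qed.

(** Each [x n] is replaced by some [cj (t n)] at distance less than [1 / (n + 1)]. Since [cj]
    preserves distances, [t] is Cauchy in [S], and the functional that it represents is the
    limit. *)
Lemma cform_complete (x : nat -> compl) : scauchy fcomb cform x ->
  exists l, forall e : R, 0 < e ->
    exists N, forall n, (N <= n)%N -> fn (x n - l) < e.
Proof.
move=> xC.
have H (n : nat) : exists t, fn (x n - cj t) < n.+1%:R^-1.
  by apply: cj_dense; rewrite invr_gt0.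
have [t tP] := choice H.
have small (e : R) : 0 < e -> exists N, forall n, (N <= n)%N -> fn (x n - cj (t n)) < e.
  move=> e0; exists (Num.truncn e^-1) => n Nn; apply: lt_trans (tP n) _.
  rewrite -[ltRHS]invrK ltf_pV2 ?posrE ?invr_gt0//.
  by rewrite (lt_le_trans (truncnS_gt _))// ler_nat.
have tC : cauchy t.
  move=> e e0; have e4 : 0 < e / 4 by lra.
  have [N1 H1] := small _ e4; have [N2 H2] := xC _ e4.
  exists (maxn N1 N2) => m n; rewrite !geq_max => /andP[m1 m2] /andP[n1 n2].
  have h3 := H2 _ _ m2 n2; rewrite cform_sdist in h3.
  have h := ltrD (H1 _ m1) (ltrD h3 (H1 _ n1)).
  rewrite -cj_sdist cform_sdist; apply: le_lt_trans (fn_triangle _ (x m) _) _.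
  rewrite (fnC (cj (t m))).
  apply: le_lt_trans (lerD (lexx _) (fn_triangle (x m) (x n) (cj (t n)))) _.
  by apply: lt_trans h _; lra.
have phiP u := cid (scauchy_form (@si_lin S) (@si_herm S) (@si_ge0 S) tC (cst_cauchy u)).
pose phi u : R[i]^o := sval (phiP u).
have tphi : represents t phi.
  by split=> // u; rewrite /phi; case: (phiP u).
have phic : phi \in cpred by apply/asboolP; exists t.
pose f : compl := Sub phi phic; exists f => e e0.
have e4 : 0 < e / 4 by lra.
have [N1 H1] := small _ e4; have [N2 H2] := tC _ e4.
exists (maxn N1 N2) => n; rewrite geq_max => /andP[n1 n2].
have h : fn (cj (t n) - f) <= e / 4.
  by rewrite fnC; apply: (@cj_approx f t (e / 4) n tphi) => m nm; apply/ltW/H2 => //; exact: leq_trans nm.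
apply: le_lt_trans (fn_triangle _ (cj (t n)) _) _.
by apply: lt_le_trans (ltr_leD (H1 _ n1) h) _; lra.
Qed.

Definition compl_inner : innerSpace R :=
  InnerSpace cform_lin cform_herm cform_ge0 cform_def cform_complete.

Theorem completion : exists (K : hilbertSpace R) (j : S -> K),
  [/\ forall a x y, j (comb a x y) = a *: j x + j y,
      forall x y, hs_inner K (j x) (j y) = s x y &
      closure (range j) = setT].
Proof.
exists (hilbert_of compl_inner), (cj : S -> hilbert_of compl_inner); split.
- move=> a x y; apply: val_inj; apply/funext => t /=; exact: si_lin.
- exact: cform_cjj.
- rewrite -subTset => v _; apply/hclosureP => e /(cj_dense v)[t tP].
  by exists (cj t) => //; exists t.
Qed.

End Completion.

(** * Dense families and extension of operators *)

Section FormalCombinations.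
Variable R : realType.

Definition lsum (S : Type) (V : lmodType R[i]) (a : S -> V) (p : seq (R[i] * S)) : V :=
  \sum_(u <- p) u.1 *: a u.2.

Definition fcomb (S : Type) (c : R[i]) (p q : seq (R[i] * S)) :=
  [seq (c * u.1, u.2) | u <- p] ++ q.

Lemma lsum_fcomb S (V : lmodType R[i]) (a : S -> V) c p q :
  lsum a (fcomb c p q) = c *: lsum a p + lsum a q.
Proof.
rewrite /lsum big_cat big_map scaler_sumr; congr (_ + _).
by apply: eq_bigr => u _; rewrite scalerA.
Qed.

Lemma lsum1 S (V : lmodType R[i]) (a : S -> V) x : lsum a [:: (1, x)] = a x.
Proof. by rewrite /lsum big_seq1 scale1r. Qed.

Lemma span_lsum (V : hilbertSpace R) S (a : S -> V) (A : set V) v :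
  A `<=` range a -> linear_span A v -> exists p, v = lsum a p.
Proof.
move=> Aa [n [c [w [Aw ->]]]].
have H i : exists x, a x = w i by have [x _ <-] := Aa _ (Aw i); exists x.
have [f fP] := choice H.
exists [seq (c i, f i) | i <- enum 'I_n]; rewrite /lsum big_map big_enum /=.
by apply: eq_bigr => i _; rewrite fP.
Qed.

Lemma lsum_span (V : hilbertSpace R) S (a : S -> V) (A : set V) p :
  (forall x, A (a x)) -> linear_span A (lsum a p).
Proof.
move=> Aa; exists (size p).
exists (fun i => (tnth (in_tuple p) i).1), (fun i => a (tnth (in_tuple p) i).2).
by split=> //; rewrite /lsum big_tnth.
Qed.

Definition dense_family (V : hilbertSpace R) S (a : S -> V) :=
  forall v (e : R), 0 < e -> exists p, hn (v - lsum a p) < e.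

Lemma closed_span_dense (V : hilbertSpace R) S (a : S -> V) (A : set V) :
  A `<=` range a -> closed_span A = setT -> dense_family a.
Proof.
move=> Aa AT v e e0; have : closed_span A v by rewrite AT.
by move=> /hclosureP/(_ e e0)[w /(span_lsum Aa)[p ->]]; exists p.
Qed.

Lemma dense_closed_span (V : hilbertSpace R) S (a : S -> V) (A : set V) :
  (forall x, A (a x)) -> dense_family a -> closed_span A = setT.
Proof.
move=> Aa D; rewrite -subTset => v _; apply/hclosureP => e /(D v)[p vp].
by exists (lsum a p) => //; exact: lsum_span.
Qed.

Lemma dense_cvg (V : hilbertSpace R) S (a : S -> V) : dense_family a ->
  forall v, exists p : nat -> seq (R[i] * S), hcvg (fun n => lsum a (p n)) v.
Proof.
move=> D v; have [|x xP xv] := @hcvgP R V (range (lsum a)) v.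
  apply/hclosureP => e /(D v)[p vp]; by exists (lsum a p).
have H n : exists p, x n = lsum a p by have [p _ <-] := xP n; exists p.
have [p pP] := choice H; exists p.
by move=> e /xv[N NP]; exists N => n; rewrite -pP; exact: NP.
Qed.

Lemma dense_functional0 (V : hilbertSpace R) S (a : S -> V) (f : V -> R[i]) (C : R) :
  dense_family a -> (forall c u v, f (c *: u + v) = c * f u + f v) ->
  (forall v, cmod (f v) <= C * hn v) -> (forall x, f (a x) = 0) ->
  forall v, f v = 0.
Proof.
move=> D fl fC fa v.
have f0 : f 0 = 0.
  have := fl (-1) 0 0; by rewrite scaler0 addr0 mulN1r addNr.
have fs p : f (lsum a p) = 0.
  elim: p => [|u p IH]; first by rewrite /lsum big_nil.
  by rewrite /lsum big_cons fl fa mulr0 add0r.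
apply: cmod0_eq0; apply/eqP; rewrite eq_le cmod_ge0 andbT.
apply/ler_addgt0Pl => e e0; rewrite addr0.
have C0 : 0 < `|C| + 1 by have := normr_ge0 C; lra.
have [p pP] := D v (e / (`|C| + 1)) (divr_gt0 e0 C0).
have -> : f v = f (v - lsum a p).
  by rewrite addrC -scaleN1r fl fs mulr0 add0r.
apply: le_trans (fC _) _.
have h1 : C * hn (v - lsum a p) <= (`|C| + 1) * hn (v - lsum a p).
  by rewrite ler_wpM2r ?hn_ge0//; have := ler_norm C; lra.
by apply: le_trans h1 _; rewrite -ler_pdivlMl// mulrC ltW.
Qed.

Definition bounded_by (V W : hilbertSpace R) (T : V -> W) (M : R) :=
  forall v, hn (T v) <= M * hn v.

Lemma bounded_opP (V W : hilbertSpace R) (T : V -> W) :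
  bounded_op T <-> exists2 M, 0 <= M & bounded_by T M.
Proof.
split=> [[M TM]|[M M0 TM]].
  exists `|M| => // v; have := TM v; rewrite !normE -real_complexM lecR.
  by move/le_trans; apply; rewrite ler_wpM2r ?hn_ge0 ?ler_norm.
by exists M => v; rewrite !normE -real_complexM lecR.
Qed.

Lemma bounded_ext (V W : hilbertSpace R) S (a : S -> V) (T T' : V -> W) (M M' : R) :
  dense_family a -> linear T -> linear T' -> bounded_by T M -> bounded_by T' M' ->
  (forall x, T (a x) = T' (a x)) -> T = T'.
Proof.
move=> D Tl Tl' TM TM' TT; apply/funext => v; apply: ip_inj => w.
apply/eqP; rewrite -subr_eq0; apply/eqP.
apply: (@dense_functional0 V S a (fun v => hs_inner W (T v) w - hs_inner W (T' v) w)
  (M * hn w + M' * hn w)) => //.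
- by move=> c u u'; rewrite Tl Tl' !ipDl !ipZl; ring.
- move=> u; rewrite -ipBl; apply: le_trans (ip_CS _ _) _.
  have := hnD (T u) (- T' u); rewrite hnN => h.
  have := TM u; have := TM' u; have := hn_ge0 w; have := hn_ge0 (T u - T' u).
  set x := hn (T u - _) in h *; set y := hn w => x0 y0 h1 h2.
  have h3 : x <= M * hn u + M' * hn u by lra.
  by have := ler_wpM2r y0 h3; lra.
- by move=> x; rewrite TT subrr.
Qed.

(** The estimate on formal combinations includes well-definedness: a combination that vanishes for
    [a] vanishes for [b]. The relation [gr] consists of limits of pairs of evaluations; the estimate
    makes it single-valued, and completeness of [W] makes it total. *)
Theorem bounded_extension (V W : hilbertSpace R) S (a : S -> V) (b : S -> W) (M : R) :
  dense_family a -> 0 <= M -> (forall p, hn (lsum b p) <= M * hn (lsum a p)) ->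
  exists T : V -> W, [/\ linear T, bounded_by T M & forall x, T (a x) = b x].
Proof.
move=> D M0 bM.
pose gr v w := exists p : nat -> seq (R[i] * S),
  hcvg (fun n => lsum a (p n)) v /\ hcvg (fun n => lsum b (p n)) w.
have grl c u v u' v' : gr u u' -> gr v v' -> gr (c *: u + v) (c *: u' + v').
  move=> [p [pa pb]] [q [qa qb]]; exists (fun n => fcomb c (p n) (q n)).
  have E (V' : hilbertSpace R) (d : S -> V') : (fun n => lsum d (fcomb c (p n) (q n))) =
      fun n => c *: lsum d (p n) + lsum d (q n).
    by apply/funext => n; rewrite lsum_fcomb.
  by rewrite !E; split; exact: hcvg_comb.
have grb v w : gr v w -> hn w <= M * hn v.
  move=> [p [pa pb]]; apply/ler_addgt0Pr => e e0.
  have [|N1 H1] := pa (e / (2 * (M + 1))); first by rewrite divr_gt0//; lra.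
  have [N2 H2] := pb _ (divr_gt0 e0 (ltr0n _ 2)).
  have /H1 := leq_maxl N1 N2; have /H2 := leq_maxr N1 N2.
  set n := maxn _ _ => h2 h1.
  have := hnD (w - lsum b (p n)) (lsum b (p n)); rewrite subrK hnB => h3.
  have := hnD (lsum a (p n) - v) v; rewrite subrK => h4.
  have h5 := bM (p n).
  have h6 : M * hn (lsum a (p n)) <= M * (hn (lsum a (p n) - v) + hn v).
    by rewrite ler_wpM2l.
  have h7 : (M + 1) * hn (lsum a (p n) - v) < e / 2.
    by rewrite -ltr_pdivlMl; [rewrite mulrC -mulrA -invfM|lra].
  by have := hn_ge0 (lsum a (p n) - v); lra.
have gru v w w' : gr v w -> gr v w' -> w = w'.
  move=> g /(grl (-1) _ _ _ _ g); rewrite !scaleN1r addNr => /grb.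
  rewrite hn0 mulr0 => h; apply/esym/eqP; rewrite -subr_eq0 addrC; apply/eqP/hn_eq0.
  by apply/eqP; rewrite eq_le h hn_ge0.
have gre v : exists w, gr v w.
  have [p pv] := dense_cvg D v.
  have [|w pw] := @hcomplete R W (fun n => lsum b (p n)); last by exists w, p.
  move=> e e0.
  have [|N H] := hcvg_cauchy pv (e := e / (M + 1)); first by rewrite divr_gt0//; lra.
  exists N => m n Nm Nn; have := H m n Nm Nn; rewrite !ip_sdist.
  have E (V' : hilbertSpace R) (d : S -> V') : lsum d (p m) - lsum d (p n) = lsum d (fcomb (-1) (p n) (p m)).
    by rewrite lsum_fcomb scaleN1r addrC.
  rewrite !E => h; apply: le_lt_trans (bM _) _.
  have h0 := hn_ge0 (lsum a (fcomb (-1) (p n) (p m))).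
  apply: (@le_lt_trans _ _ ((M + 1) * hn (lsum a (fcomb (-1) (p n) (p m))))); first by nra.
  by rewrite -ltr_pdivlMl; [rewrite mulrC|lra].
have [T TP] := choice gre; exists T; split.
- by move=> c u v; apply: (gru _ _ _ (TP _)); exact: grl.
- by move=> v; exact: grb.
- move=> x; apply: (gru _ _ _ (TP _)); exists (fun=> [:: (1, x)]).
  by rewrite !lsum1; split=> e e0; exists 0%N => n _; rewrite subrr hn0.
Qed.

Lemma ip_lsum (V : hilbertSpace R) S S' (a : S -> V) (b : S' -> V) p q :
  hs_inner V (lsum a p) (lsum b q) =
  \sum_(u <- p) \sum_(v <- q) u.1 * v.1^* * hs_inner V (a u.2) (b v.2).
Proof.
rewrite ip_suml; apply: eq_bigr => u _; rewrite ip_sumr; apply: eq_bigr => v _.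
by rewrite ipZl ipZr mulrA.
Qed.

(** Equal Gram matrices give the estimate of [bounded_extension] with constant 1. Inner products are
    then compared by density, one argument at a time, in place of polarization. *)
Theorem isometric_extension (V W : hilbertSpace R) S (a : S -> V) (b : S -> W) :
  dense_family a ->
  (forall x y, hs_inner W (b x) (b y) = hs_inner V (a x) (a y)) ->
  exists T : V -> W, [/\ linear T,
    forall u v, hs_inner W (T u) (T v) = hs_inner V u v & forall x, T (a x) = b x].
Proof.
move=> D ab.
have [p|T [Tl TM Ta]] := bounded_extension (b := b) D ler01.
  rewrite mul1r /hn /sn /sqn !ip_lsum.
  under eq_bigr do under eq_bigr do rewrite ab.
  by [].
exists T; split=> //.
have H u x : hs_inner W (T u) (b x) = hs_inner V u (a x).
  apply/eqP; rewrite -subr_eq0; apply/eqP.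
  apply: (@dense_functional0 V S a
    (fun u => hs_inner W (T u) (b x) - hs_inner V u (a x)) (hn (b x) + hn (a x))) => //.
  - by move=> c w w'; rewrite Tl !ipDl !ipZl; ring.
  - move=> w; apply: le_trans (cmodD _ _) _; rewrite cmodN mulrDl.
    rewrite lerD// (le_trans (ip_CS _ _))// mulrC//.
    by rewrite ler_wpM2l ?hn_ge0//; have := TM w; rewrite mul1r.
  - by move=> y; rewrite Ta ab subrr.
move=> u v; rewrite ip_herm (ip_herm v) /=; congr (_^*).
apply/eqP; rewrite -subr_eq0; apply/eqP.
apply: (@dense_functional0 V S a
    (fun v => hs_inner W (T v) (T u) - hs_inner V v u) (hn (T u) + hn u)) => //.
- by move=> c w w'; rewrite Tl !ipDl !ipZl; ring.
- move=> w; apply: le_trans (cmodD _ _) _; rewrite cmodN mulrDl.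
  rewrite lerD// (le_trans (ip_CS _ _))// mulrC//.
  by rewrite ler_wpM2l ?hn_ge0//; have := TM w; rewrite mul1r.
- by move=> x; rewrite Ta ip_herm H -ip_herm subrr.
Qed.

End FormalCombinations.

(** * Kolmogorov decomposition of a positive kernel *)

Section Kolmogorov.
Variables (R : realType) (S : Type) (k : S -> S -> R[i]).

Definition kform (p q : seq (R[i] * S)) : R[i] :=
  \sum_(u <- p) \sum_(v <- q) u.1 * v.1^* * k u.2 v.2.

Hypothesis k_herm : forall x y, k y x = (k x y)^*.
Hypothesis k_psd : forall p, 0 <= complex.Re (kform p p).

Lemma kform_lin c p q r : kform (fcomb c p q) r = c * kform p r + kform q r.
Proof.
rewrite /kform big_cat big_map mulr_sumr; congr (_ + _).
by apply: eq_bigr => u _; rewrite mulr_sumr; apply: eq_bigr => v _; rewrite !mulrA.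
Qed.

Lemma kform_herm p q : kform q p = (kform p q)^*.
Proof.
rewrite /kform rmorph_sum exchange_big; apply: eq_bigr => u _ /=.
rewrite rmorph_sum; apply: eq_bigr => v _ /=.
by rewrite !rmorphM /= conjCK -k_herm; ring.
Qed.

(** Formal combinations carry [kform] as a semi-inner product. Completion divides out the null
    combinations, and [j x] comes from the one-term combination with coefficient 1. *)
Theorem kolmogorov_decomposition : exists (K : hilbertSpace R) (j : S -> K),
  (forall x y, hs_inner K (j x) (j y) = k x y) /\ dense_family j.
Proof.
pose si := @SemiInner R (seq (R[i] * S)) [::] (@fcomb R S) kform kform_lin kform_herm k_psd.
have [K [J [Jl Ji Jd]]] := completion si.
exists K, (fun x => J [:: (1, x)]); split=> [x y|].
  by rewrite Ji /= /kform !big_seq1 /= rmorph1 !mul1r.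
move=> v e e0; have : closure (range J) v by rewrite Jd.
move=> /hclosureP/(_ e e0)[_ [p _ <-] vp]; exists p.
suff -> : lsum (fun x => J [:: (1, x)]) p = J p by [].
have J0 : J [::] = 0.
  have := Jl (-1) [::] [::]; by rewrite scaleN1r addNr.
elim: p {vp} => [|[c x] p IH]; first by rewrite /lsum big_nil J0.
have -> : lsum (fun x => J [:: (1, x)]) ((c, x) :: p) = c *: J [:: (1, x)] + J p.
  by rewrite -IH /lsum big_cons.
by rewrite -Jl /= /fcomb /= mulr1.
Qed.

End Kolmogorov.

(** The members of [A] are completed abstractly and the inclusion is extended isometrically;
    closedness of [A] keeps the extension inside [A]. This spares a Hilbert structure on the subset
    itself. *)
Theorem closed_subspace_hilbert (R : realType) (V : hilbertSpace R) (A : set V) :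
  A 0 -> (forall c u v, A u -> A v -> A (c *: u + v)) -> closure A `<=` A ->
  exists (K : hilbertSpace R) (i : K -> V), [/\ linear i,
    forall u v, hs_inner V (i u) (i v) = hs_inner K u v & range i = A].
Proof.
move=> A0 Al Ac; pose S := {v : V | A v}.
pose sc (c : R[i]) (x y : S) : S := exist A _ (Al c _ _ (svalP x) (svalP y)).
pose sf (x y : S) := hs_inner V (sval x) (sval y).
pose si := @SemiInner R S (exist A _ A0) sc sf
  (fun c x y z => ip_lin c (sval x) (sval y) (sval z))
  (fun x y => ip_herm (sval x) (sval y)) (fun x => ip_ge0 (sval x)).
have [K [J [Jl Ji Jd]]] := completion si.
have D : dense_family (J : S -> K).
  move=> v e e0; have : closure (range J) v by rewrite Jd.
  by move=> /hclosureP/(_ e e0)[_ [x _ <-] vx]; exists [:: (1, x)]; rewrite lsum1.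
have [i [il ip iJ]] := isometric_extension (b := @sval V A) D (fun x y => esym (Ji x y)).
exists K, i; split=> //; apply/seteqP; split=> [_ [v _ <-]|v Av]; last first.
  by exists (J (exist A v Av)) => //; rewrite iJ.
apply: Ac; apply/hclosureP => e e0; have : closure (range J) v by rewrite Jd.
move=> /hclosureP/(_ e e0)[_ [x _ <-] vx]; exists (sval x); first exact: svalP.
have {1}-> : i v - sval x = i (v - J x).
  by rewrite -iJ addrC -scaleN1r -il scaleN1r addrC.
by rewrite /hn /sn /sqn ip.
Qed.

(** * Krein-Reid inequality *)

Section LogConvex.
Variable R : realType.

(** If [g 0 < g 1], log-convexity keeps every increment at least as large as the first, so [g] grows
    at least linearly and passes the bound [C]. *)
Lemma log_convex_bounded_le (g : nat -> R) (C : R) :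
  (forall n, 0 <= g n <= C) -> (forall n, g n.+1 ^+ 2 <= g n * g n.+2) -> g 1%N <= g 0%N.
Proof.
move=> gC gl; rewrite leNgt; apply/negP => g01.
have g0 : 0 < g 0%N.
  have /andP[h _] := gC 0%N; rewrite lt_def h andbT; apply/eqP => g00.
  have := gl 0%N; rewrite g00 mul0r leNgt exprn_gt0//.
  by rewrite -g00.
have H n : g 0%N <= g n /\ g 1%N - g 0%N <= g n.+1 - g n.
  elim: n => [//|n [IH1 IH2]]; split; first by lra.
  have := gl n; move: (g n) (g n.+1) (g n.+2) IH1 IH2 => x y z h1 h2 h3.
  have x0 : 0 < x by lra.
  (* As [y ^+ 2 <= x * z], the product of [x] with [z - 2 y + x] is at least [(y - x) ^+ 2]. *)
  suff : y - x <= z - y by lra.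
  rewrite -subr_ge0 -(pmulr_rge0 _ x0).
  have := sqr_ge0 (y - x); have -> : (y - x) ^+ 2 = y ^+ 2 - 2 * (x * y) + x ^+ 2 by ring.
  nra.
have H' n : g 0%N + n%:R * (g 1%N - g 0%N) <= g n.
  elim: n => [|n IH]; first by rewrite mul0r addr0.
  by have [_] := H n; rewrite -natr1 mulrDl mul1r; move: IH; move: (n%:R * _) => t; lra.
have d0 : 0 < g 1%N - g 0%N by lra.
pose n := (Num.truncn (C / (g 1%N - g 0%N))).+1.
have := H' n; have /andP[_ hC] := gC n.
have : C / (g 1%N - g 0%N) < n%:R by exact: truncnS_gt.
by rewrite ltr_pdivrMr//; move: (n%:R * _) => t; lra.
Qed.

End LogConvex.

Section SymmetricContraction.
Variables (R : realType) (L : Type) (comb : R[i] -> L -> L -> L).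
Variables (f s : L -> L -> R[i]) (B : L -> L) (D : R).
Hypothesis f_lin : forall a x y z, f (comb a x y) z = a * f x z + f y z.
Hypothesis f_herm : forall x y, f y x = (f x y)^*.
Hypothesis f_ge0 : forall x, 0 <= complex.Re (f x x).
Hypothesis s_lin : forall a x y z, s (comb a x y) z = a * s x z + s y z.
Hypothesis s_herm : forall x y, s y x = (s x y)^*.
Hypothesis s_ge0 : forall x, 0 <= complex.Re (s x x).
Hypothesis s_bnd : forall x, complex.Re (s x x) <= D ^+ 2 * complex.Re (f x x).
Hypothesis D_ge0 : 0 <= D.
Hypothesis f_sym : forall x y, f (B x) y = f x (B y).
Hypothesis s_sym : forall x y, s (B x) y = s x (B y).
Hypothesis B_ge0 : forall x, 0 <= complex.Re (f (B x) x).
Hypothesis B_le1 : forall x, complex.Re (f (B x) x) <= complex.Re (f x x).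

(** Cauchy-Schwarz for the form [t x y = f (B x) y] at [x] and [B x] bounds the square of
    [sn f (B x)] by a product of two [t]-norms, and each of them is at most the [f]-norm because [B]
    is at most 1. *)
Lemma positive_contraction_norm x : sn f (B x) <= sn f x.
Proof.
pose t x y := f (B x) y.
have t_lin a u v w : t (comb a u v) w = a * t u w + t v w.
  by rewrite /t f_sym f_lin -!f_sym.
have t_herm u v : t v u = (t u v)^* by rewrite /t f_sym f_herm.
have tn u : sn t u <= sn f u by rewrite ler_sqrt ?f_ge0 //; exact: B_le1.
have h := semi_CauchySchwarz t_lin t_herm B_ge0 x (B x).
have h2 : sn f (B x) ^+ 2 <= cmod (t x (B x)).
  by rewrite (sn_sqr f_ge0); exact: Re_le_cmod.
have := tn x; have := tn (B x); have := sn_ge0 t x; have := sn_ge0 t (B x).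
have := sn_ge0 f x; have := sn_ge0 f (B x).
move: (sn f (B x)) (sn f x) (sn t (B x)) (sn t x) (cmod _) h h2 => a b c d e h h2 a0 b0 c0 d0 ca db.
have h3 : a ^+ 2 <= b * a by nra.
have [->//|an0] := eqVneq a 0.
have a1 : 0 < a by rewrite lt_def an0.
by rewrite -(ler_pM2r a1) -expr2.
Qed.

(* M. G. Krein's and W. T. Reid's inequality: [n |-> s (B^n x) (B^n x)] is
   log-convex and bounded, hence nonincreasing. *)
Theorem reid_inequality x : complex.Re (s (B x) x) <= complex.Re (s x x).
Proof.
pose g n := sn s (iter n B x).
have iB n : sn f (iter n B x) <= sn f x.
  by elim: n => // n IH; apply: le_trans (positive_contraction_norm _) IH.
have gC n : 0 <= g n <= D * sn f x.
  rewrite sn_ge0/=; apply: (@le_trans _ _ (D * sn f (iter n B x))); last first.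
    by rewrite ler_wpM2l.
  rewrite -(ler_pXn2r (_ : (0 < 2)%N)) ?nnegrE ?mulr_ge0 ?sn_ge0//.
  by rewrite exprMn (sn_sqr s_ge0) (sn_sqr f_ge0); exact: s_bnd.
have gl n : g n.+1 ^+ 2 <= g n * g n.+2.
  rewrite (sn_sqr s_ge0) /sqn {2}iterS -s_sym s_herm ReJ.
  by apply: le_trans (Re_le_cmod _) (semi_CauchySchwarz s_lin s_herm s_ge0 _ _).
have g10 := log_convex_bounded_le gC gl.
rewrite -/(sqn s x) -(sn_sqr s_ge0); apply: le_trans (Re_le_cmod _) _.
apply: le_trans (semi_CauchySchwarz s_lin s_herm s_ge0 _ _) _.
by rewrite expr2 ler_wpM2r ?sn_ge0.
Qed.

End SymmetricContraction.

(** * Domination of Gram matrices *)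

Section GramComparison.
Variables (R : realType) (n : nat) (V W : hilbertSpace R).
Variables (A : 'I_n -> 'I_n -> V -> V) (A' : 'I_n -> 'I_n -> W -> W).
Variables (T : V -> W) (M : R).
Hypothesis A_bnd : forall i j, bounded_op (A i j).
Hypothesis A_adj : forall i j u v, hs_inner V (A i j u) v = hs_inner V u (A j i v).
Hypothesis A'_adj : forall i j u v, hs_inner W (A' i j u) v = hs_inner W u (A' j i v).
Hypothesis T_lin : linear T.
Hypothesis M_ge0 : 0 <= M.
Hypothesis T_bnd : bounded_by T M.
Hypothesis TA : forall i j u, T (A i j u) = A' i j (T u).

Definition gram (U : hilbertSpace R) (B : 'I_n -> 'I_n -> U -> U) (x y : 'I_n -> U) : R[i] :=
  \sum_i \sum_j hs_inner U (B j i (x i)) (y j).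

Hypothesis A_ge0 : forall x, 0 <= complex.Re (gram A x x).

Let comb (a : R[i]) (x y : 'I_n -> V) i : V := a *: x i + y i.
Let f (x y : 'I_n -> V) : R[i] := \sum_i hs_inner V (x i) (y i).
Let s (x y : 'I_n -> V) : R[i] :=
  \sum_i ((M ^+ 2)%:C%C * hs_inner V (x i) (y i) - hs_inner W (T (x i)) (T (y i))).
Let Am (x : 'I_n -> V) j := \sum_i A j i (x i).

Let conjR (a : R) : (a%:C%C)^* = a%:C%C.
Proof. by rewrite conj_Creal// complex_real. Qed.

Let conjZ (a : R) (z : R[i]) : (a%:C%C * z)^* = a%:C%C * z^*.
Proof. by rewrite -{2}[a%:C%C]conjR -(rmorphM Num.conj). Qed.

Let ReS (F : 'I_n -> R[i]) : complex.Re (\sum_i F i) = \sum_i complex.Re (F i).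
Proof. by elim/big_rec2: _ => // i a b _ <-; rewrite ReD. Qed.

Let f_lin a x y z : f (comb a x y) z = a * f x z + f y z.
Proof.
rewrite /f mulr_sumr -big_split; apply: eq_bigr => i _ /=.
by rewrite /comb ipDl ipZl.
Qed.

Let f_herm x y : f y x = (f x y)^*.
Proof. by rewrite /f rmorph_sum; apply: eq_bigr => i _ /=; rewrite ip_herm. Qed.

Let f_ge0 x : 0 <= complex.Re (f x x).
Proof. by rewrite /f ReS; apply: sumr_ge0 => i _; exact: ip_ge0. Qed.

Let s_lin a x y z : s (comb a x y) z = a * s x z + s y z.
Proof.
rewrite /s mulr_sumr -big_split; apply: eq_bigr => i _ /=.
by rewrite /comb T_lin !ipDl !ipZl; ring.
Qed.

Let s_herm x y : s y x = (s x y)^*.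
Proof.
rewrite /s rmorph_sum; apply: eq_bigr => i _ /=.
by rewrite (ip_herm (x i)) (ip_herm (T (x i))) rmorphB /= conjZ.
Qed.

Let ReM2 (a : R) (z : R[i]) : complex.Re (a%:C%C * z) = a * complex.Re z.
Proof. exact: ReZ. Qed.

Let s_ge0 x : 0 <= complex.Re (s x x).
Proof.
rewrite /s ReS; apply: sumr_ge0 => i _; rewrite ReB ReM2 !ipE /=.
have := T_bnd (x i); have := hn_ge0 (T (x i)); have := hn_ge0 (x i).
move: (hn _) (hn _) => a b a0 b0 h.
rewrite subr_ge0 -exprMn ler_pXn2r ?nnegrE ?mulr_ge0//.
Qed.

Let s_bnd x : complex.Re (s x x) <= M ^+ 2 * complex.Re (f x x).
Proof.
rewrite /s /f !ReS mulr_sumr; apply: ler_sum => i _.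
by rewrite ReB ReM2 lerBlDr lerDl; exact: ip_ge0.
Qed.

Let f_Am x y : f (Am x) y = gram A x y.
Proof.
rewrite /f /gram exchange_big; apply: eq_bigr => j _ /=.
by rewrite ip_suml.
Qed.

Let s_Am x y : s (Am x) y = (M ^+ 2)%:C%C * gram A x y - gram A' (T \o x) (T \o y).
Proof.
have T0 : T 0 = 0 by have := T_lin (-1) 0 0; rewrite !scaleN1r !addNr.
rewrite /s sumrB -mulr_sumr -/(f _ _) f_Am; congr (_ - _).
rewrite /gram exchange_big; apply: eq_bigr => j _ /=.
rewrite -ip_suml; congr (hs_inner W _ _).
rewrite /Am; elim/big_rec2: _ => // i u v _ <-.
by rewrite -TA -[A j i _]scale1r T_lin !scale1r.
Qed.

Let gram_sym (U : hilbertSpace R) (B : 'I_n -> 'I_n -> U -> U) :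
  (forall i j u v, hs_inner U (B i j u) v = hs_inner U u (B j i v)) ->
  forall x y, gram B y x = (gram B x y)^*.
Proof.
move=> Badj x y; rewrite /gram exchange_big rmorph_sum; apply: eq_bigr => i _ /=.
rewrite rmorph_sum; apply: eq_bigr => j _ /=.
by rewrite Badj ip_herm.
Qed.

Let Am_f_sym x y : f (Am x) y = f x (Am y).
Proof. by rewrite (f_herm (Am y)) !f_Am (gram_sym A_adj x y) conjCK. Qed.

Let Am_s_sym x y : s (Am x) y = s x (Am y).
Proof.
rewrite (s_herm (Am y)) !s_Am (gram_sym A_adj x y) (gram_sym A'_adj (T \o x)).
by rewrite rmorphB /= conjZ !conjCK.
Qed.

Let Am_bnd : exists2 C : R, 0 < C &
  forall x, complex.Re (f (Am x) x) <= C * complex.Re (f x x).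
Proof.
have H (ij : 'I_n * 'I_n) : exists c, 0 <= c /\ bounded_by (A ij.1 ij.2) c.
  by have /bounded_opP[c c0 cP] := A_bnd ij.1 ij.2; exists c.
have [c cP] := choice H.
(* The summand 1 makes the constant positive, so that it can be inverted. *)
exists (1 + \sum_i \sum_j c (j, i)).
  rewrite ltr_pwDl//; apply: sumr_ge0 => i _; apply: sumr_ge0 => j _.
  by have [] := cP (j, i).
move=> x; rewrite f_Am mulrDl mul1r ler_wpDl ?f_ge0// /gram ReS mulr_suml.
apply: ler_sum => i _; rewrite ReS mulr_suml; apply: ler_sum => j _.
have [c0 cb] := cP (j, i); apply: le_trans (Re_le_cmod _) _.
apply: le_trans (ip_CS _ _) _.
have := cb (x i); rewrite /=.
have xi k : hn (x k) ^+ 2 <= complex.Re (f x x).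
  rewrite /f ReS (bigD1 k)//= ipE /= lerDl; apply: sumr_ge0 => l _; exact: ip_ge0.
have := xi i; have := xi j; have := hn_ge0 (x i); have := hn_ge0 (x j).
have := hn_ge0 (A j i (x i)).
move: (hn (A j i (x i))) (hn (x i)) (hn (x j)) (complex.Re _) (c _) c0 => p r q N d d0 p0 q0 r0 h1 h2 h3.
have h4 : p * q <= d * (r * q) by rewrite mulrA ler_wpM2r.
apply: le_trans h4 _; rewrite ler_wpM2l//.
by have := sqr_ge0 (r - q); nra.
Qed.

(** The matrix [A] acts as [Am], and [B = 1 - Am / C] is symmetric for [f] and [s] and lies between
    0 and 1 for [f]. Krein-Reid gives [s (B x) x <= s x x] in real parts, that is, [s (Am x) x] has
    nonnegative real part; since [T] intertwines [A] with [A'], this is the claim. *)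
Theorem gram_comparison x :
  complex.Re (gram A' (T \o x) (T \o x)) <= M ^+ 2 * complex.Re (gram A x x).
Proof.
have [C C0 CP] := Am_bnd.
pose B y : 'I_n -> V := comb (- C^-1)%:C%C (Am y) y.
have ReS2 (g : ('I_n -> V) -> ('I_n -> V) -> R[i]) y :
    (forall a x y z, g (comb a x y) z = a * g x z + g y z) ->
    complex.Re (g (B y) y) = complex.Re (g y y) - C^-1 * complex.Re (g (Am y) y).
  by move=> gl; rewrite gl ReD ReM2 mulNr addrC.
have sym (g : ('I_n -> V) -> ('I_n -> V) -> R[i]) :
    (forall a x y z, g (comb a x y) z = a * g x z + g y z) ->
    (forall x y, g y x = (g x y)^*) ->
    (forall x y, g (Am x) y = g x (Am y)) ->
    forall y z, g (B y) z = g y (B z).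
  move=> gl gh gs y z; rewrite gl (s_linr gl gh) gs; by rewrite conjR.
have C1 : 0 < C^-1 by rewrite invr_gt0.
have B0 y : 0 <= complex.Re (f (B y) y).
  by rewrite (ReS2 f)// subr_ge0 mulrC ler_pdivrMr// mulrC; exact: CP.
have B1 y : complex.Re (f (B y) y) <= complex.Re (f y y).
  by rewrite (ReS2 f)// lerBlDr lerDl mulr_ge0// ?(ltW C1)// f_Am; exact: A_ge0.
have := reid_inequality f_lin f_herm f_ge0 s_lin s_herm s_ge0
  s_bnd M_ge0 (sym f f_lin f_herm Am_f_sym) (sym s s_lin s_herm Am_s_sym) B0 B1 x.
rewrite (ReS2 s)// s_Am ReB ReM2 lerBlDr lerDl.
by rewrite pmulr_rge0// subr_ge0.
Qed.

End GramComparison.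

(** * Schlichting completion and its Haar measure *)

Section SchlichtingAction.
Variable P : heckePair.
Local Notation X := (lcosets P).
Local Notation G := (schlichting P).
Local Notation H := (@sch_sub P).
Local Notation H0 := (@hp_sub P).
Implicit Types (c d : X) (s t : G) (x y : P).

Definition base : X := \pi_X 1%g.

Definition act s c : X := val s c.

Lemma actM s t c : act (s * t)%g c = act s (act t c).
Proof. by []. Qed.

Lemma act1 c : act 1%g c = c.
Proof. exact: theta1. Qed.

Lemma actK s : cancel (act s) (act s^-1%g).
Proof. by move=> c; rewrite -actM mulVg act1. Qed.

Lemma actVK s : cancel (act s^-1%g) (act s).
Proof. by move=> c; rewrite -actM mulgV act1. Qed.

Lemma act_inj s : injective (act s). Proof. exact: can_inj (actK s). Qed.

Lemma sch_eq s t : act s =1 act t -> s = t.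
Proof. by move=> st; apply: val_inj; apply/funext. Qed.

Lemma iota_subproof x : closure (range (@theta P)) (theta x).
Proof. by apply: subset_closure; exists x. Qed.

Definition iota x : G := SigSub (mem_set (@iota_subproof x)).

Lemma act_iota x c : act (iota x) c = theta x c. Proof. by []. Qed.

Lemma iotaM x y : iota (x * y)%g = (iota x * iota y)%g.
Proof. by apply: sch_eq => c; rewrite actM !act_iota thetaM. Qed.

Lemma iota1 : iota 1%g = 1%g.
Proof. by apply: sch_eq => c; rewrite act1 act_iota theta1. Qed.

Lemma iotaV x : iota x^-1%g = (iota x)^-1%g.
Proof. by apply: (mulgI (iota x)); rewrite -iotaM !mulgV iota1. Qed.

Definition rep_iota c : G := iota (repr c).

Lemma act_rep c : act (rep_iota c) base = c.
Proof. by rewrite /rep_iota act_iota theta_pi mulg1 reprK. Qed.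

Lemma hp_subE x : H0 x <-> theta x base = base.
Proof.
rewrite theta_pi mulg1; split=> [Hx|/esym/lcoset_eqP]; last by rewrite invg1 mul1g.
by apply/esym/lcoset_eqP; rewrite invg1 mul1g.
Qed.

(** Adding the base coset to the finite set of test cosets forces the approximating elements of
    [G_0] into [H_0]; so the closure of [H_0] is the full stabilizer, and membership in it is tested
    on one coset. *)
Lemma sch_subE s : H s <-> act s base = base.
Proof.
rewrite /sch_sub /=; split=> [/closure_ptwsP/(_ [:: base])[_ [x Hx <-] xs]|sb].
  by transitivity (theta x base); [apply/esym/xs; rewrite inE|apply/hp_subE].
apply/closure_ptwsP => F; have [x xF] := schP s (base :: F).
exists (theta x); last by move=> c cF; rewrite xF// inE cF orbT.
by exists x => //; apply/hp_subE; rewrite xF ?inE ?eqxx.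
Qed.

Lemma sub1H : H 1%g. Proof. by apply/sch_subE; rewrite act1. Qed.

Lemma subMH s t : H s -> H t -> H (s * t)%g.
Proof. by move=> /sch_subE hs /sch_subE ht; apply/sch_subE; rewrite actM ht. Qed.

Lemma subVH s : H s -> H s^-1%g.
Proof. by move=> /sch_subE hs; apply/sch_subE; rewrite -{1}hs actK. Qed.

Lemma iotaH x : H (iota x) <-> H0 x.
Proof. by rewrite sch_subE hp_subE. Qed.

Lemma act_eqH s t : act s base = act t base <-> H (s^-1 * t)%g.
Proof.
rewrite sch_subE actM; split=> [<-|h]; first by rewrite actK.
by rewrite -{1}h actVK.
Qed.

Lemma sch_approx s (F : seq X) : exists x, forall c, c \in F -> theta x c = act s c.
Proof. exact: schP. Qed.

Lemma orbit_ex c : exists r : seq X, uniq r /\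
  forall d, d \in r <-> exists2 h, H0 h & theta h c = d.
Proof.
have [r rE] := hp_finite (repr c).
pose O := [seq (\pi_X y : X) | y <- r].
have OP h : H0 h -> theta h c \in O.
  move=> Hh; have : double_coset H0 (repr c) (h * repr c)%g.
    exists h => //; exists 1%g; last by rewrite mulg1.
    by have [] := hp_subgroup P.
  rewrite rE => -[y /= yr [k Hk hE]].
  apply/mapP; exists y => //.
  by apply/esym/lcoset_eqP; rewrite -hE mulKg.
exists (undup [seq d <- O | `[< exists2 h, H0 h & theta h c = d >]]).
split; first exact: undup_uniq.
move=> d; rewrite mem_undup mem_filter; split=> [/andP[/asboolP]//|[h Hh hc]].
by apply/andP; split; [apply/asboolP; exists h|rewrite -hc OP].
Qed.

Definition orb c : seq X := sval (cid (orbit_ex c)).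

Lemma orb_uniq c : uniq (orb c).
Proof. by rewrite /orb; case: cid => r []. Qed.

Lemma orbP0 c d : d \in orb c <-> exists2 h, H0 h & theta h c = d.
Proof. by rewrite /orb; case: cid => r []. Qed.

(** An element of [H_0] can imitate [s] on the two cosets [base] and [c], so passing to the closure
    enlarges no orbit, and the finiteness in the Hecke condition carries over to [H]. *)
Lemma orbP c d : d \in orb c <-> exists2 s, H s & act s c = d.
Proof.
rewrite orbP0; split=> [[h Hh <-]|[s /sch_subE sb <-]].
  by exists (iota h) => //; apply/iotaH.
have [x xF] := sch_approx s [:: base; c].
exists x; last by rewrite xF// !inE eqxx orbT.
by apply/hp_subE; rewrite xF// inE eqxx.
Qed.

Lemma orb_refl c : c \in orb c.
Proof. by apply/orbP; exists 1%g; [exact: sub1H|exact: act1]. Qed.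

Lemma orb_act s c d : H s -> (act s d \in orb c) = (d \in orb c).
Proof.
move=> Hs; apply/idP/idP => /orbP[t Ht tE]; apply/orbP.
  by exists (s^-1 * t)%g; [exact: subMH (subVH Hs) Ht|rewrite actM tE actK].
by exists (s * t)%g; [exact: subMH|rewrite actM tE].
Qed.

Lemma orb_eq c d : d \in orb c -> orb d =i orb c.
Proof.
move=> /orbP[s Hs <-] z; apply/idP/idP => /orbP[t Ht <-]; apply/orbP.
  by exists (t * s)%g; [exact: subMH|].
by exists (t * s^-1)%g; [exact: subMH Ht (subVH Hs)|rewrite actM actK].
Qed.

Lemma orb_sym c d : (d \in orb c) = (c \in orb d).
Proof. by apply/idP/idP => /orb_eq ->; exact: orb_refl. Qed.

Definition olen c : nat := size (orb c).

Lemma olen_gt0 c : (0 < olen c)%N.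
Proof. by rewrite /olen; have := orb_refl c; case: (orb c). Qed.

Lemma olen_eq c d : d \in orb c -> olen d = olen c.
Proof.
by move=> dc; apply/perm_size/uniq_perm; [exact: orb_uniq..|exact: orb_eq].
Qed.

(** The relative position of [c = xH] and [d = yH], namely the coset of [x^-1 y]. It depends on the
    representative chosen for [c]; its orbit, which stands for the double coset of [x^-1 y], does
    not. *)
Definition cdiff c d : X := act (rep_iota c)^-1%g d.

Lemma cdiffE c d s : act s base = c -> cdiff c d \in orb (act s^-1%g d).
Proof.
move=> sc; apply/orbP; exists ((rep_iota c)^-1 * s)%g; last by rewrite actM actVK.
by apply/act_eqH; rewrite act_rep.
Qed.

Lemma orb_cdiff_act s c d : orb (cdiff (act s c) (act s d)) =i orb (cdiff c d).
Proof.
apply: orb_eq; have := @cdiffE (act s c) (act s d) (s * rep_iota c)%g.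
by rewrite actM act_rep => /(_ erefl); rewrite invgM actM actK.
Qed.

Definition cyl (F : seq X) s : set G := [set t | forall c, c \in F -> act t c = act s c].

Lemma sch_openP (A : set G) : open A <-> forall s, A s -> exists F, cyl F s `<=` A.
Proof.
split=> [[B oB <-] s Bs|AP].
  apply: contrapT => /forallNP H'.
  have : closure (~` B) (val s : coset_map P).
    apply/closure_ptwsP => F; have /existsNP[t /not_implyP[tF tB]] := H' F.
    by exists (val t).
  have /closure_id <- : closed (~` B) by apply: open_closedC.
  by apply.
rewrite openE => s /AP[F FA].
have : nbhs (val s : coset_map P) [set t : coset_map P | forall c, c \in F -> t c = val s c].
  elim: F {FA} => [|c F IH]; first exact: filterS filterT.
  have nc : nbhs (val s : coset_map P) [set t : coset_map P | t c = val s c].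
    exact: (@proj_continuous X
      (fun _ => discrete_topology X) c (val s) [set d | d = val s c]).
  apply: filterS (filterI nc IH) => t [/= tc tF] d.
  by rewrite inE => /orP[/eqP ->//|/tF].
move=> N; apply: filterS FA _.
have : continuous (val : G -> coset_map P) by exact: initial_continuous.
by move=> /(_ s _ N).
Qed.

End SchlichtingAction.

(** * Cosets as compact open sets *)

Section SchlichtingTopology.
Variable P : heckePair.
Local Notation X := (lcosets P).
Local Notation G := (schlichting P).
Local Notation H := (@sch_sub P).
Implicit Types (c d : X) (s t : G).

Definition coset c : set G := [set s | act s (base P) = c].

Lemma coset_open c : open (coset c).
Proof.
by apply/sch_openP => s sc; exists [:: base P] => t; rewrite /coset/= => -> //; rewrite inE.
Qed.

Lemma coset_closed c : closed (coset c).
Proof.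
rewrite -(setCK (coset c)); apply: open_closedC.
apply/sch_openP => s sc; exists [:: base P] => t tF; rewrite /coset/= => tc.
by apply: sc; rewrite /coset/= -tc tF// inE.
Qed.

(** An element sending [base] to [c] maps each [d] into a finite set, the image of [orb d] under
    [rep_iota c]. By Tychonoff's theorem the product of these sets is compact, and intersecting it
    with the closure of [range theta] keeps cluster points in [G]. *)
Lemma coset_compact c : compact (coset c).
Proof.
pose L d : set (discrete_topology X) := [set` [seq act (rep_iota c) d' | d' <- orb d]].
have cL : compact [set f : coset_map P | forall d, L d (f d)].
  have := @tychonoff X (fun=> discrete_topology X) L.
  by apply=> d; apply: finite_compact; exact: finite_seq.
have {}cL : compact ([set f : coset_map P | forall d, L d (f d)] `&`
    closure (range (@theta P))).
  by apply: compact_closedI; [exact: cL|exact: closed_closure].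
have sub (s : G) : coset c s -> forall d, L d (val s d).
  rewrite /coset /= => sc d; apply/mapP; exists (cdiff c (act s d)).
    by apply/orbP; exists ((rep_iota c)^-1 * s)%g => //; apply/act_eqH; rewrite act_rep.
  by rewrite /cdiff actVK.
move=> F FF Fc.
pose F' : set_system (coset_map P) := (val : G -> coset_map P) @ F.
have F'F : ProperFilter F' by exact: fmap_proper_filter.
have [|p [[pL pc] pF]] := cL F' F'F.
  by rewrite /F' /fmap /=; apply: filterS Fc => s /sub sL; split=> //=; exact: set_valP.
pose q : G := SigSub (mem_set pc).
exists q; split.
  have := pL (base P); rewrite /L /= => /mapP[d].
  move=> /orbP[h /sch_subE hb <-]; rewrite hb act_rep.
  by rewrite /coset /act /=.
move=> A B FA qB.
have [B1 [[B2 oB2 B2E] B1q B1B]] : exists B1 : set G, [/\ open B1, B1 q & B1 `<=` B].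
  move: qB; rewrite nbhsE => -[B1 [oB1 B1q] B1B]; by exists B1.
have : nbhs p B2.
  by apply: open_nbhs_nbhs; split=> //; move: B1q; rewrite -B2E.
have F'A : F' (val @` A) by rewrite /F' /fmap /=; apply: filterS FA => s As; exists s.
move=> /(pF _ _ F'A)[_ [[s As <-] B2s]].
by exists s; split=> //; apply: B1B; rewrite -B2E.
Qed.

(** Otherwise the parts of [K] outside finitely many cosets form the base of a proper filter. A
    cluster point has its own coset as an open neighbourhood, and that coset misses a member of the
    filter. *)
Lemma compact_cosets (K : set G) : compact K ->
  exists F : seq X, forall s, K s -> act s (base P) \in F.
Proof.
move=> cK; apply: contrapT => /forallNP nF.
pose B (F : seq X) := [set s | K s /\ act s (base P) \notin F].
have FF : ProperFilter (filter_from setT B).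
  apply: filter_from_proper; last first.
    move=> F _; have /existsNP[s /not_implyP[Ks /negP sF]] := nF F.
    by exists s.
  apply: filter_from_filter; first by exists [::].
  move=> F1 F2 _ _; exists (F1 ++ F2) => // s [Ks].
  by rewrite mem_cat negb_or => /andP[s1 s2]; split; split.
have [|p [Kp pF]] := cK _ FF; first by exists [::] => // s [].
have : filter_from setT B (B [:: act p (base P)]) by exists [:: act p (base P)].
have np : nbhs p (coset (act p (base P))).
  by apply: open_nbhs_nbhs; split=> //; exact: coset_open.
by move=> /pF/(_ np)[s [[_]]]; rewrite inE => /eqP.
Qed.

Lemma open_translate (A : set G) s : open A -> open [set t | A (s * t)%g].
Proof.
move=> /sch_openP oA; apply/sch_openP => t /oA[F FA]; exists F => u tu.
by apply: FA => c cF; rewrite !actM tu.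
Qed.

Lemma open_inv_translate (A : set G) s : open A -> open [set t | A (t^-1 * s)%g].
Proof.
move=> /sch_openP oA; apply/sch_openP => t /oA[F FA].
exists [seq act (t^-1 * s)%g c | c <- F] => u tu.
apply: FA => c cF; apply: (@act_inj _ u); rewrite actM actVK.
by rewrite tu ?map_f// actM actVK.
Qed.

End SchlichtingTopology.

(** * Measures of cosets and the modular function *)

Section HaarIntegrals.
Variables (R : realType) (P : heckePair).
Variables (mu : {measure set (borel P) -> \bar R}) (Delta : schlichting P -> R).
Hypotheses (hmu : left_haar mu) (hmuH : mu (@sch_sub P) = 1%E).
Hypothesis hDelta : modular_function mu Delta.
Local Notation X := (lcosets P).
Local Notation G := (schlichting P).
Local Notation H := (@sch_sub P).
Implicit Types (c d : X) (s t : G) (A : set G).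

Lemma open_measurable_borel A : open A -> measurable (A : set (borel P)).
Proof. by move=> oA; exact: sub_sigma_algebra. Qed.

Lemma mu_translate s A : measurable (A : set (borel P)) ->
  mu [set (s * t)%g | t in A] = mu A.
Proof. exact: haar_invariant. Qed.

Lemma sub_cosetE : H = coset (base P).
Proof. by apply/seteqP; split=> s /sch_subE. Qed.

Lemma measurable_sub : measurable (H : set (borel P)).
Proof. by rewrite sub_cosetE; exact: open_measurable_borel (coset_open _). Qed.

Lemma mu_coset c : mu (coset c) = 1%E.
Proof.
rewrite -hmuH -(mu_translate (rep_iota c) measurable_sub).
congr (mu _); apply/seteqP; split=> [s sc|_ [h /sch_subE hb <-]].
  exists ((rep_iota c)^-1 * s)%g; last by rewrite mulgA mulgV mul1g.
  by apply/act_eqH; rewrite act_rep.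
by rewrite /coset /= actM hb act_rep.
Qed.

Definition trans c d : set G := [set s | H s /\ act s c = d].

Lemma trans_open c d : open (trans c d).
Proof.
apply/sch_openP => s [/sch_subE Hs sc]; exists [:: base P; c] => t tF.
by split; [apply/sch_subE|]; rewrite tF// ?inE ?eqxx ?orbT.
Qed.

(** [H] is the disjoint union of the sets [trans c d] over the orbit of [c]. These are left
    translates of one another, so each takes an equal share of [mu H = 1]. *)
Lemma mu_trans c d :
  mu (trans c d) = (if d \in orb c then (olen c)%:R^-1 else 0)%:E.
Proof.
case: ifPn => [dc|]; last first.
  move=> /negP dc; rewrite (_ : trans c d = set0) ?measure0//.
  by apply/seteqP; split=> // s [Hs sc]; case: dc; apply/orbP; exists s.
have tE d' : d' \in orb c -> mu (trans c d') = mu (trans c c).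
  move=> /orbP[s Hs sc]; rewrite -(mu_translate s (open_measurable_borel (trans_open c c))).
  congr (mu _); apply/seteqP; split=> [t [Ht tc]|_ [t [Ht tc] <-]].
    exists (s^-1 * t)%g; last by rewrite mulgA mulgV mul1g.
    by split; [exact: subMH (subVH Hs) Ht|rewrite actM tc -sc actK].
  by split; [exact: subMH|rewrite actM tc].
have : mu H = (\sum_(d' <- orb c) mu (trans c d'))%E.
  rewrite (_ : H = \bigcup_(d' in [set` orb c]) trans c d'); last first.
    apply/seteqP; split=> [s Hs|s [d' _ []]//].
    by exists (act s c) => //=; apply/orbP; exists s.
  rewrite measure_fin_bigcup.
  - by rewrite -fsbig_seq//; exact: orb_uniq.
  - exact: finite_seq.
  - by move=> i j _ _ [s [[_ si] [_ sj]]]; rewrite -si -sj.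
  - by move=> d' _; exact: open_measurable_borel (trans_open _ _).
rewrite hmuH (eq_big_seq _ tE) (tE _ dc).
have : (mu (trans c c) <= mu H)%E.
  apply: le_measure; rewrite ?inE; [exact: open_measurable_borel (trans_open _ _)| |by move=> s []].
  exact: measurable_sub.
have : (0 <= mu (trans c c))%E by exact: measure_ge0.
rewrite hmuH; case: (mu (trans c c)) => [r _ _| |] //=.
rewrite sumEFin => -[] h; congr (_%:E).
move: h; rewrite big_const_seq count_predT iter_addr_0 -/(olen c) => h.
have n0 : (olen c)%:R != 0 :> R by rewrite pnatr_eq0 -lt0n olen_gt0.
by apply: (mulIf n0); rewrite mulVf// mulr_natr -h.
Qed.

Lemma mu_translater s A : measurable (A : set (borel P)) ->
  mu [set (t * s)%g | t in A] = ((Delta s)%:E * mu A)%E.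
Proof. exact: (hDelta s).2. Qed.

Lemma Delta_gt0 s : 0 < Delta s. Proof. exact: (hDelta s).1. Qed.

Lemma open_translater s : open [set (t * s)%g | t in H].
Proof.
rewrite (_ : [set _ | _ in _] = [set t | H (t * s^-1)%g]); last first.
  apply/seteqP; split=> [_ [t Ht <-]|t Ht]; first by rewrite /= mulgK.
  by exists (t * s^-1)%g => //; rewrite mulgVK.
apply/sch_openP => t /sch_subE Ht; exists [:: act s^-1%g (base P)] => u tu.
by apply/sch_subE; rewrite -[RHS]Ht !actM tu// inE.
Qed.

Lemma Delta_mu s : mu [set (t * s)%g | t in H] = (Delta s)%:E.
Proof. by rewrite mu_translater ?hmuH ?mule1//; exact: measurable_sub. Qed.

Lemma DeltaM s t : Delta (s * t)%g = Delta s * Delta t.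
Proof.
apply: EFin_inj; rewrite -Delta_mu EFinM muleC -(Delta_mu s) -mu_translater; last first.
  exact: open_measurable_borel (open_translater s).
congr (mu _); apply/seteqP; split=> [_ [u Hu <-]|_ [_ [u Hu <-] <-]].
  by exists (u * s)%g; [exists u|rewrite mulgA].
by exists u => //; rewrite mulgA.
Qed.

Lemma Delta1 : Delta 1%g = 1.
Proof.
by apply: (mulfI (lt0r_neq0 (Delta_gt0 1%g))); rewrite -DeltaM mulg1 mulr1.
Qed.

Lemma DeltaV s : Delta s^-1%g = (Delta s)^-1.
Proof.
apply: (mulIf (lt0r_neq0 (Delta_gt0 s))).
by rewrite -DeltaM mulVg Delta1 mulVf// gt_eqF// Delta_gt0.
Qed.

Lemma Delta_sub s : H s -> Delta s = 1.
Proof.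
move=> Hs; apply: EFin_inj; rewrite -Delta_mu -hmuH; congr (mu _).
apply/seteqP; split=> [_ [t Ht <-]|t Ht]; first exact: subMH.
by exists (t * s^-1)%g; [exact: subMH Ht (subVH Hs)|rewrite mulgVK].
Qed.

Lemma Delta_act s t : act s (base P) = act t (base P) -> Delta s = Delta t.
Proof.
move=> /act_eqH/Delta_sub; rewrite DeltaM DeltaV => h.
by rewrite -[LHS]mulr1 -h mulVKf// gt_eqF ?Delta_gt0.
Qed.

(* The two orbit lengths are the indices of [H] and [s H s^-1] over their
   intersection, which [s] conjugates into one another. *)
Lemma olen_Delta s :
  (olen (act s (base P)))%:R = Delta s * (olen (act s^-1%g (base P)))%:R.
Proof.
set c := act s _; set c' := act s^-1%g _.
have h := mu_trans c c; have h' := mu_trans c' c'; rewrite !orb_refl in h h'.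
have : mu [set (t * s)%g | t in [set (s^-1 * t)%g | t in trans c c]] =
    mu (trans c' c').
  congr (mu _); apply/seteqP; split=> [_ [_ [t [Ht tc] <-] <-]|t [Ht tc]].
    split; first by apply/sch_subE; rewrite !actM tc /c actK.
    rewrite !actM; congr (act _ _); rewrite /c' actVK.
    by have /sch_subE -> := Ht.
  exists (t * s^-1)%g; last by rewrite mulgVK.
  exists (s * (t * s^-1))%g; last by rewrite mulKg.
  split; first by apply/sch_subE; rewrite !actM tc /c' actVK.
  by rewrite /c !actM actK; congr (act _ _); have /sch_subE -> := Ht.
have ot : open [set (s^-1 * t)%g | t in trans c c].
  rewrite (_ : [set _ | _ in _] = [set t | trans c c (s * t)%g]).
    exact: open_translate (trans_open _ _).
  apply/seteqP; split=> [_ [t Ht <-]|t Ht]; first by rewrite /= mulVKg.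
  by exists (s * t)%g => //; rewrite mulKg.
rewrite mu_translater; last exact: open_measurable_borel.
rewrite mu_translate; last exact: open_measurable_borel (trans_open _ _).
rewrite h h' => -[] e.
have n0 d : (olen d)%:R != 0 :> R by rewrite pnatr_eq0 -lt0n olen_gt0.
have -> : Delta s = (olen c')%:R^-1 * (olen c)%:R by rewrite -e mulfVK.
by rewrite mulrAC mulVf// mul1r.
Qed.

End HaarIntegrals.

(** * Hecke algebra *)

Section HeckeAlgebra.
Variables (R : realType) (P : heckePair).
Variables (mu : {measure set (borel P) -> \bar R}) (Delta : schlichting P -> R).
Hypotheses (hmu : left_haar mu) (hmuH : mu (@sch_sub P) = 1%E).
Hypothesis hDelta : modular_function mu Delta.
Local Notation X := (lcosets P).
Local Notation G := (schlichting P).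
Local Notation H := (@sch_sub P).
Local Notation p := (@projH R P).
Local Notation e := (base P).
Implicit Types (c d : X) (x y z : G) (A : set G) (f g : G -> R[i]).

Lemma rint_sum I (s : seq I) (b : I -> R) (A : I -> set (borel P)) (m : I -> R) :
  (forall i, open (A i : set G)) -> (forall i, mu (A i) = (m i)%:E) ->
  Rintegral mu setT (fun x : borel P => \sum_(i <- s) b i * \1_(A i) x) =
    \sum_(i <- s) b i * m i.
Proof.
move=> oA mA.
have mA' i : measurable (A i) by exact: open_measurable_borel.
have iA i : mu.-integrable setT (fun x : borel P => (\1_(A i) x : R)%:E).
  apply/integrableP; split; first exact/measurable_EFinP/measurable_indic.
  rewrite (eq_integral (fun x : borel P => (\1_(A i) x)%:E)); last first.
    by move=> x _; rewrite gee0_abs// lee_fin.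
  by rewrite integral_indic// setIT mA ltry.
rewrite /Rintegral; under eq_integral do rewrite -sumEFin.
rewrite (integral_sum measurableT (f := fun i (x : borel P) => (b i * \1_(A i) x)%:E)); last first.
  move=> i; under eq_fun do rewrite EFinM; exact: integrableZl.
rewrite (eq_bigr (fun i => (b i * m i)%:E)); first by rewrite sumEFin.
move=> i _; under eq_integral do rewrite EFinM.
by rewrite (integralZl measurableT (iA i)) integral_indic// setIT EFinM mA.
Qed.

(** The evaluation tool for integrals: the integrands met below are cut into finitely many open
    pieces of known measure on which they are constant. *)
Lemma cint_sum I (s : seq I) (a : I -> R[i]) (A : I -> set G) (m : I -> R) (F : G -> R[i]) :
  (forall i, open (A i)) -> (forall i, mu (A i) = (m i)%:E) ->
  (forall x, F x = \sum_(i <- s) a i * (x \in A i)%:R) ->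
  cintegral mu F = \sum_(i <- s) a i * (m i)%:C%C.
Proof.
move=> oA mA FE; rewrite /cintegral.
have cR (z : R[i]) (b : bool) : z * b%:R = Complex (complex.Re z * b%:R) (complex.Im z * b%:R).
  by case: z b => u v [] /=; rewrite ?mulr1 ?mulr0.
have cS (t : seq I) (u v : I -> R) :
    \sum_(i <- t) Complex (u i) (v i) = Complex (\sum_(i <- t) u i) (\sum_(i <- t) v i).
  by elim: t => [|i t IH]; rewrite ?big_nil// !big_cons IH.
have -> : \sum_(i <- s) a i * (m i)%:C%C =
    Complex (\sum_(i <- s) complex.Re (a i) * m i) (\sum_(i <- s) complex.Im (a i) * m i).
  rewrite -cS; apply: eq_bigr => i _; case: (a i) => u v /=.
  by rewrite mulrC; congr Complex; rewrite /= ?mul0r ?subr0 ?addr0 mulrC.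
rewrite -(rint_sum s (fun i => complex.Re (a i)) oA mA).
rewrite -(rint_sum s (fun i => complex.Im (a i)) oA mA).
congr Complex; congr (Rintegral _ _ _); apply/funext => x; rewrite FE.
  by under eq_bigr do rewrite cR; rewrite cS /=; apply: eq_bigr => i _; rewrite indicE.
by under eq_bigr do rewrite cR; rewrite cS /=; apply: eq_bigr => i _; rewrite indicE.
Qed.

(** Lower semicontinuity, which can be verified on cylinders and suffices for measurability because
    upper rays generate the Borel sets of [R]. *)
Definition ray_open (F : G -> R) := forall r : R, open [set x | r < F x].

Lemma ray_open_measurable (F : G -> R) : ray_open F ->
  measurable_fun setT (F : borel P -> R).
Proof.
move=> oF; apply: (measurability _ (RGenOInfty.measurableE R)) => _ [_ [r ->] <-].
rewrite setTI (_ : _ @^-1` _ = [set x | r < F x]); first exact: open_measurable_borel.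
by apply/seteqP; split=> x /=; rewrite in_itv /= andbT.
Qed.

(** Translation pushes [mu] forward to itself. The change of variables is made for nonnegative
    functions, applied to positive and negative parts, so no integrability has to be established. *)
Lemma rint_translate (F : G -> R) z : ray_open F ->
  Rintegral mu setT (fun x => F (z * x)%g) = Rintegral mu setT F.
Proof.
move=> /ray_open_measurable mF; rewrite /Rintegral; congr fine.
pose phi (x : borel P) : borel P := (z * x)%g.
have mphi : measurable_fun setT phi.
  apply: (@measurability _ _ (borel P) (borel P) setT phi (@open G)) => // _ [U oU <-]; rewrite setTI.
  exact: open_measurable_borel (open_translate z oU).
have pE (A : set (borel P)) : measurable A -> pushforward mu phi A = mu A.
  move=> mA; rewrite /pushforward -(mu_translate hmu z); last first.
    by rewrite -[_ @^-1` _]setTI; exact: mphi.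
  congr (mu _); apply/seteqP; split=> [_ [x Ax <-]//|x Ax].
  by exists (z^-1 * x)%g; rewrite /phi /= mulVKg.
pose mphi' := isMeasurableFun.Build _ _ _ _ phi mphi.
pose Phi : {mfun borel P >-> borel P} := HB.pack phi mphi'.
have ge0 (h : borel P -> \bar R) : measurable_fun setT h -> (forall x, 0 <= h x)%E ->
    (\int[mu]_x h (phi x) = \int[mu]_x h x)%E.
  move=> mh h0.
  rewrite -[RHS](@eq_measure_integral _ _ _ setT mu (pushforward mu Phi)); last first.
    by move=> A mA _; exact: pE.
  rewrite (ge0_integral_pushforward (phi := phi))//.
have mFE : measurable_fun setT (EFin \o (F : borel P -> R)) by exact/measurable_EFinP.
rewrite integralE [RHS]integralE.
have hp := ge0 _ (measurable_funepos mFE) (funepos_ge0 _).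
have hn := ge0 _ (measurable_funeneg mFE) (funeneg_ge0 _).
congr (_ - _)%E.
- by rewrite -[RHS]hp; apply: eq_integral => x _; rewrite !funeposE.
- by rewrite -[RHS]hn; apply: eq_integral => x _; rewrite !funenegE.
Qed.

Lemma cint_translate (F : G -> R[i]) z :
  ray_open (fun x => complex.Re (F x)) -> ray_open (fun x => complex.Im (F x)) ->
  cintegral mu (fun x => F (z * x)%g) = cintegral mu F.
Proof.
by move=> oR oI; rewrite /cintegral (rint_translate z oR) (rint_translate z oI).
Qed.

Lemma cintegral0 (F : G -> R[i]) : (forall x, F x = 0) -> cintegral mu F = 0.
Proof.
move=> F0; rewrite (@cint_sum nat [::] (fun=> 0) (fun=> H) (fun=> 1)) ?big_nil//.
- by move=> _; rewrite sub_cosetE; exact: coset_open.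
- by move=> x; rewrite F0 big_nil.
Qed.

(** Right [H]-invariance, phrased through the base coset so that [f] is recovered from its values at
    the representatives [rep_iota c]. *)
Definition rinv f := forall x y, act x e = act y e -> f x = f y.
Definition linv f := forall h x, H h -> f (h * x)%g = f x.
Definition fsupp f (s : seq X) := uniq s /\ forall x, act x e \notin s -> f x = 0.
Definition binv f := [/\ rinv f, linv f & exists s, fsupp f s].

Lemma projHE x : p x = (act x e == e)%:R.
Proof.
rewrite /projH indicE; congr (nat_of_bool _)%:R.
by apply/idP/eqP => [/set_mem/sch_subE//|h]; apply/mem_set/sch_subE.
Qed.

Lemma locally_constant_open T (F : G -> T) (B : set T) :
  (forall x, exists r : seq X, forall y, (forall c, c \in r -> act y c = act x c) -> F y = F x) ->
  open [set x | B (F x)].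
Proof.
by move=> Fl; apply/sch_openP => x Bx; have [r rP] := Fl x; exists r => y /rP /= ->.
Qed.

Lemma rinv_continuous f : rinv f -> continuous (f : G -> R[i]^o).
Proof.
move=> fr; apply/continuousP => B oB; apply: locally_constant_open => x.
by exists [:: e] => y h; apply: fr; rewrite h// inE.
Qed.

Lemma fsupp_compact f s : fsupp f s -> compact (closure [set x | f x != 0]).
Proof.
move=> [_ fs]; pose K := \big[setU/set0]_(c <- s) @coset P c.
have KE x : K x <-> act x e \in s.
  rewrite /K -bigcup_seq; split=> [[c /= cs xc]|xs]; last by exists (act x e).
  by rewrite (xc : act x e = c).
apply: (@subclosed_compact _ _ K).
- exact: closed_closure.
- by apply: bigsetU_compact => c _; exact: coset_compact.
- have cK : closed K by apply: closed_bigsetU => c _; exact: coset_closed.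
  rewrite closureE; apply: smallest_sub => // x /= /eqP fx; apply/KE.
  by apply: contrapT => /negP/fs.
Qed.

Lemma Cc_fsupp f : Cc f -> exists s, fsupp f s.
Proof.
move=> [_ /compact_cosets[s sP]]; exists (undup s); split; first exact: undup_uniq.
move=> x; rewrite mem_undup => /negP xs; apply: contrapT => /eqP fx.
by apply: xs; apply: sP; exact: subset_closure.
Qed.

Lemma rinv_Cc f s : rinv f -> fsupp f s -> Cc f.
Proof. by move=> fr /fsupp_compact fc; split=> //; exact: rinv_continuous. Qed.

Lemma sum_coset (s : seq X) (a : X -> R[i]) x : uniq s -> act x e \in s ->
  \sum_(c <- s) a c * (x \in @coset P c)%:R = a (act x e).
Proof.
move=> us xs; rewrite (bigD1_seq (act x e))//= big1 ?addr0.
  by rewrite (mem_set (erefl _ : coset _ x)) mulr1.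
move=> c cx; rewrite memNset ?mulr0// => xc.
by move: cx; rewrite -xc eqxx.
Qed.

Lemma sum_coset0 (s : seq X) (a : X -> R[i]) x : act x e \notin s ->
  \sum_(c <- s) a c * (x \in @coset P c)%:R = 0.
Proof.
move=> xs; rewrite big_seq big1// => c cs; rewrite memNset ?mulr0// => xc.
by move: xs; rewrite xc cs.
Qed.

(** Left invariance of [g] and right invariance of [f] make the integrand a function of the coset of
    [y], and every coset has measure 1. *)
Lemma convE f g s x : rinv f -> fsupp f s -> linv g ->
  conv mu f g x = \sum_(c <- s) f (rep_iota c) * g ((rep_iota c)^-1 * x)%g.
Proof.
move=> fr [us fs] gl; rewrite /conv.
rewrite (@cint_sum X s (fun c => f (rep_iota c) * g ((rep_iota c)^-1 * x)%g)
  (@coset P) (fun=> 1)).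
- by apply: eq_bigr => c _; rewrite mulr1.
- exact: coset_open.
- exact: mu_coset.
move=> y; have [ys|ys] := boolP (act y e \in s); last first.
  by rewrite sum_coset0// fs// mul0r.
rewrite sum_coset//; congr (_ * _); first by apply: fr; rewrite act_rep.
have Hy : H ((rep_iota (act y e))^-1 * y)%g by apply/act_eqH; rewrite act_rep.
by rewrite -[in RHS](gl _ _ (subVH Hy)) invgM invgK -mulgA mulVKg.
Qed.

Lemma act_repV c : act (rep_iota c)^-1%g c = e.
Proof. by apply: (@act_inj _ (rep_iota c)); rewrite actVK act_rep. Qed.

Lemma linv_proj : linv p.
Proof.
move=> h x Hh; rewrite !projHE actM; congr (nat_of_bool _)%:R.
have /sch_subE hb := Hh.
by rewrite -{2}hb (inj_eq (@act_inj _ h)).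
Qed.

Lemma rinv_proj : rinv p.
Proof. by move=> x y xy; rewrite !projHE xy. Qed.

Lemma fsupp_proj : fsupp p [:: e].
Proof. by split=> // x; rewrite inE projHE => /negbTE->. Qed.

Lemma conv_projr f s : rinv f -> fsupp f s -> conv mu f p = f.
Proof.
move=> fr fs; apply/funext => x; rewrite (convE _ fr fs linv_proj).
have pE c : p ((rep_iota c)^-1 * x)%g = (x \in @coset P c)%:R.
  rewrite projHE; congr (nat_of_bool _)%:R.
  apply/eqP/idP => [h|/set_mem].
    apply/mem_set/(@act_inj _ (rep_iota c)^-1%g).
    by rewrite -actM h act_repV.
  by rewrite /coset /= actM => ->; exact: act_repV.
under eq_bigr do rewrite pE.
have [xs|xs] := boolP (act x e \in s).
  by rewrite (sum_coset (fun c => f (rep_iota c)))//; [apply: fr; rewrite act_rep|case: fs].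
by rewrite (sum_coset0 (fun c => f (rep_iota c)))//; case: fs => _ ->.
Qed.

Lemma conv_projl f : linv f -> conv mu p f = f.
Proof.
move=> fl; apply/funext => x; rewrite (convE _ rinv_proj fsupp_proj fl) big_seq1.
have He : H (rep_iota e) by apply/sch_subE; rewrite act_rep.
by rewrite projHE act_rep eqxx mul1r fl//; exact: subVH.
Qed.

Lemma conv_proj_rinv f : rinv (conv mu f p).
Proof.
move=> x y xy; rewrite /conv; congr cintegral; apply/funext => z.
by congr (_ * _); apply: rinv_proj; rewrite !actM xy.
Qed.

Lemma fsupp_sub f (s : seq X) : (forall x, f x != 0 -> act x e \in s) ->
  exists s, fsupp f s.
Proof.
move=> h; exists (undup s); split; first exact: undup_uniq.
move=> x; rewrite mem_undup => /negP xs; apply: contrapT => /eqP fx.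
by apply: xs; exact: h.
Qed.

Lemma conv_proj_fsupp f s : fsupp f s -> exists s, fsupp (conv mu f p) s.
Proof.
move=> [us fs]; apply: (@fsupp_sub _ s) => x; apply: contraTT => xs.
rewrite negbK; apply/eqP/cintegral0 => y; rewrite projHE.
have [yx|_] := eqVneq (act (y^-1 * x)%g e) e; last by rewrite mulr0.
rewrite fs ?mul0r//; suff -> : act y e = act x e by [].
by apply/act_eqH/sch_subE.
Qed.

Lemma proj_conv_fsupp f s : fsupp f s -> exists s, fsupp (conv mu p f) s.
Proof.
move=> [us fs]; apply: (@fsupp_sub _ (flatten [seq orb c | c <- s])) => x.
apply: contraTT => xs; rewrite negbK; apply/eqP/cintegral0 => y; rewrite projHE.
have [ye|_] := eqVneq (act y e) e; last by rewrite mul0r.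
rewrite fs ?mulr0//; apply: contra xs => yx.
apply/flattenP; exists (orb (act (y^-1 * x)%g e)); first exact: map_f.
by apply/orbP; exists y; [exact/sch_subE|rewrite actM actVK].
Qed.

(** Here [f] is only continuous, so the integral is no finite sum, and invariance has to come from
    the substitution [y |-> h^-1 y]. *)
Lemma proj_conv_linv f : Cc f -> linv (conv mu p f).
Proof.
move=> [fc _] h x Hh; rewrite /conv.
pose F (y : G) := p y * f (y^-1 * x)%g.
have FE y : F (h^-1 * y)%g = p y * f (y^-1 * (h * x))%g.
  by rewrite /F (linv_proj _ (subVH Hh)) invgM invgK mulgA.
rewrite -(funext FE).
(* With [q] the real or imaginary part: on the open set [H] the integrand is the continuous
   [f (y^-1 x)], and off [H] it vanishes on a neighbourhood, where [q 0 = 0] applies. *)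
have ro (q : R[i] -> R) : (forall (r : R) (U : set R[i]^o), open (q @^-1` [set t | r < t] : set R[i]^o)) ->
    q 0 = 0 -> ray_open (fun y => q (F y)).
  move=> qc q0 r.
  have oV : open [set z | r < q (f z)].
    by move/continuousP : fc => /(_ _ (qc r setT)).
  have /sch_openP oV' := open_inv_translate x oV.
  apply/sch_openP => z /= rz; have [ze|ze] := eqVneq (act z e) e.
    have [|r' r'V] := oV' z.
      by move: rz; rewrite /= /F projHE ze eqxx mul1r.
    exists (e :: r') => y yz /=; rewrite /F projHE yz ?inE ?eqxx// ze eqxx mul1r.
    by apply: r'V => c cr; apply: yz; rewrite inE cr orbT.
  exists [:: e] => y yz /=; move: rz.
  by rewrite /F !projHE yz ?inE// (negbTE ze) !mul0r q0.
apply: cint_translate; apply: ro => //.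
- move=> r _; rewrite openE => z /= rz; apply/nbhs_ballP; exists (complex.Re z - r)%:C%C => /=.
    by rewrite -[0]/(0%:C%C) ltcR subr_gt0.
  move=> w; rewrite -ball_normE /= normcE_cmod ltcR => zw.
  by have := Re_le_cmod (z - w); rewrite ReB; lra.
- move=> r _; rewrite openE => z /= rz; apply/nbhs_ballP; exists (complex.Im z - r)%:C%C => /=.
    by rewrite -[0]/(0%:C%C) ltcR subr_gt0.
  move=> w; rewrite -ball_normE /= normcE_cmod ltcR => zw.
  have := norm_Im_le_cmod (z - w); rewrite ler_norml.
  by case: (z) (w) rz zw => ? ? [? ?] /=; lra.
Qed.

Lemma conv_proj_linv f : linv f -> linv (conv mu f p).
Proof.
move=> fl h x Hh; rewrite /conv.
pose F (y : G) := f y * p (y^-1 * x)%g.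
have FE y : F (h^-1 * y)%g = f y * p (y^-1 * (h * x))%g.
  by rewrite /F (fl _ _ (subVH Hh)) invgM invgK mulgA.
rewrite -(funext FE).
have lc T (q : R[i] -> T) y : exists r : seq X, forall z,
    (forall c, c \in r -> act z c = act y c) -> q (F z) = q (F y).
  exists [:: act y^-1%g e; act (y^-1 * x)%g e] => z zy; congr q; rewrite /F.
  congr (_ * _).
    rewrite -[z](mulgVK y) fl//; apply/sch_subE.
    by rewrite actM zy ?inE ?eqxx// actVK.
  apply: rinv_proj; apply: (@act_inj _ z); rewrite actM actVK.
  by rewrite zy ?inE ?eqxx ?orbT// !actM actVK.
apply: cint_translate => r.
- exact: (locally_constant_open [set t | r < t] (lc _ (@complex.Re R))).
- exact: (locally_constant_open [set t | r < t] (lc _ (@complex.Im R))).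
Qed.

(** Convolution with [p] on either side fixes the functions described by [binv], which gives the
    converse inclusion. From here on membership in the Hecke algebra involves neither topology nor
    measure. *)
Theorem hecke_algebraP f : hecke_algebra mu f <-> binv f.
Proof.
split=> [[g gc <-]|[fr fl [s fs]]].
  have [s gs] := Cc_fsupp gc; have [t pt] := proj_conv_fsupp gs.
  split; [exact: conv_proj_rinv| |exact: conv_proj_fsupp pt].
  by apply: conv_proj_linv; exact: proj_conv_linv.
by exists f; [exact: rinv_Cc fs|rewrite conv_projl// (conv_projr fr fs)].
Qed.

Theorem CcpP f : Ccp mu f <-> rinv f /\ exists s, fsupp f s.
Proof.
split=> [[g gc <-]|[fr [s fs]]].
  have [s gs] := Cc_fsupp gc.
  by split; [exact: conv_proj_rinv|exact: conv_proj_fsupp gs].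
by exists f; [exact: rinv_Cc fs|exact: conv_projr fs].
Qed.

End HeckeAlgebra.

(** * Hecke elements as kernels on pairs of cosets *)

Section HeckeKernels.
Variables (R : realType) (P : heckePair).
Variables (mu : {measure set (borel P) -> \bar R}) (Delta : schlichting P -> R).
Hypotheses (hmu : left_haar mu) (hmuH : mu (@sch_sub P) = 1%E).
Hypothesis hDelta : modular_function mu Delta.
Local Notation X := (lcosets P).
Local Notation G := (schlichting P).
Local Notation H := (@sch_sub P).
Local Notation p := (@projH R P).
Local Notation e := (base P).
Implicit Types (c d : X) (x y z : G) (f g : G -> R[i]).

(** A bi-invariant [f] becomes a kernel on pairs of cosets that is invariant under the diagonal
    action of [G]. *)
Definition fk f c d : R[i] := f ((rep_iota c)^-1 * rep_iota d)%g.

Lemma binvE f x y : rinv f -> linv f -> f (x^-1 * y)%g = fk f (act x e) (act y e).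
Proof.
move=> fr fl; rewrite /fk; set u := rep_iota _; set v := rep_iota _.
have Hx : H (u^-1 * x)%g by apply/act_eqH; rewrite act_rep.
rewrite -(fl _ _ Hx) -mulgA mulVKg.
by apply: fr; rewrite !actM act_rep.
Qed.

Lemma fk_act f s c d : rinv f -> linv f -> fk f (act s c) (act s d) = fk f c d.
Proof.
move=> fr fl; rewrite -{1}(act_rep c) -{1}(act_rep d) -!actM -binvE//.
by rewrite invgM -mulgA mulKg.
Qed.

Lemma fk_base f x : rinv f -> linv f -> f x = fk f e (act x e).
Proof. by move=> fr fl; rewrite -{1}(act1 e) -binvE// invg1 mul1g. Qed.

Lemma fk_supp f s c d : rinv f -> linv f -> fsupp f s ->
  d \notin [seq act (rep_iota c) v | v <- s] -> fk f c d = 0.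
Proof.
move=> fr fl [us fs] ds; apply: fs; apply: contra ds => h.
apply/mapP; eexists; first exact: h.
by rewrite actM act_rep actVK.
Qed.

(** The values at the left cosets in the double coset add up to 1, so in a representation this
    element averages over an orbit. *)
Definition bk c d : G -> R[i] :=
  fun x => if act x e \in orb (cdiff c d) then (olen (cdiff c d))%:R^-1 else 0.

Lemma bk_rinv c d : rinv (bk c d).
Proof. by move=> x y xy; rewrite /bk xy. Qed.

Lemma bk_linv c d : linv (bk c d).
Proof. by move=> h x Hh; rewrite /bk actM orb_act. Qed.

Lemma bk_fsupp c d : fsupp (bk c d) (orb (cdiff c d)).
Proof. by split=> [|x /negbTE xs]; [exact: orb_uniq|rewrite /bk xs]. Qed.

Lemma bk_binv c d : binv (bk c d).
Proof.
split; [exact: bk_rinv|exact: bk_linv|exists (orb (cdiff c d)); exact: bk_fsupp].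
Qed.

Lemma bk_act s c d : bk (act s c) (act s d) = bk c d.
Proof.
apply/funext => x; rewrite /bk orb_cdiff_act.
have -> // : olen (cdiff (act s c) (act s d)) = olen (cdiff c d).
by apply: olen_eq; rewrite -(orb_cdiff_act s) orb_refl.
Qed.

Lemma cdiff_refl c : cdiff c c = e.
Proof. by rewrite /cdiff act_repV. Qed.

Lemma orb_base : orb e = [:: e].
Proof.
apply: perm_small_eq => //; apply: uniq_perm => [||c]; [exact: orb_uniq|by []|].
rewrite inE; apply/idP/eqP => [/orbP[s /sch_subE h <-]//|->].
exact: orb_refl.
Qed.

Lemma bk_refl c : bk c c = p.
Proof.
apply/funext => x; rewrite /bk cdiff_refl /olen orb_base /= invr1 inE projHE.
by case: (_ == _).
Qed.

Lemma sum_uniq_sub (V : nmodType) (r s : seq X) (F : X -> V) : uniq r -> uniq s ->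
  (forall c, c \in r -> c \notin s -> F c = 0) ->
  \sum_(c <- r) F c = \sum_(c <- s | c \in r) F c.
Proof.
move=> ur us F0; rewrite [LHS](bigID (mem s))/= [X in _ + X]big1_seq ?addr0; last first.
  by move=> c /andP[cs cr]; exact: F0.
rewrite -big_filter -[RHS]big_filter; apply/perm_big/uniq_perm; rewrite ?filter_uniq//.
by move=> c; rewrite !mem_filter andbC.
Qed.

(** The kernel of [g] is summed over the product of the orbits of [w] and [z]. By invariance its row
    sums and its column sums are constant, so double counting exchanges the average over the orbit
    of [w], which is the convolution, for an average over the orbit of [z], which is the right-hand
    side. *)
Lemma conv_bk g s c c' x : rinv g -> linv g -> fsupp g s ->
  conv mu (bk c c') g x =
  \sum_(d <- [seq act (rep_iota c') v | v <- s]) fk g c' d * bk c d x.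
Proof.
move=> gr gl gs; set w := cdiff c c'; set z := act x e.
rewrite (convE hmu hmuH x (@bk_rinv c c') (bk_fsupp c c') gl) -/w.
pose k u v := fk g u v.
have orb_shift h u : H h -> perm_eq [seq act h v | v <- orb u] (orb u).
  move=> Hh; apply: uniq_perm; rewrite ?orb_uniq ?map_inj_uniq ?orb_uniq//; first exact: act_inj.
  move=> v; apply/mapP/idP => [[v' v'u ->]|vu]; first by rewrite orb_act.
  by exists (act h^-1%g v); rewrite ?orb_act ?actVK//; exact: subVH.
have K1 v : v \in orb z -> \sum_(u <- orb w) k u v = \sum_(u <- orb w) k u z.
  move=> /orbP[h Hh <-]; rewrite -(perm_big _ (orb_shift h w Hh)) big_map.
  by apply: eq_bigr => u _; rewrite /k fk_act.
have K2 u : u \in orb w -> \sum_(v <- orb z) k u v = \sum_(v <- orb z) k w v.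
  move=> /orbP[h Hh <-]; rewrite -(perm_big _ (orb_shift h z Hh)) big_map.
  by apply: eq_bigr => v _; rewrite /k fk_act.
have dbl : (olen z)%:R * \sum_(u <- orb w) k u z =
    (olen w)%:R * \sum_(v <- orb z) k w v :> R[i].
  have : \sum_(v <- orb z) \sum_(u <- orb w) k u v =
      \sum_(u <- orb w) \sum_(v <- orb z) k u v by rewrite exchange_big.
  rewrite (eq_big_seq _ K1) (eq_big_seq _ K2) !big_const_seq !count_predT !iter_addr_0.
  by rewrite -/(olen _) -/(olen _) !mulr_natl.
have n0 u : (olen u)%:R != 0 :> R[i] by rewrite pnatr_eq0 -lt0n olen_gt0.
transitivity ((olen w)%:R^-1 * \sum_(u <- orb w) k u z).
  rewrite mulr_sumr; apply: eq_big_seq => u uw.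
  by rewrite /bk act_rep -/w uw (binvE _ _ gr gl) act_rep.
transitivity ((olen z)%:R^-1 * \sum_(v <- orb z) k w v).
  have -> : \sum_(u <- orb w) k u z = (olen z)%:R^-1 * ((olen w)%:R * \sum_(v <- orb z) k w v).
    by rewrite -dbl mulKf.
  by rewrite mulrCA mulKf.
rewrite (@sum_uniq_sub _ (orb z) [seq cdiff c d | d <- [seq act (rep_iota c') v | v <- s]]).
- rewrite big_map big_mkcond mulr_sumr; apply: eq_bigr => d _.
  rewrite -/z /k /bk -/z orb_sym; have [zd|_] := boolP (z \in orb _); last by rewrite !mulr0.
  by rewrite (olen_eq zd) mulrC /w /cdiff fk_act.
- exact: orb_uniq.
- by rewrite !map_inj_uniq; [case: gs|exact: act_inj..].
move=> v vz vs; rewrite /k -(@fk_act _ (rep_iota c)) // /w /cdiff actVK.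
apply: (fk_supp gr gl gs); apply: contra vs => h; apply/mapP; eexists; first exact: h.
by rewrite /cdiff actK.
Qed.

(** [bk e e] is the left unit [p], so this is [conv_bk] at the base coset. It reduces statements
    linear in [f] to the elements [bk e c]. *)
Lemma binv_expand f s x : rinv f -> linv f -> fsupp f s ->
  f x = \sum_(c <- s) f (rep_iota c) * bk e c x.
Proof.
move=> fr fl fs; rewrite -{1}(conv_projl hmu hmuH fl) -(bk_refl e) (conv_bk _ _ _ fr fl fs).
rewrite big_map; apply: eq_bigr => c _.
have -> : fk f e (act (rep_iota e) c) = f (rep_iota c).
  rewrite -{1}(act_rep e) fk_act// (fk_base _ fr fl) act_rep//.
by congr (_ * _); rewrite -{1}(act_rep e) bk_act.
Qed.

Lemma orb_inv x t :
  (act x^-1%g e \in orb (act t e)) = (act x e \in orb (act t^-1%g e)).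
Proof.
have H' y u : act y^-1%g e \in orb (act u e) -> act y e \in orb (act u^-1%g e).
  move=> /orbP[h Hh]; rewrite -actM => /act_eqH Hk.
  apply/orbP; exists ((h * u)^-1 * y^-1)^-1%g; last first.
    rewrite invgM !invgK !actM; congr (act y _); rewrite actVK.
    by have /sch_subE := Hh.
  exact: subVH.
apply/idP/idP => [/H'//|h].
by have := @H' x^-1%g t^-1%g; rewrite !invgK; apply.
Qed.

(** Inversion exchanges the double cosets of [t] and [t^-1]. Their numbers of left cosets have ratio
    [Delta t] by [olen_Delta], and this cancels the modular factor in [star]. *)
Lemma star_bk c d : star Delta (bk c d) = bk d c.
Proof.
apply/funext => x; rewrite /star /bk.
set t := ((rep_iota c)^-1 * rep_iota d)%g.
have wE : cdiff c d = act t e by rewrite /cdiff actM act_rep.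
have wE' : cdiff d c = act t^-1%g e by rewrite invgM invgK actM act_rep.
rewrite wE wE' orb_inv; case: ifPn => [xt|_]; last by rewrite rmorph0 mul0r.
have /orbP[h Hh] : act x^-1%g e \in orb (act t e) by rewrite orb_inv.
rewrite -actM => /(Delta_act hmuH hDelta) <-.
rewrite (DeltaM hmuH hDelta) (Delta_sub hmuH hDelta Hh) mul1r.
have D0 : Delta t != 0 by rewrite gt_eqF// (Delta_gt0 hDelta).
have := olen_Delta hmu hmuH hDelta t.
set L := olen _; set L' := olen _ => LE.
have -> : (L%:R^-1 : R[i])^* = ((L%:R : R)^-1)%:C%C.
  by rewrite conj_Creal ?realV ?realn// real_complexV rmorph_nat.
rewrite -real_complexM LE invfM mulrAC mulVf// mul1r real_complexV.
by rewrite rmorph_nat.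
Qed.

(** [star Delta f] need not be right invariant, so the group is cut into the sets [A (c, d)] on
    which both factors of the integrand are constant. Right translation by a representative of [c]
    carries such a set to a [trans], and the resulting power of [Delta] cancels the one in
    [star]. *)
Lemma innerR_bk f s x : rinv f -> fsupp f s ->
  innerR mu Delta f f x =
  \sum_(c <- s) \sum_(d <- s) (f (rep_iota c))^* * f (rep_iota d) * bk c d x.
Proof.
move=> fr [us fs].
pose A (cd : X * X) : set G :=
  [set y | act y^-1%g e = cd.1 /\ act (y^-1 * x)%g e = cd.2].
pose m (cd : X * X) : R := (Delta (rep_iota cd.1))^-1 *
  (if act x e \in orb (cdiff cd.1 cd.2) then (olen (cdiff cd.1 cd.2))%:R^-1 else 0).
have Aopen cd : open (A cd).
  apply/sch_openP => y [y1 y2]; exists [:: cd.1; cd.2] => z zy.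
  split; apply: (@act_inj _ z); rewrite ?actM actVK zy ?inE ?eqxx ?orbT//.
    by rewrite -y1 actVK.
  by rewrite -y2 -actM mulVKg.
have mA cd : mu (A cd) = (m cd)%:E.
  case: cd => c d; rewrite /m /= -(DeltaV hmuH hDelta) EFinM.
  have -> : (if act x e \in orb (cdiff c d) then (olen (cdiff c d))%:R^-1 else 0)%:E
      = mu (trans (cdiff c d) (act x e)) by rewrite mu_trans.
  rewrite -(mu_translater hDelta); last exact: open_measurable_borel (trans_open _ _).
  congr (mu _); apply/seteqP; split=> [y [/= y1 y2]|_ [h [/sch_subE Hh hx] <-]].
    exists (y * rep_iota c)%g; last by rewrite mulgK.
    split; first by apply/sch_subE; rewrite actM act_rep -y1 actVK.
    by rewrite /cdiff actM actVK -y2 -actM mulVKg.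
  rewrite /A /= invgM invgK; split; first by rewrite actM -{1}Hh actK act_rep.
  by rewrite -mulgA !actM -hx actK /cdiff actVK.
rewrite /innerR /conv (@cint_sum _ _ _ _ [seq (c, d) | c <- s, d <- s]
  (fun cd => (f (rep_iota cd.1))^* * f (rep_iota cd.2) * (Delta (rep_iota cd.1))%:C%C) A m)//.
  rewrite big_allpairs_dep /=; apply: eq_bigr => c _; apply: eq_bigr => d _.
  rewrite -[_ * (m _)%:C%C]mulrA -real_complexM /m /= mulVKf ?gt_eqF ?(Delta_gt0 hDelta)//.
  by rewrite /bk; case: ifP => // _; rewrite real_complexV rmorph_nat.
move=> y; rewrite /star big_allpairs_dep /=.
have f0 z : f z = \sum_(c <- s) f (rep_iota c) * (z \in coset c)%:R.
  have [zs|zs] := boolP (act z e \in s).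
    by rewrite (sum_coset (fun c => f (rep_iota c)))//; apply: fr; rewrite act_rep.
  by rewrite (sum_coset0 (fun c => f (rep_iota c)))// fs.
rewrite {1}f0 (f0 (y^-1 * x)%g) rmorph_sum /= mulr_suml mulr_suml.
apply: eq_bigr => c _; rewrite mulr_sumr; apply: eq_bigr => d _.
rewrite rmorphM /= conjC_nat.
have -> : (y \in A (c, d))%:R =
    (y^-1%g \in coset c)%:R * ((y^-1 * x)%g \in coset d)%:R :> R[i].
  rewrite -natrM mulnb; congr (nat_of_bool _)%:R.
  apply/idP/andP => [/set_mem[/= h1 h2]|[/set_mem h1 /set_mem h2]].
    by split; apply/mem_set.
  by apply/mem_set.
have [yc|_] := boolP (y^-1%g \in coset c); last by rewrite !(mulr0, mul0r).
rewrite (Delta_act hmuH hDelta (s := y^-1%g) (t := rep_iota c)); last first.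
  by rewrite act_rep; move/set_mem: yc.
by ring.
Qed.

End HeckeKernels.

(** * Fixed vectors of unitary representations *)

Section FixedVectors.
Variables (R : realType) (P : heckePair) (pi : unitary_rep R P).
Variables (mu : {measure set (borel P) -> \bar R}) (Delta : schlichting P -> R).
Hypotheses (hmu : left_haar mu) (hmuH : mu (@sch_sub P) = 1%E).
Hypothesis hDelta : modular_function mu Delta.
Local Notation V := (ur_space pi).
Local Notation act_ := (@ur_act R P pi).
Local Notation F := (@fixed_vectors R P pi).
Local Notation X := (lcosets P).
Local Notation G := (schlichting P).
Local Notation H := (@sch_sub P).
Local Notation H0 := (@hp_sub P).
Local Notation e := (base P).
Implicit Types (c d : X) (u v w : V) (f g : G -> R[i]).

Lemma urZ x a v : act_ x (a *: v) = a *: act_ x v.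
Proof.
have ur0 : act_ x 0 = 0 by have := @ur_linear R P pi x (-1) 0 0; rewrite !scaleN1r !addNr.
by rewrite -[a *: v]addr0 ur_linear ur0 addr0.
Qed.

Lemma urD x u v : act_ x (u + v) = act_ x u + act_ x v.
Proof. by rewrite -[u]scale1r ur_linear !scale1r. Qed.

Lemma ur0 x : act_ x 0 = 0.
Proof. by have := urZ x 0 0; rewrite !scale0r. Qed.

Lemma ur_sum x I (s : seq I) (g : I -> V) :
  act_ x (\sum_(i <- s) g i) = \sum_(i <- s) act_ x (g i).
Proof. by elim: s => [|i s IH]; rewrite ?big_nil ?ur0// !big_cons urD IH. Qed.

Lemma ur_hn x v : hn (act_ x v) = hn v.
Proof. by rewrite /hn /sn /sqn ur_unitary. Qed.

Lemma urK x v : act_ x^-1%g (act_ x v) = v.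
Proof. by rewrite -ur_actM mulVg ur_act1. Qed.

(** The representative is immaterial when [v] is fixed, by [cv_pi]; defining the translate for every
    [v] keeps linearity free of side conditions. *)
Definition cv c v : V := act_ (repr c) v.

Lemma cv_pi x v : F v -> cv (\pi_X x) v = act_ x v.
Proof.
move=> Fv; have Hx : H0 ((repr (\pi_X x : X))^-1 * x)%g by apply/lcoset_eqP; rewrite reprK.
by rewrite /cv -{2}(mulVKg (repr (\pi_X x : X)) x) ur_actM (Fv _ Hx).
Qed.

Lemma act_cv x c v : F v -> act_ x (cv c v) = cv (theta x c) v.
Proof. by move=> Fv; rewrite {1}/cv -ur_actM -cv_pi. Qed.

Lemma cv_base v : F v -> cv e v = v.
Proof. by move=> Fv; rewrite cv_pi// ur_act1. Qed.

Lemma cvP a c u v : cv c (a *: u + v) = a *: cv c u + cv c v.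
Proof. exact: ur_linear. Qed.

Lemma fixed0 : F 0. Proof. by move=> h _; exact: ur0. Qed.

Lemma fixedP a u v : F u -> F v -> F (a *: u + v).
Proof. by move=> Fu Fv h Hh; rewrite ur_linear (Fu _ Hh) (Fv _ Hh). Qed.

Lemma fixed_closed : closure F `<=` F.
Proof.
move=> v /hclosureP Fv h Hh; apply/eqP; rewrite -subr_eq0; apply/eqP/hn_eq0.
apply/eqP; rewrite eq_le hn_ge0 andbT; apply/ler_addgt0Pl => r r0; rewrite addr0.
have [u Fu uv] := Fv _ (divr_gt0 r0 (ltr0n _ 2)).
have := hn_triangle u (act_ h v) v.
have -> : act_ h v - u = act_ h (v - u).
  by rewrite urD -[- u in RHS]scaleN1r urZ scaleN1r (Fu h Hh).
by rewrite ur_hn (hnB u v); lra.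
Qed.

Definition hsum f v : V := \sum_(c \in [set: X]) f (rep_iota c) *: cv c v.

Lemma fsupp_rep f s c : fsupp f s -> c \notin s -> f (rep_iota c) = 0.
Proof. by move=> [_ fs] cs; apply: fs; rewrite act_rep. Qed.

Lemma hsumE f s v : fsupp f s -> hsum f v = \sum_(c <- s) f (rep_iota c) *: cv c v.
Proof.
move=> fs; rewrite /hsum (fsbigE s)//.
- by apply: eq_bigl => c; rewrite in_setT.
- by case: fs.
- by move=> c _ cs; rewrite (fsupp_rep fs cs) scale0r.
Qed.

Lemma fsupp_act f s (h : G) : linv f -> H h -> fsupp f s -> fsupp f [seq act h c | c <- s].
Proof.
move=> fl Hh [us fs]; split; first by rewrite map_inj_uniq//; exact: act_inj.
move=> x xs; rewrite -(fl _ _ (subVH Hh)); apply: fs; apply: contra xs => h1.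
by apply/mapP; eexists; first exact: h1; rewrite actM actVK.
Qed.

Lemma hsum_fixed f v : binv f -> F v -> F (hsum f v).
Proof.
move=> [fr fl [s fs]] Fv h Hh.
have Hh' : H (iota h) by apply/iotaH.
(* The same [hsum] is written over the support [s] and over its image under [h]; left invariance of
   [f] matches the two term by term. *)
rewrite (hsumE v fs) ur_sum -(hsumE v fs) (hsumE v (fsupp_act fl Hh' fs)) big_map.
apply: eq_bigr => c _; rewrite urZ act_cv//; congr (_ *: _).
rewrite -(fl _ (rep_iota c) Hh'); apply: fr.
by rewrite actM !act_rep.
Qed.

Lemma hsum_linear f a u v : binv f -> hsum f (a *: u + v) = a *: hsum f u + hsum f v.
Proof.
move=> [fr fl [s fs]]; rewrite !(hsumE _ fs) scaler_sumr -big_split; apply: eq_bigr => c _ /=.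
by rewrite cvP scalerDr !scalerA mulrC.
Qed.

Lemma hsum_bounded f : binv f -> exists2 C, 0 <= C & forall v, hn (hsum f v) <= C * hn v.
Proof.
move=> [fr fl [s fs]]; exists (\sum_(c <- s) cmod (f (rep_iota c))).
  by apply: sumr_ge0 => c _; exact: cmod_ge0.
move=> v; rewrite (hsumE _ fs) mulr_suml; elim: (s) => [|c t IH].
  by rewrite !big_nil hn0.
rewrite !big_cons; apply: le_trans (hnD _ _) _; rewrite lerD// hnZ.
by rewrite /cv ur_hn.
Qed.

Lemma fsupp_common f g : binv f -> binv g -> exists s, fsupp f s /\ fsupp g s.
Proof.
move=> [_ _ [s [us fs]]] [_ _ [t [ut gt]]]; exists (undup (s ++ t)).
by split; split; rewrite ?undup_uniq// => x; rewrite mem_undup mem_cat negb_or => /andP[? ?];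
  [exact: fs|exact: gt].
Qed.

Lemma binv_comb a f g : binv f -> binv g -> binv (fun x => a * f x + g x).
Proof.
move=> bf bg; have [s [[us fs] [_ gs]]] := fsupp_common bf bg.
move: bf bg => [fr fl _] [gr gl _]; split.
- by move=> x y xy; rewrite (fr _ _ xy) (gr _ _ xy).
- by move=> h x Hh; rewrite fl// gl.
- by exists s; split=> // x xs; rewrite fs// gs// mulr0 addr0.
Qed.

Lemma hsum_comb a f g v : binv f -> binv g ->
  hsum (fun x => a * f x + g x) v = a *: hsum f v + hsum g v.
Proof.
move=> bf bg; have [s [fs gs]] := fsupp_common bf bg.
have fgs : fsupp (fun x => a * f x + g x) s.
  by case: fs gs => us fs [_ gs]; split=> // x xs; rewrite fs// gs// mulr0 addr0.
rewrite (hsumE _ fs) (hsumE _ gs) (hsumE _ fgs) scaler_sumr -big_split.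
by apply: eq_bigr => c _ /=; rewrite scalerDl scalerA.
Qed.

(** By [E] the translate of [hsum g v] to [c] has coefficients [fk g c d], and [convE] sums these
    against [f]. The finite set [r] contains every [d] that occurs, so the sums can be exchanged. *)
Lemma hsum_conv f g v : binv f -> binv g -> F v ->
  hsum (conv mu f g) v = hsum f (hsum g v).
Proof.
move=> [fr fl [s fs]] [gr gl [t gt]] Fv.
have E c : cv c (hsum g v) = \sum_(d \in [set: X]) fk g c d *: cv d v.
  rewrite (hsumE _ gt) /cv ur_sum (fsbigE [seq act (rep_iota c) d | d <- t])//.
  - rewrite big_map; apply: eq_big => d; first by rewrite in_setT.
    move=> _; rewrite urZ act_cv//; congr (_ *: _).
    by rewrite (fk_base _ gr gl) act_rep -{1}(act_rep c) fk_act.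
  - by rewrite map_inj_uniq; [case: gt|exact: act_inj].
  - by move=> d _ dt; rewrite (fk_supp gr gl gt dt) scale0r.
pose r := undup (flatten [seq [seq act (rep_iota c) d | d <- t] | c <- s]).
have rP c d : c \in s -> d \notin r -> fk g c d = 0.
  move=> cs dr; apply: (fk_supp gr gl gt); apply: contra dr => dt.
  by rewrite mem_undup; apply/flattenP; eexists; first by apply: map_f; exact: cs.
rewrite [RHS](hsumE _ fs) /hsum (fsbigE r) ?undup_uniq//; last first.
  move=> d _ dr; rewrite (convE hmu hmuH _ fr fs gl) big1_seq ?scale0r// => c /= cs.
  by rewrite -/(fk g c d) (rP _ _ cs dr) mulr0.
transitivity (\sum_(d <- r) \sum_(c <- s) (f (rep_iota c) * fk g c d) *: cv d v).
  apply: eq_big => d; first by rewrite in_setT.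
  by move=> _; rewrite (convE hmu hmuH _ fr fs gl) scaler_suml.
rewrite exchange_big; apply: eq_big_seq => c cs /=.
rewrite E (fsbigE r) ?undup_uniq//; last by move=> d _ dr; rewrite (rP _ _ cs dr) scale0r.
rewrite scaler_sumr; apply: eq_big => d; first by rewrite in_setT.
by move=> _; rewrite scalerA.
Qed.

Lemma hsum_proj v : F v -> hsum (@projH R P) v = v.
Proof.
move=> Fv; rewrite (hsumE _ (@fsupp_proj R P)) big_seq1 projHE act_rep eqxx scale1r.
exact: cv_base.
Qed.

Lemma ip_cv_rep c d u v : F u -> F v ->
  hs_inner V (cv c u) (cv d v) = hs_inner V (cv (cdiff d c) u) v.
Proof.
move=> Fu Fv; rewrite -(ur_unitary (repr d)^-1%g) /cv urK -/(cv c u) act_cv//.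
by rewrite /cdiff /rep_iota -iotaV.
Qed.

Lemma ip_cv_orb c d u v : F u -> F v -> d \in orb c ->
  hs_inner V (cv d u) v = hs_inner V (cv c u) v.
Proof.
move=> Fu Fv /orbP0[h Hh <-]; rewrite -act_cv//.
by rewrite -{1}(Fv h Hh) ur_unitary.
Qed.

Lemma ip_hsum_bk c d u v : F u -> F v ->
  hs_inner V (hsum (bk R d c) u) v = hs_inner V (cv c u) (cv d v).
Proof.
move=> Fu Fv; rewrite (hsumE _ (bk_fsupp R d c)) ip_suml ip_cv_rep//.
transitivity (\sum_(z <- orb (cdiff d c)) (olen (cdiff d c))%:R^-1 * hs_inner V (cv (cdiff d c) u) v).
  apply: eq_big_seq => z zo; rewrite ipZl (ip_cv_orb Fu Fv zo).
  by rewrite /bk act_rep zo.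
rewrite big_const_seq count_predT iter_addr_0 -/(olen _) -[LHS]mulr_natl mulVKf//.
by rewrite pnatr_eq0 -lt0n olen_gt0.
Qed.

Lemma binv_lincomb (I : Type) (t : seq I) (a : I -> R[i]) (b : I -> G -> R[i]) :
  (forall i, binv (b i)) -> binv (fun x => \sum_(i <- t) a i * b i x).
Proof.
move=> bb; elim: t => [|i t IH].
  have -> : (fun x : G => \sum_(i <- [::]) a i * b i x) = fun=> 0.
    by apply/funext => x; rewrite big_nil.
  by split=> //; exists [::].
have -> : (fun x : G => \sum_(j <- i :: t) a j * b j x) =
    fun x => a i * b i x + \sum_(j <- t) a j * b j x.
  by apply/funext => x; rewrite big_cons.
exact: binv_comb.
Qed.

Lemma hsum_lincomb (I : Type) (t : seq I) (a : I -> R[i]) (b : I -> G -> R[i]) v :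
  (forall i, binv (b i)) ->
  hsum (fun x => \sum_(i <- t) a i * b i x) v = \sum_(i <- t) a i *: hsum (b i) v.
Proof.
move=> bb; elim: t => [|i t IH].
  have z0 : fsupp (fun x : G => \sum_(i <- [::]) a i * b i x) ([::] : seq X).
    by split=> // x _; rewrite big_nil.
  by rewrite (hsumE _ z0) !big_nil.
have -> : (fun x : G => \sum_(j <- i :: t) a j * b j x) =
    fun x => a i * b i x + \sum_(j <- t) a j * b j x.
  by apply/funext => x; rewrite big_cons.
by rewrite big_cons -IH hsum_comb//; exact: binv_lincomb.
Qed.

Lemma hsum_expand f s v : binv f -> fsupp f s ->
  hsum f v = \sum_(c <- s) f (rep_iota c) *: hsum (bk R e c) v.
Proof.
move=> [fr fl _] fs.
rewrite -(hsum_lincomb s (fun c => f (rep_iota c)) v (bk_binv R e)).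
by congr hsum; apply/funext => x; exact: (binv_expand hmu hmuH).
Qed.

Lemma star_expand f s : rinv f -> linv f -> fsupp f s ->
  star Delta f = fun x => \sum_(c <- s) (f (rep_iota c))^* * bk R c e x.
Proof.
move=> fr fl fs; apply/funext => x.
rewrite /star (binv_expand hmu hmuH x^-1%g fr fl fs).
rewrite rmorph_sum /= mulr_suml; apply: eq_bigr => c _.
by rewrite rmorphM /= -mulrA -(star_bk hmu hmuH hDelta e c).
Qed.

(** By linearity only the elements [bk e c] matter; for them [ip_hsum_bk] turns both sides into the
    inner product of [cv e u] with [cv c v]. *)
Lemma hsum_star f u v : binv f -> F u -> F v ->
  hs_inner V (hsum (star Delta f) u) v = hs_inner V u (hsum f v).
Proof.
move=> bf Fu Fv; have [fr fl [s fs]] := bf.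
rewrite (star_expand fr fl fs).
rewrite (hsum_lincomb s (fun c => (f (rep_iota c))^*) u (fun c => bk_binv R c e)).
rewrite (hsum_expand _ bf fs) ip_suml ip_sumr.
apply: eq_bigr => c _; rewrite ipZl ipZr; congr (_ * _).
by rewrite ip_hsum_bk// (ip_herm (hsum _ _)) ip_hsum_bk// -ip_herm.
Qed.

End FixedVectors.

(** * Fixed vectors as a representation of the Hecke algebra *)

Section FixedSpace.
Variables (R : realType) (P : heckePair) (pi : unitary_rep R P).
Local Notation V := (ur_space pi).
Local Notation F := (@fixed_vectors R P pi).

Lemma fixed_space_ex : exists (K : hilbertSpace R) (i : K -> V), [/\ linear i,
  forall u v, hs_inner V (i u) (i v) = hs_inner K u v & range i = F].
Proof.
apply: closed_subspace_hilbert; [exact: fixed0|exact: fixedP|exact: fixed_closed].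
Qed.

Definition fixed_space : hilbertSpace R := sval (cid fixed_space_ex).
Definition fixed_incl : fixed_space -> V := sval (cid (svalP (cid fixed_space_ex))).
Local Notation i := fixed_incl.

Lemma fixed_inclP : [/\ linear i,
  forall u v, hs_inner V (i u) (i v) = hs_inner fixed_space u v & range i = F].
Proof. exact: svalP (cid (svalP (cid fixed_space_ex))). Qed.

Lemma fixed_incl_linear : linear i. Proof. by case: fixed_inclP. Qed.

Lemma fixed_incl_ip u v : hs_inner V (i u) (i v) = hs_inner fixed_space u v.
Proof. by case: fixed_inclP. Qed.

Lemma fixed_incl_fixed u : F (i u).
Proof. by case: fixed_inclP => _ _ <-; exists u. Qed.

Lemma fixed_incl_surj v : F v -> exists u, i u = v.
Proof. by case: fixed_inclP => _ _ <- [u _ <-]; exists u. Qed.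

Lemma fixed_incl_hn u : hn (i u) = hn u.
Proof. by rewrite /hn /sn /sqn fixed_incl_ip. Qed.

Lemma fixed_incl_inj : injective i.
Proof.
move=> u v uv; apply: ip_inj => w.
by rewrite -!fixed_incl_ip uv.
Qed.

(** A total function of [f] is required, while [hsum f] is known to preserve fixed vectors for
    bi-invariant [f]; where no preimage exists, [xget] returns 0. *)
Definition hact (f : schlichting P -> R[i]) (u : fixed_space) : fixed_space :=
  xget 0 [set w | i w = hsum f (i u)].

Lemma fixed_incl_hact f u : binv f -> i (hact f u) = hsum f (i u).
Proof.
move=> bf; have [w wP] := fixed_incl_surj (hsum_fixed bf (fixed_incl_fixed u)).
have ex : exists w, [set w | i w = hsum f (i u)] w by exists w.
exact: (xgetPex 0 ex).
Qed.

End FixedSpace.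

Section FixedVectorFunctor.
Variables (R : realType) (P : heckePair).
Variables (mu : {measure set (borel P) -> \bar R}) (Delta : schlichting P -> R).
Hypotheses (hmu : left_haar mu) (hmuH : mu (@sch_sub P) = 1%E).
Hypothesis hDelta : modular_function mu Delta.
Local Notation X := (lcosets P).
Local Notation G := (schlichting P).
Local Notation e := (base P).
Implicit Types (c d : X) (f g : G -> R[i]).

Let HAP f : hecke_algebra mu f <-> binv f := hecke_algebraP hmu hmuH f.

Section Object.
Variable pi : unitary_rep R P.
Local Notation K := (fixed_space pi).
Local Notation i := (@fixed_incl R P pi).
Local Notation F := (@fixed_vectors R P pi).
Let iF := @fixed_incl_fixed R P pi.
Let iI := @fixed_incl_inj R P pi.

Lemma conv_binv f g : binv f -> binv g -> binv (conv mu f g).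
Proof.
move=> [fr fl [s fs]] [gr gl [t gt]].
have E := convE hmu hmuH _ fr fs gl.
split.
- move=> x y xy; rewrite /conv; congr cintegral; apply/funext => z.
  by congr (_ * _); apply: gr; rewrite !actM xy.
- move=> h x Hh; rewrite [RHS]E.
  have fs' := fsupp_act fl Hh fs; rewrite (convE hmu hmuH _ fr fs' gl) big_map.
  apply: eq_bigr => c _; congr (_ * _).
    rewrite -(fl _ (rep_iota c) Hh); apply: fr.
    by rewrite actM !act_rep.
  by rewrite !(binvE _ _ gr gl) actM !act_rep fk_act.
- apply: (@fsupp_sub _ _ _ (flatten [seq [seq act (rep_iota c) d | d <- t] | c <- s])) => x.
  apply: contraTT => xs; rewrite negbK E big1_seq// => c /= cs.
  have [_ gt'] := gt; rewrite gt' ?mulr0//; apply: contra xs => h.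
  apply/flattenP; eexists; first by apply: map_f; exact: cs.
  by apply/mapP; eexists; first exact: h; rewrite actM actVK.
Qed.

Lemma star_binv f : binv f -> binv (star Delta f).
Proof.
move=> [fr fl [s fs]].
rewrite (star_expand hmu hmuH hDelta fr fl fs).
exact: (binv_lincomb s (fun c => (f (rep_iota c))^*) (fun c => bk_binv R c e)).
Qed.

Lemma hact_linear f : hecke_algebra mu f -> linear (@hact R P pi f).
Proof.
move=> /HAP bf a u v; apply: iI.
by rewrite fixed_incl_linear !fixed_incl_hact// fixed_incl_linear hsum_linear.
Qed.

Lemma hact_bounded f : hecke_algebra mu f -> bounded_op (@hact R P pi f).
Proof.
move=> /HAP bf; have [C C0 CP] := hsum_bounded pi bf.
apply/bounded_opP; exists C => // v.
by rewrite -!fixed_incl_hn fixed_incl_hact.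
Qed.

Lemma hact_comb (a : R[i]) f g v : hecke_algebra mu f -> hecke_algebra mu g ->
  @hact R P pi (fun x => a * f x + g x) v = a *: hact f v + hact g v.
Proof.
move=> /HAP bf /HAP bg; apply: iI.
rewrite fixed_incl_linear !fixed_incl_hact ?hsum_comb//; exact: binv_comb.
Qed.

Lemma hact_conv f g v : hecke_algebra mu f -> hecke_algebra mu g ->
  @hact R P pi (conv mu f g) v = hact f (hact g v).
Proof.
move=> /HAP bf /HAP bg; apply: iI.
by rewrite !fixed_incl_hact ?hsum_conv//; exact: conv_binv.
Qed.

Lemma hact_star f u v : hecke_algebra mu f ->
  hs_inner K (hact (star Delta f) u) v = hs_inner K u (hact f v).
Proof.
move=> /HAP bf; rewrite -!fixed_incl_ip !fixed_incl_hact//; last exact: star_binv.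
exact: (hsum_star hmu hmuH hDelta).
Qed.

Lemma hact_proj v : @hact R P pi (@projH R P) v = v.
Proof.
have pb : binv (@projH R P).
  by split; [exact: rinv_proj|exact: linv_proj|exists [:: e]; exact: fsupp_proj].
by apply: iI; rewrite fixed_incl_hact// hsum_proj.
Qed.

Lemma hact_nondegenerate :
  closed_span [set @hact R P pi f v | f in hecke_algebra mu & v in [set: K]] = setT.
Proof.
apply: (@dense_closed_span _ _ K id) => [v|v r r0]; last first.
  by exists [:: (1, v)]; rewrite lsum1 subrr hn0.
exists (@projH R P); last by exists v => //; exact: hact_proj.
apply/HAP.
by split; [exact: rinv_proj|exact: linv_proj|exists [:: e]; exact: fsupp_proj].
Qed.

Definition fixed_hecke_rep : hecke_rep mu Delta :=
  @HeckeRep R P mu Delta K (@hact R P pi) hact_linear hact_bounded hact_comb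
    hact_conv hact_star hact_nondegenerate.

Lemma ip_hact_bk c d u v :
  hs_inner K (hact (bk R d c) u) v = hs_inner _ (cv c (i u)) (cv d (i v)).
Proof. by rewrite -fixed_incl_ip fixed_incl_hact ?ip_hsum_bk//; exact: bk_binv. Qed.

(** The value is the squared norm of [z], the coset sum of [f] itself applied to [v]. As [f] need
    not be left invariant, [z] lives in the whole representation space rather than among the fixed
    vectors. *)
Lemma fixed_hecke_rep_positive : innerR_positive fixed_hecke_rep.
Proof.
move=> f /(CcpP hmu hmuH)[fr [s fs]] v /=.
pose a (cd : X * X) := (f (rep_iota cd.1))^* * f (rep_iota cd.2).
have E : innerR mu Delta f f =
    fun x => \sum_(cd <- [seq (c, d) | c <- s, d <- s]) a cd * bk R cd.1 cd.2 x.
  apply/funext => x; rewrite (innerR_bk hmu hmuH hDelta x fr fs).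
  by rewrite big_allpairs_dep.
rewrite E -fixed_incl_ip fixed_incl_hact; last first.
  by apply: binv_lincomb => cd; exact: bk_binv.
rewrite (hsum_lincomb _ a (i v) (fun cd => bk_binv R cd.1 cd.2)).
pose z := \sum_(d <- s) f (rep_iota d) *: cv d (i v).
suff -> : hs_inner _ (\sum_(cd <- [seq (c, d) | c <- s, d <- s])
    a cd *: hsum (bk R cd.1 cd.2) (i v)) (i v) = hs_inner _ z z.
  by rewrite ipE -[0]/(0%:C%C) lecR exprn_ge0// hn_ge0.
rewrite ip_suml big_allpairs_dep /= ip_sumr; apply: eq_bigr => c _.
rewrite ip_suml; apply: eq_bigr => d _.
by rewrite !ipZl ipZr ip_hsum_bk// mulrA /a /=; congr (_ * _); rewrite mulrC.
Qed.

Definition fixed_positive_rep : positive_rep mu Delta :=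
  PositiveRep fixed_hecke_rep_positive.

End Object.
End FixedVectorFunctor.

(** * The functor of fixed vectors is full and faithful *)

Section FixedVectorMorphisms.
Variables (R : realType) (P : heckePair).
Variables (mu : {measure set (borel P) -> \bar R}) (Delta : schlichting P -> R).
Hypotheses (hmu : left_haar mu) (hmuH : mu (@sch_sub P) = 1%E).
Hypothesis hDelta : modular_function mu Delta.
Local Notation X := (lcosets P).
Local Notation G := (schlichting P).
Local Notation e := (base P).
Implicit Types (c d : X) (f g : G -> R[i]) (pi : unitary_rep R P).

Let HAP f : hecke_algebra mu f <-> binv f := hecke_algebraP hmu hmuH f.

Definition translate pi (cu : X * fixed_space pi) : ur_space pi :=
  cv cu.1 (fixed_incl cu.2).

Lemma translate_act pi x c (u : fixed_space pi) :
  ur_act x (translate (c, u)) = translate (theta x c, u).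
Proof. by rewrite /translate /= act_cv//; exact: fixed_incl_fixed. Qed.

Lemma translate_base pi (u : fixed_space pi) : translate (e, u) = fixed_incl u.
Proof. by rewrite /translate cv_base//; exact: fixed_incl_fixed. Qed.

Lemma translateZ pi c (a : R[i]) (u : fixed_space pi) :
  translate (c, a *: u) = a *: translate (c, u).
Proof.
rewrite /translate /= /cv -urZ; congr (ur_act _ _).
have i0 : @fixed_incl R P pi 0 = 0.
  by have := @fixed_incl_linear R P pi (-1) 0 0; rewrite !scaleN1r !addNr.
by have := @fixed_incl_linear R P pi a u 0; rewrite i0 !addr0.
Qed.

Lemma smooth_dense pi : smooth pi -> dense_family (@translate pi).
Proof.
move=> sm; apply: closed_span_dense sm => _ [x _ [v /fixed_incl_surj[u <-] <-]].
exists (\pi_X x, u) => //; rewrite /translate /= cv_pi//; exact: fixed_incl_fixed.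
Qed.

Section Restriction.
Variables (pi pi' : smooth_rep R P).
Variable T : @cat_hom (smooth_reps R P) pi pi'.

Let Tl : linear (T : ur_space pi -> ur_space pi') := itw_linear T.
Let TA x v : T (ur_act x v) = ur_act x (T v).
Proof. exact: itw_act. Qed.
Let TZ a v : T (a *: v) = a *: T v.
Proof.
have T0 : T 0 = 0 by have := Tl (-1) 0 0; rewrite !scaleN1r !addNr.
by rewrite -[a *: v]addr0 Tl T0 addr0.
Qed.
Let Tsum I (s : seq I) (h : I -> ur_space pi) :
  T (\sum_(j <- s) h j) = \sum_(j <- s) T (h j).
Proof.
elim: s => [|j s IH]; first by rewrite !big_nil -(scale0r 0) TZ scale0r.
by rewrite !big_cons -IH -[h j]scale1r Tl !scale1r.
Qed.

Lemma itw_fixed u : fixed_vectors (T (fixed_incl u)).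
Proof. by move=> h Hh; rewrite -TA (@fixed_incl_fixed R P pi u h Hh). Qed.

Definition restrict (u : fixed_space pi) : fixed_space pi' :=
  xget 0 [set w | fixed_incl w = T (fixed_incl u)].

Lemma restrictE u : fixed_incl (restrict u) = T (fixed_incl u).
Proof.
have [w wP] := fixed_incl_surj (@itw_fixed u).
have ex : exists w, [set w | fixed_incl w = T (fixed_incl u)] w by exists w.
exact: (xgetPex 0 ex).
Qed.

Lemma restrict_linear : linear restrict.
Proof.
move=> a u v; apply: fixed_incl_inj.
by rewrite fixed_incl_linear !restrictE fixed_incl_linear Tl.
Qed.

Lemma restrict_bounded : bounded_op restrict.
Proof.
have /bounded_opP[M M0 TM] := itw_bounded T.
apply/bounded_opP; exists M => // u.
by rewrite -!fixed_incl_hn restrictE.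
Qed.

Lemma restrict_act f u : hecke_algebra mu f ->
  restrict (hact f u) = hact f (restrict u).
Proof.
move=> /HAP bf; apply: fixed_incl_inj; rewrite restrictE !fixed_incl_hact// restrictE.
have [_ _ [s fs]] := bf; rewrite !(hsumE _ fs) Tsum; apply: eq_bigr => c _.
by rewrite TZ TA.
Qed.

Definition restrict_hom : @cat_hom (positive_reps mu Delta)
    (fixed_positive_rep hmu hmuH hDelta pi) (fixed_positive_rep hmu hmuH hDelta pi') :=
  @Intertwiner R _ (hecke_algebra mu) (positive_rep mu Delta)
    (fun rho => hr_space rho) (fun rho => @hr_act R P mu Delta rho)
    (fixed_positive_rep hmu hmuH hDelta pi) (fixed_positive_rep hmu hmuH hDelta pi')
    restrict restrict_linear restrict_bounded (fun f u => @restrict_act f u).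

End Restriction.

Lemma restrict_id (pi : smooth_rep R P) :
  restrict_hom (cat_id (pi : smooth_reps R P)) = cat_id _.
Proof.
apply: intertwiner_eq; apply/funext => u /=; apply: fixed_incl_inj.
by rewrite restrictE.
Qed.

Lemma restrict_comp (pi1 pi2 pi3 : smooth_reps R P)
    (S : cat_hom pi2 pi3) (T : cat_hom pi1 pi2) :
  restrict_hom (cat_comp S T) = cat_comp (restrict_hom S) (restrict_hom T).
Proof.
apply: intertwiner_eq; apply/funext => u /=; apply: fixed_incl_inj.
by rewrite !restrictE.
Qed.

Definition fixed_functor : Functor (smooth_reps R P) (positive_reps mu Delta) :=
  @MkFunctor (smooth_reps R P) (positive_reps mu Delta)
    (fun pi : smooth_rep R P => fixed_positive_rep hmu hmuH hDelta pi)
    restrict_hom restrict_id restrict_comp.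

(** Smoothness makes the translates of fixed vectors a dense family, and equivariance determines an
    intertwiner on them from its restriction. *)
Lemma fixed_functor_faithful (pi pi' : smooth_reps R P) (S T : cat_hom pi pi') :
  fmap fixed_functor S = fmap fixed_functor T -> S = T.
Proof.
move=> ST; apply: intertwiner_eq.
have [M _ SM] := (bounded_opP _).1 (itw_bounded S).
have [N _ TN] := (bounded_opP _).1 (itw_bounded T).
apply: (bounded_ext (smooth_dense (sr_smooth pi)) (itw_linear S) (itw_linear T) SM TN).
move=> [c u]; rewrite /translate /= /cv (itw_act S)// (itw_act T)//; congr (ur_act _ _).
rewrite -!restrictE; congr fixed_incl.
exact: (congr1 (fun h : @cat_hom (positive_reps mu Delta) (fixed_functor pi) (fixed_functor pi') => itw_fun h u) ST).
Qed.

Lemma ip_translate pi c d (u v : fixed_space pi) :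
  hs_inner _ (translate (c, u)) (translate (d, v)) = hs_inner _ (hact (bk R d c) u) v.
Proof. by rewrite ip_hact_bk. Qed.

Lemma gram_translate pi n (c : 'I_n -> X) (x : 'I_n -> fixed_space pi) :
  gram (fun j i => hact (bk R (c j) (c i))) x x =
  (hn (\sum_i translate (c i, x i)) ^+ 2)%:C%C.
Proof.
rewrite -ipE ip_suml; apply: eq_bigr => i _; rewrite ip_sumr; apply: eq_bigr => j _.
by rewrite ip_translate.
Qed.

Lemma fixed_functor_full (pi pi' : smooth_reps R P)
    (g : cat_hom (fixed_functor pi) (fixed_functor pi')) :
  exists T, fmap fixed_functor T = g.
Proof.
have [M M0 gM] := (bounded_opP _).1 (itw_bounded g).
pose b (cu : X * fixed_space pi) := translate (cu.1, itw_fun g cu.2 : fixed_space pi').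
have D := smooth_dense (sr_smooth pi).
have gZ a u : itw_fun g (a *: u) = a *: itw_fun g u.
  have g0 : itw_fun g 0 = 0 by have := itw_linear g (-1) 0 0; rewrite !scaleN1r !addNr.
  by rewrite -[a *: u]addr0 (itw_linear g) g0 addr0.
have bM p : hn (lsum b p) <= M * hn (lsum (@translate pi) p).
  pose c i := (tnth (in_tuple p) i).2.1.
  (* Absorbing the coefficients into the vectors turns the norm of a formal combination into a value
     of [gram]. *)
  pose x i : fixed_space pi := (tnth (in_tuple p) i).1 *: (tnth (in_tuple p) i).2.2.
  have aE : lsum (@translate pi) p = \sum_i translate (c i, x i).
    by rewrite /lsum big_tnth; apply: eq_bigr => i _; rewrite /x translateZ.
  have bE : lsum b p = \sum_i translate (c i, itw_fun g (x i) : fixed_space pi').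
    by rewrite /lsum big_tnth; apply: eq_bigr => i _; rewrite /x gZ translateZ.
  have Hbk c1 c2 : hecke_algebra mu (bk R c1 c2) by apply/HAP; exact: bk_binv.
  have adj (rho : unitary_rep R P) i j (u v : fixed_space rho) :
      hs_inner _ (hact (bk R (c i) (c j)) u) v = hs_inner _ u (hact (bk R (c j) (c i)) v).
    by rewrite -(hact_star hmu hmuH hDelta)// (star_bk hmu hmuH hDelta).
  have := @gram_comparison R _ (fixed_space pi) (fixed_space pi')
    (fun j i => hact (bk R (c j) (c i))) (fun j i => hact (bk R (c j) (c i)))
    (itw_fun g) M _ _ _ _ M0 gM _ _ x.
  rewrite !gram_translate /= aE bE => H.
  rewrite -(ler_pXn2r (_ : (0 < 2)%N)) ?nnegrE ?mulr_ge0 ?hn_ge0// exprMn; apply: H.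
  - by move=> i j; exact: (hact_bounded hmu hmuH).
  - by move=> i j u v; exact: adj.
  - by move=> i j u v; exact: adj.
  - exact: (itw_linear g).
  - by move=> i j u; exact: (itw_act g).
  - by move=> y; rewrite gram_translate /= exprn_ge0// hn_ge0.
have [T [Tl TM Ta]] := bounded_extension D M0 bM.
have TA x v : setT x -> T (ur_act x v) = ur_act x (T v).
  move=> _; suff : T \o ur_act x = ur_act x \o T by move=> /(congr1 (@^~ v)).
  apply: (bounded_ext (M := M) (M' := M) D) => //.
  - by move=> a u w /=; rewrite ur_linear Tl.
  - by move=> a u w /=; rewrite Tl ur_linear.
  - by move=> u /=; apply: le_trans (TM _) _; rewrite ur_hn.
  - by move=> u /=; rewrite ur_hn.
  - by move=> [c u] /=; rewrite translate_act !Ta /b translate_act.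
have Tb : bounded_op T by apply/bounded_opP; exists M.
pose Th : @cat_hom (smooth_reps R P) pi pi' :=
  @Intertwiner R _ setT (smooth_rep R P) (fun rho => ur_space rho)
    (fun rho => @ur_act R P rho) pi pi' T Tl Tb TA.
exists Th; apply: intertwiner_eq; apply/funext => u /=; apply: fixed_incl_inj.
by rewrite restrictE /= -translate_base Ta /b /= translate_base.
Qed.

End FixedVectorMorphisms.

(** * Positive representations and induction *)

Section ApproximateProjection.
Variables (R : realType) (W : hilbertSpace R) (D : set W).
Hypothesis D0 : D 0.
Hypothesis DP : forall a u v, D u -> D v -> D (a *: u + v).

(** [D] is not closed, so the distance to [w] need not be attained. A point [y] whose squared
    distance is within [r ^+ 2] of the infimum suffices: moving it along [z] gains the square of the
    inner product divided by that of [hn z], and the gain cannot exceed [r ^+ 2]. *)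
Lemma approximate_projection w (r : R) : 0 < r ->
  exists2 y, D y & forall z, D z -> cmod (hs_inner W (w - y) z) <= r * hn z.
Proof.
move=> r0; pose A := [set hn (w - y) ^+ 2 | y in D].
have Alb : has_lbound A by exists 0 => _ [y _ <-]; exact: sqr_ge0.
have hA : has_inf A by split=> //; exists (hn (w - 0) ^+ 2), 0.
have [_ [y Dy <-] yA] := inf_adherent (exprn_gt0 2 r0) hA.
exists y => // z Dz.
have z0 := hn_ge0 z; have [hz0|hz0] := eqVneq (hn z) 0.
  by rewrite (hn_eq0 hz0) ip0r cmod0 hn0 mulr0.
have zp : 0 < hn z by rewrite lt_def hz0.
set t := hs_inner W (w - y) z.
(* The step along [z] that decreases the distance most. *)
pose a : R[i] := - (t / (hn z ^+ 2)%:C%C).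
have h1 : inf A <= hn (w - (y - a *: z)) ^+ 2.
  apply: ge_inf => //; exists (y - a *: z) => //.
  by rewrite addrC -scaleNr; exact: DP.
have E : hn (w - (y - a *: z)) ^+ 2 = hn (w - y) ^+ 2 - cmod t ^+ 2 / hn z ^+ 2.
  have -> : w - (y - a *: z) = lcomb a z (w - y) by rewrite /lcomb opprB !addrA [w + _]addrC.
  rewrite {1}/hn (sn_sqr (@ip_ge0 R W)) (sqn_comb (@ip_lin R W) (@ip_herm R W)).
  rewrite -!(sn_sqr (@ip_ge0 R W)) -!/(hn _) (ip_herm (w - y)) -/t.
  have zC : hn z ^+ 2 != 0 by rewrite expf_neq0.
  have -> : a * t^* = (- (cmod t ^+ 2 / hn z ^+ 2))%:C%C.
    rewrite /a mulNr mulrAC mulcJ real_complexN real_complexM real_complexV.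
    by [].
  have -> : cmod a = cmod t / hn z ^+ 2.
    rewrite /a cmodN cmodM -real_complexV cmodR ger0_norm// invr_ge0 exprn_ge0//.
  by rewrite /=; field.
have h2 : cmod t ^+ 2 / hn z ^+ 2 < r ^+ 2.
  by move: h1 yA; rewrite E; move: (inf A) (_ / _) (hn _ ^+ 2) => p q s; lra.
rewrite -(ler_pXn2r (_ : (0 < 2)%N)) ?nnegrE ?cmod_ge0 ?mulr_ge0 ?(ltW r0)// exprMn.
by rewrite -ler_pdivrMr ?exprn_gt0// ltW.
Qed.

End ApproximateProjection.

Section PositiveRepresentation.
Variables (R : realType) (P : heckePair).
Variables (mu : {measure set (borel P) -> \bar R}) (Delta : schlichting P -> R).
Hypotheses (hmu : left_haar mu) (hmuH : mu (@sch_sub P) = 1%E).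
Hypothesis hDelta : modular_function mu Delta.
Variable rho : positive_rep mu Delta.
Local Notation X := (lcosets P).
Local Notation G := (schlichting P).
Local Notation e := (base P).
Local Notation W := (hr_space rho).
Local Notation A := (@hr_act R P mu Delta rho).
Local Notation HA := (hecke_algebra mu).
Local Notation proj := (@projH R P).
Implicit Types (c d : X) (f g : G -> R[i]) (w : W).

Let HAP f : HA f <-> binv f := hecke_algebraP hmu hmuH f.

Definition hr_bk c d : W -> W := A (bk R c d).

Lemma HA_bk c d : HA (bk R c d). Proof. by apply/HAP; exact: bk_binv. Qed.

Lemma HA_proj : HA proj.
Proof.
by apply/HAP; split; [exact: rinv_proj|exact: linv_proj|exists [:: e]; exact: fsupp_proj].
Qed.

Lemma HA_linear f a u v : HA f -> A f (a *: u + v) = a *: A f u + A f v.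
Proof. by move=> hf; exact: (hr_op_linear hf). Qed.

Lemma HA_0 f : HA f -> A f 0 = 0.
Proof. by move=> hf; have := HA_linear (-1) 0 0 hf; rewrite !scaleN1r !addNr. Qed.

Lemma HA_Z f a u : HA f -> A f (a *: u) = a *: A f u.
Proof. by move=> hf; rewrite -[a *: u]addr0 HA_linear// HA_0// addr0. Qed.

Lemma HA_D f u v : HA f -> A f (u + v) = A f u + A f v.
Proof. by move=> hf; rewrite -[u]scale1r HA_linear// !scale1r. Qed.

Lemma hr_lincomb (I : Type) (t : seq I) (a : I -> R[i]) (b : I -> G -> R[i]) v :
  (forall i, binv (b i)) ->
  A (fun x => \sum_(i <- t) a i * b i x) v = \sum_(i <- t) a i *: A (b i) v.
Proof.
move=> bb; elim: t => [|i t IH].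
  have z0 : binv (fun _ : G => 0 : R[i]) by split=> //; exists [::].
  have := @hr_linear R P mu Delta rho (-1) _ _ v ((HAP _).2 z0) ((HAP _).2 z0).
  have -> : (fun x : G => -1 * 0 + 0) = (fun x : G => \sum_(i <- [::]) a i * b i x).
    by apply/funext => x; rewrite mulr0 addr0 big_nil.
  by rewrite scaleN1r addNr big_nil.
have -> : (fun x : G => \sum_(j <- i :: t) a j * b j x) =
    fun x => a i * b i x + \sum_(j <- t) a j * b j x.
  by apply/funext => x; rewrite big_cons.
by rewrite big_cons -IH -hr_linear//; apply/HAP => //; exact: binv_lincomb.
Qed.

(** This is [conv_bk] seen in the representation. Allowing [r] to exceed the support provides one
    common index set for several [g]. *)
Lemma hr_bk_hr g (r : seq X) c c' w : binv g -> uniq r ->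
  (forall d, d \notin r -> fk g c' d = 0) ->
  hr_bk c c' (A g w) = \sum_(d <- r) fk g c' d *: hr_bk c d w.
Proof.
move=> bg ur r0; have [gr gl [s gs]] := bg.
rewrite /hr_bk -hr_conv; [|exact: HA_bk|exact/HAP].
have -> : conv mu (bk R c c') g = fun x => \sum_(d <- r) fk g c' d * bk R c d x.
  apply/funext => x; rewrite (conv_bk hmu hmuH _ _ _ gr gl gs).
  have us : uniq [seq act (rep_iota c') z | z <- s].
    by rewrite map_inj_uniq; [case: gs|exact: act_inj].
  rewrite (sum_uniq_sub us ur) => [|d _ /r0 ->]; last by rewrite mul0r.
  rewrite big_mkcond; apply: eq_bigr => d _; case: ifPn => // ds.
  by rewrite (fk_supp gr gl gs ds) mul0r.
exact: (hr_lincomb r (fun d => fk g c' d) w (bk_binv R c)).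
Qed.

Lemma hr_bk_adj c d u v : hs_inner W (hr_bk c d u) v = hs_inner W u (hr_bk d c v).
Proof.
rewrite /hr_bk -(star_bk hmu hmuH hDelta d c) hr_star//; exact: HA_bk.
Qed.

(** [p] is a left unit of the Hecke algebra, hence acts as the identity on every [A f v], and by
    nondegeneracy these vectors span a dense subspace. *)
Lemma hr_proj w : A proj w = w.
Proof.
pose S := ({f : G -> R[i] | HA f} * W)%type.
pose a (s : S) := A (sval s.1) s.2.
have D : dense_family a.
  apply: closed_span_dense (@hr_nondegenerate R P mu Delta rho).
  by move=> _ [f hf [v _ <-]]; exists (exist HA f hf, v).
have [M _ pM] := (bounded_opP _).1 (@hr_op_bounded R P mu Delta rho _ HA_proj).
have idb : bounded_by (@idfun W) 1 by move=> v; rewrite mul1r.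
have := bounded_ext D (@hr_op_linear R P mu Delta rho _ HA_proj) (T' := idfun) _ pM idb.
move=> -> //.
move=> [[f hf] v]; rewrite /a /= -hr_conv//; last exact: HA_proj.
have [_ fl _] := (HAP f).1 hf.
by rewrite (conv_projl hmu hmuH fl).
Qed.

Lemma hr_bk_refl c w : hr_bk c c w = w.
Proof. by rewrite /hr_bk bk_refl; exact: hr_proj. Qed.

Lemma hr_bk_act s c d : hr_bk (act s c) (act s d) = hr_bk c d.
Proof. by rewrite /hr_bk bk_act. Qed.

(** The numbers [F c] are taken as the values on cosets of a function in [C_c(G)p]; [innerR_bk] then
    rewrites the assumed positivity at that function. *)
Lemma hr_bk_positive (s : seq X) (F : X -> R[i]) w : uniq s ->
  0 <= complex.Re (\sum_(c <- s) \sum_(d <- s) (F c)^* * F d * hs_inner W (hr_bk c d w) w).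
Proof.
move=> us; pose f (x : G) := if act x e \in s then F (act x e) else 0.
have fr : rinv f by move=> x y xy; rewrite /f xy.
have fs : fsupp f s by split=> // x /negbTE xs; rewrite /f xs.
pose a (cd : X * X) := (f (rep_iota cd.1))^* * f (rep_iota cd.2).
have E : innerR mu Delta f f =
    fun x => \sum_(cd <- [seq (c, d) | c <- s, d <- s]) a cd * bk R cd.1 cd.2 x.
  apply/funext => x; rewrite (innerR_bk hmu hmuH hDelta x fr fs).
  by rewrite big_allpairs_dep.
have := @pr_positive _ _ _ _ rho f.
move=> /(_ ((CcpP hmu hmuH f).2 (conj fr (ex_intro _ s fs))) w).
rewrite E (hr_lincomb _ a w (fun cd => bk_binv R cd.1 cd.2)) ge0_complexE.
move=> /andP[_]; rewrite ip_suml big_allpairs_dep /= => h.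
rewrite (_ : \sum_(c <- s) _ = \sum_(c <- s) \sum_(d <- s)
  hs_inner W (a (c, d) *: A (bk R c d) w) w)//.
apply: eq_big_seq => c cs; apply: eq_big_seq => d ds.
by rewrite ipZl /a /f /= !act_rep cs ds.
Qed.

Definition Qform (p q : seq (X * W)) : R[i] :=
  \sum_(u <- p) \sum_(v <- q) hs_inner W (hr_bk v.1 u.1 u.2) v.2.

Lemma Qform_herm p q : Qform q p = (Qform p q)^*.
Proof.
rewrite /Qform rmorph_sum exchange_big; apply: eq_bigr => u _ /=.
rewrite rmorph_sum; apply: eq_bigr => v _ /=.
by rewrite hr_bk_adj ip_herm.
Qed.

(** The algebraic cyclic subspace without closure: the vectors [A g w0] are those that [hr_bk_hr]
    expands. *)
Definition cyclic_span w0 : set W := [set A g w0 | g in HA].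

(** Writing each vector as [A g w0] and applying [hr_bk_hr] in both arguments extracts the values of
    [fk] as scalars. What remains is [hr_bk_positive] at the single vector [w0], with the
    coefficient of [d] summed over the family. *)
Lemma Qform_cyclic w0 (p : seq (X * W)) : (forall u : X * W, u \in p -> cyclic_span w0 u.2) ->
  0 <= complex.Re (Qform p p).
Proof.
move=> pD.
have H w : exists g, cyclic_span w0 w -> HA g /\ A g w0 = w.
  have [[g hg <-]|nw] := pselect (cyclic_span w0 w); first by exists g.
  by exists (fun=> 0).
have [g gP] := choice H.
have Hs (u : X * W) : exists s : seq X, u \in p -> forall d, d \notin s -> fk (g u.2) u.1 d = 0.
  have [up|up] := boolP (u \in p); last by exists [::].
  have [/HAP[gr gl [s gs]] _] := gP _ (pD u up).
  by exists [seq act (rep_iota u.1) z | z <- s] => _ d; exact: fk_supp.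
have [sf sfP] := choice Hs.
pose s := undup (flatten [seq sf u | u <- p]).
have us : uniq s by exact: undup_uniq.
have sP (u : X * W) d : u \in p -> d \notin s -> fk (g u.2) u.1 d = 0.
  move=> up ds; apply: (sfP u up); apply: contra ds => h.
  by rewrite mem_undup; apply/flattenP; exists (sf u) => //; exact: map_f.
pose a (u : X * W) d := fk (g u.2) u.1 d.
pose M d d' := hs_inner W (hr_bk d' d w0) w0.
have E (u v : X * W) : u \in p -> v \in p -> hs_inner W (hr_bk v.1 u.1 u.2) v.2 =
    \sum_(d <- s) \sum_(d' <- s) a u d * (a v d')^* * M d d'.
  move=> up vp; have [/HAP bu uE] := gP _ (pD u up); have [/HAP bv vE] := gP _ (pD v vp).
  rewrite -{1}uE (hr_bk_hr _ _ bu us) => [|d ds]; last exact: sP.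
  rewrite ip_suml; apply: eq_bigr => d _; rewrite ipZl hr_bk_adj -{1}vE.
  rewrite (hr_bk_hr _ _ bv us) => [|d' ds]; last exact: sP.
  rewrite ip_sumr mulr_sumr; apply: eq_bigr => d' _.
  by rewrite ipZr mulrA /M hr_bk_adj.
have := hr_bk_positive (fun d => \sum_(u <- p) a u d) w0 us; congr (0 <= complex.Re _).
rewrite /Qform; symmetry.
transitivity (\sum_(u <- p) \sum_(v <- p) \sum_(d <- s) \sum_(d' <- s) a u d * (a v d')^* * M d d').
  by apply: eq_big_seq => u up; apply: eq_big_seq => v vp; exact: E.
rewrite [RHS]exchange_big /=.
under eq_bigr do rewrite exchange_big /=.
rewrite exchange_big /=; apply: eq_bigr => d _.
under eq_bigr do rewrite exchange_big /=.
rewrite exchange_big /=; apply: eq_bigr => d' _.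
rewrite rmorph_sum /= mulr_sumr mulr_suml; apply: eq_bigr => u _.
by rewrite mulr_suml mulr_suml; apply: eq_bigr => v _; rewrite [_^* * _]mulrC.
Qed.

Lemma cyclic_span0 w0 : cyclic_span w0 0.
Proof.
exists (fun x => -1 * proj x + proj x).
  by apply/HAP; apply: binv_comb; exact/HAP/HA_proj.
by rewrite hr_linear ?scaleN1r ?addNr//; exact: HA_proj.
Qed.

Lemma cyclic_spanP w0 a u v :
  cyclic_span w0 u -> cyclic_span w0 v -> cyclic_span w0 (a *: u + v).
Proof.
move=> [f hf <-] [g hg <-]; exists (fun x => a * f x + g x).
  by apply/HAP; apply: binv_comb; exact/HAP.
exact: hr_linear.
Qed.

Lemma cyclic_span_hr_bk w0 c d u : cyclic_span w0 u -> cyclic_span w0 (hr_bk c d u).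
Proof.
move=> [f hf <-]; exists (conv mu (bk R c d) f).
  by apply/HAP/(conv_binv hmu hmuH); [exact: bk_binv|exact/HAP].
by rewrite hr_conv//; exact: HA_bk.
Qed.

Lemma cyclic_span_refl w0 : cyclic_span w0 w0.
Proof. by exists proj; [exact: HA_proj|exact: hr_proj]. Qed.

Lemma Qform_split (y z : W -> W) p : (forall w, w = y w + z w) ->
  Qform p p = Qform [seq (u.1, y u.2) | u <- p] [seq (u.1, y u.2) | u <- p] +
    Qform [seq (u.1, y u.2) | u <- p] [seq (u.1, z u.2) | u <- p] +
    (Qform [seq (u.1, y u.2) | u <- p] [seq (u.1, z u.2) | u <- p])^* +
    Qform [seq (u.1, z u.2) | u <- p] [seq (u.1, z u.2) | u <- p].
Proof.
move=> yz; rewrite -Qform_herm /Qform !big_map -!big_split; apply: eq_bigr => u _ /=.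
rewrite !big_map -!big_split; apply: eq_bigr => v _ /=.
rewrite {1}(yz u.2) {1}(yz v.2) /hr_bk HA_D; last exact: HA_bk.
by rewrite !ipDl !ipDr; ring.
Qed.

(* Complete positivity: split off, up to [r], the components in the cyclic
   subspace of the first vector, which is invariant, so that the two parts are
   nearly orthogonal for the form and the second one is shorter. *)
Theorem Qform_ge0 p : 0 <= complex.Re (Qform p p).
Proof.
have [n] := ubnP (size p); elim: n p => // n IH [|[c0 w0] p] pn.
  by rewrite /Qform big_nil.
set q := (c0, w0) :: p.
have HB (cd : X * X) : exists B, 0 <= B /\ bounded_by (hr_bk cd.1 cd.2) B.
  have /bounded_opP[B B0 BP] := @hr_op_bounded R P mu Delta rho _ (HA_bk cd.1 cd.2).
  by exists B.
have [B BP] := choice HB.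
(* A bound for the cross term is [r * C]; the summand 1 comes from [hn (y w) <= hn w + r] with
   [r <= 1]. *)
pose C := \sum_(u <- q) \sum_(v <- q) B (v.1, u.1) * (hn u.2 + 1).
suff step r : 0 < r -> r <= 1 -> - (2 * (r * C)) <= complex.Re (Qform q q).
  apply/ler_addgt0Pl => r r0.
  have C0 : 0 <= C.
    apply: sumr_ge0 => u _; apply: sumr_ge0 => v _; rewrite mulr_ge0//.
      by have [] := BP (v.1, u.1).
    by have := hn_ge0 u.2; lra.
  (* Chosen so that [t <= 1] and [2 * (t * C) <= r]. *)
  pose t := Num.min 1 (r / (2 * (C + 1))).
  have t1 : t <= 1 by rewrite ge_min lexx.
  have t2 : t <= r / (2 * (C + 1)) by rewrite ge_min lexx orbT.
  have t0 : 0 < t by rewrite lt_min ltr01 divr_gt0// mulr_gt0//; lra.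
  have := step t t0 t1.
  have : t * (2 * (C + 1)) <= r by rewrite -ler_pdivlMr//; lra.
  by move: (complex.Re _) => z; nra.
move=> r0 r1.
(* The clause [y = w] on the cyclic subspace makes the remainder of [w0] exactly zero, so the
   remainders form a shorter family for the induction. *)
have Hy w : exists y, [/\ cyclic_span w0 y, cyclic_span w0 w -> y = w &
    forall z, cyclic_span w0 z -> cmod (hs_inner W (w - y) z) <= r * hn z].
  have [Dw|nDw] := pselect (cyclic_span w0 w).
    exists w; split=> // z _; rewrite subrr ip0l cmod0 mulr_ge0 ?hn_ge0//; exact: ltW.
  have [y Dy yP] := approximate_projection (cyclic_span0 w0) (@cyclic_spanP w0) w r0.
  by exists y; split.
have [y yP] := choice Hy; pose z w := w - y w.
have yn w : hn (y w) <= hn w + r.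
  have [Dy _ /(_ _ Dy) h] := yP w.
  have hip : hn (y w) ^+ 2 = complex.Re (hs_inner W w (y w)) - complex.Re (hs_inner W (w - y w) (y w)).
    by rewrite -ReB -ipBl opprB addrC subrK ipE.
  have h1 : complex.Re (hs_inner W w (y w)) <= hn w * hn (y w).
    by apply: le_trans (Re_le_cmod _) (ip_CS _ _).
  have h2 : - complex.Re (hs_inner W (w - y w) (y w)) <= r * hn (y w).
    by rewrite -ReN; apply: le_trans (Re_le_cmod _) _; rewrite cmodN.
  have [->|yw0] := eqVneq (hn (y w)) 0; first by have := hn_ge0 w; lra.
  have yw : 0 < hn (y w) by rewrite lt_def yw0 hn_ge0.
  by rewrite -(ler_pM2r yw) -expr2 hip; lra.
pose qy := [seq (u.1, y u.2) | u <- q]; pose qz := [seq (u.1, z u.2) | u <- q].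
have zz w : w = y w + z w by rewrite /z addrC subrK.
rewrite (Qform_split q zz) -/qy -/qz !ReD ReJ.
have hy : 0 <= complex.Re (Qform qy qy).
  apply: (@Qform_cyclic w0) => _ /mapP[u _ ->] /=; by have [] := yP u.2.
have hz : 0 <= complex.Re (Qform qz qz).
  have zw0 : z w0 = 0.
    by have [_ h _] := yP w0; rewrite /z h ?subrr//; exact: cyclic_span_refl.
  have -> : Qform qz qz = Qform [seq (u.1, z u.2) | u <- p] [seq (u.1, z u.2) | u <- p].
    rewrite /Qform big_cons big1 ?add0r; last first.
      by move=> v _; rewrite /= zw0 /hr_bk HA_0 ?ip0l//; exact: HA_bk.
    apply: eq_bigr => u _; rewrite big_cons /= zw0 ip0r add0r.
    by [].
  by apply: IH; rewrite size_map.
have hc : cmod (Qform qy qz) <= r * C.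
  rewrite /Qform /C mulr_sumr big_map.
  apply: le_trans (cmod_sum _ _) _; apply: ler_sum => u _.
  rewrite mulr_sumr big_map; apply: le_trans (cmod_sum _ _) _; apply: ler_sum => v _ /=.
  rewrite ip_herm cmodJ; have [_ _ zP] := yP v.2.
  have [Dy _ _] := yP u.2.
  apply: le_trans (zP _ (cyclic_span_hr_bk v.1 u.1 Dy)) _.
  rewrite ler_wpM2l ?(ltW r0)//; have [B0 /(_ (y u.2)) h] := BP (v.1, u.1).
  apply: le_trans h _; rewrite ler_wpM2l//; have := yn u.2; lra.
have := Re_le_cmod (- Qform qy qz); rewrite cmodN ReN; lra.
Qed.

Definition Wkernel (s t : X * W) : R[i] := hs_inner W (hr_bk t.1 s.1 s.2) t.2.

Lemma Wkernel_herm s t : Wkernel t s = (Wkernel s t)^*.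
Proof. by rewrite /Wkernel hr_bk_adj ip_herm. Qed.

Lemma Wkernel_psd p : 0 <= complex.Re (kform Wkernel p p).
Proof.
have := Qform_ge0 [seq (u.2.1, u.1 *: u.2.2) | u <- p]; congr (0 <= complex.Re _).
rewrite /Qform /kform big_map; apply: eq_bigr => u _; rewrite big_map.
apply: eq_bigr => v _ /=; rewrite /hr_bk HA_Z; last exact: HA_bk.
by rewrite ipZl ipZr mulrA.
Qed.

End PositiveRepresentation.

(** * The induced representation and its fixed vectors *)

Section InducedRepresentation.
Variables (R : realType) (P : heckePair).
Variables (mu : {measure set (borel P) -> \bar R}) (Delta : schlichting P -> R).
Hypotheses (hmu : left_haar mu) (hmuH : mu (@sch_sub P) = 1%E).
Hypothesis hDelta : modular_function mu Delta.
Variable rho : positive_rep mu Delta.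
Local Notation X := (lcosets P).
Local Notation G := (schlichting P).
Local Notation e := (base P).
Local Notation W := (hr_space rho).
Local Notation A := (@hr_act R P mu Delta rho).
Local Notation bkop := (@hr_bk R P mu Delta rho).
Local Notation HA := (hecke_algebra mu).
Variables (K : hilbertSpace R) (j : X * W -> K).
Hypothesis j_ip : forall s t, hs_inner K (j s) (j t) = Wkernel (rho := rho) s t.
Hypothesis j_dense : dense_family j.
Implicit Types (c d : X) (f g : G -> R[i]) (w : W).

Let HAP f : HA f <-> binv f := hecke_algebraP hmu hmuH f.

Lemma dense_ip_inj (v v' : K) :
  (forall s, hs_inner K v (j s) = hs_inner K v' (j s)) -> v = v'.
Proof.
move=> vv; apply: ip_inj => u; rewrite ip_herm [RHS]ip_herm; congr (_^*).
apply/eqP; rewrite -subr_eq0; apply/eqP.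
apply: (@dense_functional0 R K _ j (fun u => hs_inner K u v - hs_inner K u v')
  (hn v + hn v')) => //.
- by move=> a u1 u2; rewrite !ipDl !ipZl; ring.
- move=> u1; rewrite -ipBr; apply: le_trans (ip_CS _ _) _.
  rewrite mulrC ler_wpM2r ?hn_ge0//.
  by apply: le_trans (hnD _ _) _; rewrite hnN.
- by move=> s; rewrite ip_herm vv -ip_herm subrr.
Qed.

(** The balancing relation of a tensor product over the Hecke algebra. It is not imposed: both sides
    have the same inner products with the dense family [j]. *)
Lemma j_hr g (r : seq X) c w : binv g -> uniq r ->
  (forall d, d \notin r -> fk g c d = 0) ->
  j (c, A g w) = \sum_(d <- r) fk g c d *: j (d, w).
Proof.
move=> bg ur r0; apply: dense_ip_inj => -[c' w'].
rewrite ip_suml j_ip /Wkernel /= (hr_bk_hr hmu hmuH _ _ bg ur r0) ip_suml.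
by apply: eq_bigr => d _; rewrite !ipZl j_ip.
Qed.

Lemma j_linear c a u v : j (c, a *: u + v) = a *: j (c, u) + j (c, v).
Proof.
apply: dense_ip_inj => -[c' w']; rewrite ipDl ipZl !j_ip /Wkernel /=.
rewrite /hr_bk (HA_linear (rho := rho)); last exact: HA_bk.
by rewrite ipDl ipZl.
Qed.

Lemma j_base_ip u v : hs_inner K (j (e, u)) (j (e, v)) = hs_inner W u v.
Proof. by rewrite j_ip /Wkernel /= (hr_bk_refl hmu hmuH). Qed.

Lemma j_base_hn u : hn (j (e, u)) = hn u.
Proof. by rewrite /hn /sn /sqn j_base_ip. Qed.

Lemma j_base0 : j (e, 0) = 0.
Proof. by have := j_linear e (-1) 0 0; rewrite !scaleN1r !addNr. Qed.

Lemma j_base_inj u v : j (e, u) = j (e, v) -> u = v.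
Proof. by move=> uv; apply: ip_inj => w; rewrite -!j_base_ip uv. Qed.

(** The kernel sees two cosets only through their relative position, so translating both leaves the
    Gram matrix unchanged. *)
Lemma induced_action_ex x : exists U : K -> K, [/\ linear U,
  forall u v, hs_inner K (U u) (U v) = hs_inner K u v &
  forall s, U (j s) = j (theta x s.1, s.2)].
Proof.
apply: isometric_extension => // -[c u] [d v] /=.
by rewrite !j_ip /Wkernel /= -!act_iota hr_bk_act.
Qed.

Definition induced_action x : K -> K := sval (cid (induced_action_ex x)).
Local Notation U := induced_action.

Lemma induced_actionP x : [/\ linear (U x),
  forall u v, hs_inner K (U x u) (U x v) = hs_inner K u v &
  forall s, U x (j s) = j (theta x s.1, s.2)].
Proof. exact: svalP (cid (induced_action_ex x)). Qed.

Lemma induced_linear x : linear (U x). Proof. by case: (induced_actionP x). Qed.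

Lemma induced_unitary x u v : hs_inner K (U x u) (U x v) = hs_inner K u v.
Proof. by case: (induced_actionP x). Qed.

Lemma induced_j x c w : U x (j (c, w)) = j (theta x c, w).
Proof. by case: (induced_actionP x) => _ _ ->. Qed.

Lemma induced_bounded x : bounded_by (U x) 1.
Proof. by move=> v; rewrite mul1r /hn /sn /sqn induced_unitary. Qed.

Lemma induced_act1 v : U 1%g v = v.
Proof.
have b1 : bounded_by (@idfun K) 1 by move=> u; rewrite mul1r.
have -> // : U 1%g = idfun.
apply: (bounded_ext j_dense (@induced_linear _) _ (@induced_bounded _) b1) => //.
by move=> [c w]; rewrite induced_j theta1.
Qed.

Lemma induced_actM x y v : U (x * y)%g v = U x (U y v).
Proof.
have b1 : bounded_by (U x \o U y) 1.
  move=> u /=; apply: le_trans (induced_bounded _ _) _.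
  by rewrite mul1r; exact: induced_bounded.
have -> // : U (x * y)%g = U x \o U y.
apply: (bounded_ext j_dense (@induced_linear _) _ (@induced_bounded _) b1) => //.
  by move=> a u w /=; rewrite !induced_linear.
by move=> [c w]; rewrite /= !induced_j thetaM.
Qed.

Definition induced_rep : unitary_rep R P :=
  UnitaryRep induced_linear induced_unitary induced_act1 induced_actM.

Lemma j_base_fixed w : @fixed_vectors R P induced_rep (j (e, w)).
Proof. by move=> h Hh /=; rewrite induced_j; congr (j (_, w)); apply/hp_subE. Qed.

Lemma cv_j c w : @cv R P induced_rep c (j (e, w)) = j (c, w).
Proof.
rewrite /cv /= induced_j; congr (j (_, w)).
exact: act_rep.
Qed.

Lemma induced_smooth : smooth induced_rep.
Proof.
apply: dense_closed_span j_dense => -[c w].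
exists (repr c) => //; exists (j (e, w)); first exact: j_base_fixed.
exact: cv_j.
Qed.

Lemma fixed_ip_orb (v : K) c d w : @fixed_vectors R P induced_rep v -> d \in orb c ->
  hs_inner K (j (d, w)) v = hs_inner K (j (c, w)) v.
Proof.
move=> Fv /orbP0[h Hh <-]; rewrite -induced_j.
by rewrite -{1}(Fv h Hh) /= induced_unitary.
Qed.

(* [bk e c] averages over the orbit of [c], along which the inner product with a
   fixed vector is constant. *)
Lemma fixed_ip_average (v : K) c w : @fixed_vectors R P induced_rep v ->
  hs_inner K (j (e, bkop e c w)) v = hs_inner K (j (c, w)) v.
Proof.
move=> Fv; have cE : cdiff e c \in orb c.
  by apply/orbP; exists (rep_iota e)^-1%g => //; apply/subVH/sch_subE; rewrite act_rep.
have fkE d : fk (bk R e c) e d = if d \in orb (cdiff e c) then (olen (cdiff e c))%:R^-1 else 0.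
  by rewrite -{1}(act_rep d) -fk_base ?/bk ?act_rep//; [exact: bk_rinv|exact: bk_linv].
rewrite /hr_bk (@j_hr _ (orb (cdiff e c))); last 3 first.
- exact: bk_binv.
- exact: orb_uniq.
- by move=> d /negbTE dn; rewrite fkE dn.
rewrite ip_suml (eq_big_seq (fun=> (olen (cdiff e c))%:R^-1 * hs_inner K (j (c, w)) v)).
  rewrite big_const_seq count_predT iter_addr_0 -/(olen _) -[LHS]mulr_natl mulVKf//.
  by rewrite pnatr_eq0 -lt0n olen_gt0.
move=> d dc; rewrite ipZl fkE dc (@fixed_ip_orb v c)//.
by rewrite -(orb_eq cE).
Qed.

(** Averaging the terms of an approximation [z] of [v] gives a vector [J w] that pairs with fixed
    vectors as [z] does. So [z - J w] is orthogonal to the fixed vector [v - J w], and [J w] is at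
    least as close to [v] as [z] is. *)
Lemma induced_fixed (v : K) : @fixed_vectors R P induced_rep v ->
  exists w, j (e, w) = v.
Proof.
move=> Fv; pose J w := j (e, w).
have : closure (range J) v.
  apply/hclosureP => r r0; have [p vp] := j_dense v r0.
  pose w := lsum (fun s : X * W => bkop e s.1 s.2) p.
  exists (J w); first by exists w.
  apply: le_lt_trans vp; set z := lsum j p.
  have Ft : @fixed_vectors R P induced_rep (v - J w).
    by rewrite addrC -scaleN1r; apply: fixedP => //; exact: j_base_fixed.
  have zE : hs_inner K (z - J w) (v - J w) = 0.
    rewrite ipBl; apply/eqP; rewrite subr_eq0; apply/eqP.
    (* [J w] changes with [p], so the induction is run for an arbitrary fixed vector [u] in place of
       [v - J w]. *)
    rewrite /z /J /w; elim: p {w z Ft} (v - _) Ft => [|[a s] p IH] u Fu.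
      by rewrite /lsum !big_nil j_base0.
    rewrite /lsum !big_cons j_linear !ipDl !ipZl (IH _ Fu).
    by case: s => c w /=; rewrite (fixed_ip_average _ _ Fu).
  set t := v - J w in Ft zE *.
  have h : hn t ^+ 2 <= hn (v - z) * hn t.
    have -> : hn t ^+ 2 = complex.Re (hs_inner K (v - z) t).
      have <- : hs_inner K t t = hs_inner K (v - z) t.
        have tE : t = (v - z) + (z - J w) by rewrite subrKA.
        by rewrite [X in hs_inner K X t]tE ipDl zE addr0.
      by rewrite ipE.
    by apply: le_trans (Re_le_cmod _) (ip_CS _ _).
  have [->|t0] := eqVneq (hn t) 0; first exact: hn_ge0.
  have tp : 0 < hn t by rewrite lt_def t0 hn_ge0.
  by rewrite -(ler_pM2r tp) -expr2.
(* [J] is isometric and [W] is complete, so the range of [J] is closed. *)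
move=> /hcvgP[y yJ yv].
have [w wP] := choice (fun n => let: ex_intro2 w _ h := yJ n in ex_intro _ w h).
have E n m : hn (w n - w m) = hn (y n - y m).
  by rewrite -!wP -j_base_hn -scaleN1r addrC j_linear scaleN1r addrC.
have [|w' ww'] := @hcomplete R W w.
  move=> r r0; have [N NP] := hcvg_cauchy yv r0; exists N => m n Nm Nn.
  by rewrite ip_sdist E -ip_sdist; exact: NP.
exists w'; apply: (hcvg_unique _ yv) => r r0; have [N NP] := ww' r r0.
exists N => n /NP; rewrite -wP /J -j_base_hn.
by rewrite -scaleN1r addrC j_linear scaleN1r addrC.
Qed.

(** The map [w |-> j (e, w)] identifies [W] with the fixed vectors. The translates of [j (e, w)] are
    the [j (c, w)], so the coset sum of [f] is the expansion of [j (e, A f w)] in [j_hr], which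
    gives equivariance. *)
Lemma fixed_induced_iso :
  exists i : @cat_hom (positive_reps mu Delta)
    (fixed_positive_rep hmu hmuH hDelta (SmoothRep induced_smooth)) rho, is_iso i.
Proof.
set pi := SmoothRep induced_smooth.
have exT (u : fixed_space pi) : exists w : W, j (e, w) = fixed_incl u.
  by apply: induced_fixed; exact: fixed_incl_fixed.
have exS (w : W) : exists u : fixed_space pi, fixed_incl u = j (e, w).
  by apply: fixed_incl_surj; exact: j_base_fixed.
have [T TP] := choice exT.
have [S SP] := choice exS.
have Tl : linear T.
  move=> a u v; apply: j_base_inj; rewrite j_linear !TP.
  by rewrite fixed_incl_linear.
have Sl : linear S.
  move=> a u v; apply: fixed_incl_inj; rewrite fixed_incl_linear !SP.
  by rewrite j_linear.
have Tb : bounded_op T.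
  apply/bounded_opP; exists 1 => // u.
  by rewrite mul1r -j_base_hn TP -(fixed_incl_hn u).
have Sb : bounded_op S.
  apply/bounded_opP; exists 1 => // w.
  by rewrite mul1r -fixed_incl_hn SP -(j_base_hn w).
have hsum_j f w : binv f -> @hsum R P pi f (j (e, w)) = j (e, A f w).
  move=> bf; have [fr fl [s fs]] := bf.
  have fE d : fk f e d = f (rep_iota d).
    by rewrite (fk_base _ fr fl) act_rep.
  rewrite (hsumE _ fs) (@j_hr f s e w bf); last 2 first.
  - by case: fs.
  - by move=> d ds; rewrite fE; exact: fsupp_rep fs ds.
  by apply: eq_bigr => c _; rewrite fE cv_j.
have TA f u : HA f -> T (hact f u) = A f (T u).
  move=> /HAP bf; apply: j_base_inj.
  by rewrite TP fixed_incl_hact// -TP hsum_j.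
have SA f w : HA f -> S (A f w) = hact f (S w).
  move=> /HAP bf; apply: fixed_incl_inj.
  by rewrite SP fixed_incl_hact// SP hsum_j.
pose Th : @cat_hom (positive_reps mu Delta) (fixed_positive_rep hmu hmuH hDelta pi) rho :=
  @Intertwiner R _ HA (positive_rep mu Delta) (fun r => hr_space r)
    (fun r => @hr_act R P mu Delta r) (fixed_positive_rep hmu hmuH hDelta pi) rho T Tl Tb TA.
pose Sh : @cat_hom (positive_reps mu Delta) rho (fixed_positive_rep hmu hmuH hDelta pi) :=
  @Intertwiner R _ HA (positive_rep mu Delta) (fun r => hr_space r)
    (fun r => @hr_act R P mu Delta r) rho (fixed_positive_rep hmu hmuH hDelta pi) S Sl Sb SA.
exists Th, Sh; split; apply: intertwiner_eq; apply/funext => u /=.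
  by apply: fixed_incl_inj; rewrite SP TP.
by apply: j_base_inj; rewrite TP SP.
Qed.

End InducedRepresentation.

Theorem corollary5p19 (R : realType) (P : heckePair)
    (mu : {measure set (borel P) -> \bar R}) (Delta : schlichting P -> R)
    (hP : reduced P) (hmu : left_haar mu) (hmuH : mu (@sch_sub P) = 1%E)
    (hDelta : modular_function mu Delta) :
  equivalent_categories (smooth_reps R P) (positive_reps mu Delta).
Proof.
apply: (fully_faithful_ess_surj_equivalence (F := fixed_functor hmu hmuH hDelta)).
- exact: fixed_functor_faithful.
- exact: fixed_functor_full.
- move=> rho.
  have [K [j [j_ip j_dense]]] := kolmogorov_decomposition
    (Wkernel_herm hmu hmuH hDelta (rho := rho)) (Wkernel_psd hmu hmuH hDelta (rho := rho)).
  exists (SmoothRep (induced_smooth j_ip j_dense)).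
  exact: fixed_induced_iso.
Qed.
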